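(* Let $f(s)=\alpha s^{2m}$ with $\alpha>0$ and $m\in\mathbb{N}$. Suppose that for some integer $n\ge 0$ the initial data satisfy $$(u_0,u_1)\in \mathscr{H}^n = \mathscr{D}(A^{(n+1)/2})\times \mathscr{D}(A^{n/2}).$$ Then for every $T>0$ there exists a unique weak solution $u$ on $[0,T]$, regular of order $n$ (that is, $(u,\dot u)\in C([0,T];\mathscr{H}^n)$), of the problem $$\ddot u-u_{xx}+f(u)\dot u=0 \ \text{ in } \Omega=(0,1),\ t>0,\qquad u(t,0)=u(t,1)=0,\qquad u(0,\cdot)=u_0,\ \dot u(0,\cdot)=u_1 .$$ Moreover $u\in S_T^n$; in particular, $u\in C^j([0,T];\mathscr{D}(A^{\frac{n+1-j}{2}}))$ for $j=0,1,\ldots,n$.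
   Context: $\Omega=(0,1)$; dots denote time derivatives. $A=-\partial_{xx}$ on $L^2(\Omega)$ with domain $\mathscr{D}(A)=W^{2,2}(\Omega)\cap H^1_0(\Omega)$; it has eigenvalues $\lambda_k=k^2\pi^2$ and orthonormal eigenfunctions $E_k(x)=\sqrt2\sin(k\pi x)$, $k\in\mathbb{N}$. Its powers $A^r$ are defined spectrally, $A^r(\sum c_kE_k)=\sum\lambda_k^r c_kE_k$, with $\mathscr{D}(A^r)=\{\sum c_kE_k:\sum \lambda_k^{2r}|c_k|^2<\infty\}$; $\mathscr{D}(A^{1/2})=H_0^1(\Omega)$ and $\mathscr{D}(A^0)=L^2(\Omega)$. $(\cdot,\cdot)_0$ is the $L^2(\Omega)$ inner product and $(u,v)_1=(u_x,v_x)_0$ the inner product on $H_0^1(\Omega)$. $S_T^n=\{z: z\in C^j([0,T];\mathscr{D}(A^{\frac{n+1-j}{2}}))\text{ for } j=0,1,\ldots,n+1\}$. Weak solution of the stated problem on $[0,T]$: a function $u\in C^1([0,T];L^2(\Omega))\cap C([0,T];H_0^1(\Omega))$ such that (i) $u(0,x)=u_0(x)$ and $\dot u(0,x)=u_1(x)$ for a.e. $x\in\Omega$; (ii) for every $\phi\in H_0^1(\Omega)$ the map $t\mapsto(\dot u(t),\phi)_0$ is absolutely continuous on $[0,T]$; (iii) for every $\phi\in H_0^1(\Omega)$, $\frac{d}{dt}(\dot u(t),\phi)_0+(u(t),\phi)_1+(f(u(t))\dot u(t),\phi)_0=0$ for a.e. $t\in(0,T)$. *)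

(* Defs.v *)
From HB Require Import structures.
From mathcomp Require Export all_boot all_order all_algebra.
From mathcomp Require Export all_classical all_reals all_analysis.
Export Order.TTheory GRing.Theory Num.Theory.
Export numFieldNormedType.Exports.

Set Implicit Arguments.
Unset Strict Implicit.
Unset Printing Implicit Defensive.

Local Open Scope classical_set_scope.
Local Open Scope ring_scope.

(* Elements of function spaces over Omega = ]0, 1[ are represented by total
   functions R -> R; only their values a.e. in Omega matter, since all norms,
   inner products and a.e. statements are taken for [muO]. A function of time
   with values in such a space is a map R -> R -> R (time first), of which only
   the times in [0, T] matter. *)

Section omega.
Context (R : realType).

(* Lebesgue measure restricted to Omega *)
Definition muO : set (measurableTypeR R) -> \bar R :=
  mrestr (@lebesgue_measure R) (measurable_itv `]0, 1[).
HB.instance Definition _ := Measure.on muO.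

Definition ip0 (g h : R -> R) : R := \int[muO]_x (g x * h x).

Definition norm0 (g : R -> R) : R := Num.sqrt (ip0 g g).

(* A function space with its norm, which is only meaningful on [carrier]. *)
Record fspace := FSpace { carrier :> (R -> R) -> Prop ; fnorm : (R -> R) -> R }.

Definition L2 : fspace :=
  FSpace [set g : R -> R | g \in Lfun muO 2%:E] norm0.

(* C_c^oo(Omega) *)
Definition test_fun : set (R -> R) := [set phi |
  (forall k x, derivable (derive1n k phi) x 1) /\
  (exists a b : R, [/\ 0 < a, b < 1 & forall x, phi x != 0 -> a <= x <= b])].

Definition is_wderiv (g h : R -> R) : Prop :=
  L2 h /\ forall phi, test_fun phi -> ip0 g (derive1 phi) = - ip0 h phi.

(* the weak derivative g_x; well defined up to a.e. equality *)
Definition wderiv (g : R -> R) : R -> R := xget 0 [set h | is_wderiv g h].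

Definition ip1 (g h : R -> R) : R := ip0 (wderiv g) (wderiv h).

Definition W12 : fspace :=
  FSpace [set g | L2 g /\ exists h, is_wderiv g h]
         (fun g => Num.sqrt (ip0 g g + ip1 g g)).

(* H^1_0(Omega), the closure of C_c^oo(Omega) in W^{1,2}(Omega), with the norm
   of (.,.)_1 *)
Definition H10 : fspace :=
  FSpace [set g | W12 g /\
            forall e : R, 0 < e ->
            exists2 phi, test_fun phi & fnorm W12 (g - phi) < e]
         (fun g => Num.sqrt (ip1 g g)).

(* Eigenvalues and orthonormal eigenfunctions of A, for k >= 1 *)
Definition lambda (k : nat) : R := k%:R ^+ 2 * pi ^+ 2.

Definition E (k : nat) (x : R) : R := Num.sqrt 2 * sin (k%:R * pi * x).

Definition coef (g : R -> R) (k : nat) : R := ip0 g (E k).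

(* D(A^r) for r >= 0: the g = \sum_(k >= 1) c_k E_k (in L^2) with
   \sum_(k >= 1) lambda_k^{2r} c_k^2 < oo, where orthonormality forces
   c_k = (g, E_k)_0. The norm is |A^r g|_0, which is equivalent to the graph
   norm of A^r because lambda_k >= pi^2. *)
Definition DA (r : R) : fspace :=
  FSpace [set g | [/\ L2 g,
            (fun N => norm0 (g - \sum_(1 <= k < N) coef g k *: E k)) @ \oo
              --> (0 : R) &
            (\sum_(1 <= k <oo) (lambda k `^ (2 * r) * coef g k ^+ 2)%:E
              < +oo)%E]]
         (fun g => Num.sqrt (fine
            (\sum_(1 <= k <oo) (lambda k `^ (2 * r) * coef g k ^+ 2)%:E)%E)).

(* script H^n = D(A^{(n+1)/2}) x D(A^{n/2}) *)
Definition Hdata (n : nat) (u0 u1 : R -> R) : Prop :=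
  DA (n.+1%:R / 2) u0 /\ DA (n%:R / 2) u1.

(* w is the derivative at t, in the norm of X, of z : [0, T] -> X (one-sided at
   the end points) *)
Definition is_tderiv (X : fspace) (T : R) (z : R -> R -> R) (t : R)
    (w : R -> R) : Prop :=
  X w /\ (fun s => fnorm X ((s - t)^-1 *: (z s - z t) - w))
           @ within `[0, T] t^' --> (0 : R).

(* the X-valued time derivative; well defined up to a.e. equality in Omega *)
Definition tderiv (X : fspace) (T : R) (z : R -> R -> R) (t : R) : R -> R :=
  xget 0 [set w | is_tderiv X T z t w].

Definition C0 (X : fspace) (T : R) (z : R -> R -> R) : Prop :=
  forall t, t \in `[0, T] ->
    X (z t) /\
    (fun s => fnorm X (z s - z t)) @ within `[0, T] (nbhs t) --> (0 : R).

(* C^j([0, T]; X) *)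
Fixpoint Cj (X : fspace) (T : R) (j : nat) (z : R -> R -> R) : Prop :=
  match j with
  | 0 => C0 X T z
  | j'.+1 => [/\ C0 X T z,
                 forall t, t \in `[0, T] -> exists w, is_tderiv X T z t w &
                 Cj X T j' (tderiv X T z)]
  end.

Definition S_space (T : R) (n : nat) (z : R -> R -> R) : Prop :=
  forall j, (j <= n.+1)%N -> Cj (DA ((n.+1 - j)%:R / 2)) T j z.

Definition abs_continuous (a b : R) (g : R -> R) : Prop :=
  forall e : R, 0 < e -> exists2 d : R, 0 < d &
    forall (N : nat) (x y : nat -> R),
      (forall i, (i < N)%N -> [/\ a <= x i, x i <= y i & y i <= b]) ->
      trivIset `I_N (fun i => `]x i, y i[%classic) ->
      \sum_(i < N) (y i - x i) < d ->
      \sum_(i < N) `|g (y i) - g (x i)| < e.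

(* weak solution on [0, T] of u'' - u_xx + f(u) u' = 0 with data u0, u1; the
   Dirichlet boundary condition is carried by H^1_0 *)
Definition weak_solution (f : R -> R) (u0 u1 : R -> R) (T : R)
    (u : R -> R -> R) : Prop :=
  let du := tderiv L2 T u in
  [/\ Cj L2 T 1 u /\ Cj H10 T 0 u,
      {ae muO, forall x, u 0 x = u0 x /\ du 0 x = u1 x},
      forall phi, H10 phi -> abs_continuous 0 T (fun t => ip0 (du t) phi) &
      forall phi, H10 phi ->
        {ae @lebesgue_measure R, forall t, t \in `]0, T[ ->
          derivable (fun s => ip0 (du s) phi) t 1 /\
          derive1 (fun s => ip0 (du s) phi) t + ip1 (u t) phi
            + ip0 (fun x => f (u t x) * du t x) phi = 0}].

(* (u, u') \in C([0, T]; script H^n), componentwise *)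
Definition regular (n : nat) (T : R) (u : R -> R -> R) : Prop :=
  Cj (DA (n.+1%:R / 2)) T 0 u /\ Cj (DA (n%:R / 2)) T 0 (tderiv L2 T u).

End omega.

Arguments L2 {R}.
Arguments H10 {R}.

(* Main.v *)
From HB Require Import structures.
Require Import Defs.
From mathcomp Require Import measurable_realfun.
From mathcomp Require Import ring lra zify.

(** In the sine basis a function of time with values in L^2 is a sequence of
scalar functions a_k(t), and the domain of A^{s/2} is the space of sequences
with sum_k omega_k^{2s} a_k^2 finite, where omega_k = (k + 1) pi. Writing b_k
for the coefficients of the velocity, the equation is the infinite system
a_k' = b_k, b_k' = - omega_k^2 a_k - g_k, where g is the coefficient sequence
of alpha u^{2m} u_t. For a known continuous forcing g every mode is solved by
Duhamel's formula, and the energy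
sum_k (omega_k^{s+1} a_k)^2 + (omega_k^s b_k)^2 satisfies a Gronwall estimate.
Hence Picard iteration converges on the whole of [0, T], and its limit is
unique, as soon as g depends on (a, b) with linear growth, is Lipschitz on
bounded sets and is continuous in time ([picard_exists], [picard_unique]).

For s = 0 these hypotheses hold once u is truncated at a height M inside the
coefficient, because sequences with sum_k omega_k^2 a_k^2 <= B belong to
functions bounded by the square root of B ([sup_bound]). Truncation keeps the
coefficient nonnegative, so the energy of the truncated solution does not
increase ([energy_decay]). Since the energy bounds the maximum of u, a height M
chosen from the initial energy is never reached, and the truncated solution
solves the original system on [0, T]: this is existence for n = 0.

Higher regularity is obtained by induction on n ([persistence]). For s >= 1 the
domain of A^{s/2} carries boundary conditions of odd type and need not be
stable under products of two factors; a product of three factors is odd again,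
and it is estimated by [triple_product], proved for sine polynomials by
integration by parts and the algebra property of Sobolev norms. If u is a
solution of level n, then multiplication by u^{2m} is bounded on the domain of
A^{(n+1)/2}; the linear problem with this known coefficient is therefore
solvable at level n + 1, and by uniqueness at level 0 its solution is u.

For the time derivatives ([Ckcf_solution]) one uses u'' = - A u - g and the
fact that g is the time derivative of alpha u^{2m+1} / (2m+1). An odd power of
u is a product of the admissible kind, so it has as many time derivatives as u
in any domain of A^{s/2} with s >= 1 in which u has them; this makes g, and
then u'', differentiable often enough for an induction on the number of time
derivatives.

Finally L^2, H^1_0 and the domains of A^{s/2} are all described by the size of
the sine coefficients ([level_L2], [level_H10], [level_DA]); this rests on the
completeness of the sine system ([sinm_complete]). The coefficients of a weak
solution satisfy the system for almost every t; absolute continuity upgrades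
this to every t ([ac_derivative]), so that [picard_unique] gives uniqueness
([weak_unique]). In the other direction, for phi in H^1_0 the partial sums of
(u_t, phi) have equicontinuous derivatives, and passing to the limit
([limit_derivative]) gives the weak equation at every time
([pairing_equation]). *)

Set Implicit Arguments.
Unset Strict Implicit.
Unset Printing Implicit Defensive.

Local Open Scope classical_set_scope.
Local Open Scope ring_scope.

(** * Square-integrable functions on the unit interval *)

Section L2_toolkit.
Context (R : realType).
Local Notation mu := (@muO R).
Implicit Types g h : R -> R.

Lemma muOT : mu setT = 1%E.
Proof.
rewrite /muO /mrestr setTI/= lebesgue_measure_itv /= lte_fin ltr01.
by rewrite oppr0 adde0.
Qed.

(** Finiteness makes constants integrable and gives the inclusion of L^2 in
L^1. *)
Lemma muO_fin : fin_num_fun mu.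
Proof.
by apply: lty_fin_num_fun; have /= -> := muOT; rewrite ltry.
Qed.

HB.instance Definition _ := @Measure_isFinite.Build _ _ _ mu muO_fin.

Lemma aeO_filter : Filter (almost_everywhere mu).
Proof. exact: (@ae_filter_ringOfSetsType _ _ _ (mu : {measure set _ -> \bar R})). Qed.

Lemma aeOS (P Q : R -> Prop) : (forall x, P x -> Q x) ->
  {ae mu, forall x, P x} -> {ae mu, forall x, Q x}.
Proof. exact: (@filterS _ _ aeO_filter). Qed.

Lemma aeOS2 (P Q S : R -> Prop) : (forall x, P x -> Q x -> S x) ->
  {ae mu, forall x, P x} -> {ae mu, forall x, Q x} -> {ae mu, forall x, S x}.
Proof. exact: (@filterS2 _ _ aeO_filter). Qed.

Lemma aeOT (P : R -> Prop) : (forall x, P x) -> {ae mu, forall x, P x}.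
Proof. by move=> H; apply: (@filterS _ _ aeO_filter setT) => //; exact: (@filterT _ _ aeO_filter). Qed.

Lemma aeO_exists (P : R -> Prop) : {ae mu, forall x, P x} -> exists x, P x.
Proof.
move=> [A [mA A0 /= sA]]; apply: contrapT => H.
have AT : A = setT.
  by apply/seteqP; split => // x _; apply: sA => /= Px; apply: H; exists x.
by have := @muOT; rewrite -AT A0 => /eqP; rewrite eqe eq_sym oner_eq0.
Qed.

Lemma L2_meas g : L2 g -> measurable_fun setT g.
Proof. by rewrite /L2/= inE => /andP[]; rewrite !inE. Qed.

Lemma L2P g : L2 g <-> measurable_fun setT g /\
  mu.-integrable setT (EFin \o (fun x => g x ^+ 2)).
Proof.
split=> [Lg|[mg ig]].
  by split; [exact: L2_meas|exact: Lfun2_integrable_sqr].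
rewrite /L2/= inE; apply/andP; split; rewrite inE//=.
rewrite /finite_norm unlock /Lnorm poweR_lty//.
under eq_integral => x _.
  rewrite /= powR_mulrn// real_normK ?num_real//.
over.
by have /integrable_lty := ig; apply.
Qed.

Lemma L2_mul_int g h : L2 g -> L2 h ->
  mu.-integrable setT (EFin \o (fun x => g x * h x)).
Proof.
move=> Lg Lh; have := Lfun2_mul_Lfun1 Lg Lh.
by move/Lfun1_integrable.
Qed.

Let L2_closed := @Lfun_submod_closed _ _ _ mu 2%:E (lee1n 2).

Lemma L2D g h : L2 g -> L2 h -> L2 (g + h).
Proof. by move=> Lg Lh; have := L2_closed.2 1 _ _ Lg Lh; rewrite scale1r. Qed.

Lemma L2Z (c : R) g : L2 g -> L2 (c *: g).
Proof. by move=> Lg; have := L2_closed.2 c _ _ Lg L2_closed.1; rewrite addr0. Qed.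

Lemma L2N g : L2 g -> L2 (- g).
Proof. by move=> Lg; rewrite -scaleN1r; exact: L2Z. Qed.

Lemma L2B g h : L2 g -> L2 h -> L2 (g - h).
Proof. by move=> Lg Lh; exact/L2D/L2N. Qed.

Lemma L20 : L2 (0 : R -> R).
Proof. exact: L2_closed.1. Qed.

Lemma L2_sum (I : Type) (s : seq I) (P : pred I) (F : I -> R -> R) :
  (forall i, P i -> L2 (F i)) -> L2 (\sum_(i <- s | P i) F i).
Proof. by move=> LF; elim/big_ind : _ => //; [exact: L20|exact: L2D]. Qed.

Lemma ip0C g h : ip0 g h = ip0 h g.
Proof. by rewrite /ip0; congr fine; apply: eq_integral => x _; rewrite mulrC. Qed.

Lemma ip0Dl g h k : L2 g -> L2 h -> L2 k -> ip0 (g + h) k = ip0 g k + ip0 h k.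
Proof.
move=> Lg Lh Lk; rewrite /ip0 -RintegralD//; [|exact: L2_mul_int..].
by congr fine; apply: eq_integral => x _; rewrite mulrDl.
Qed.

Lemma ip0Zl (c : R) g h : L2 g -> L2 h -> ip0 (c *: g) h = c * ip0 g h.
Proof.
move=> Lg Lh; rewrite /ip0 -RintegralZl//; last exact: L2_mul_int.
by congr fine; apply: eq_integral => x _; rewrite mulrA.
Qed.

Lemma ip0Nl g h : L2 g -> L2 h -> ip0 (- g) h = - ip0 g h.
Proof. by move=> Lg Lh; rewrite -scaleN1r ip0Zl// mulN1r. Qed.

Lemma ip0Bl g h k : L2 g -> L2 h -> L2 k -> ip0 (g - h) k = ip0 g k - ip0 h k.
Proof. by move=> *; rewrite ip0Dl// ?ip0Nl//; exact: L2N. Qed.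

Lemma ip0Dr g h k : L2 g -> L2 h -> L2 k -> ip0 k (g + h) = ip0 k g + ip0 k h.
Proof. by move=> *; rewrite ip0C ip0Dl// !(ip0C k). Qed.

Lemma ip0Zr (c : R) g h : L2 g -> L2 h -> ip0 g (c *: h) = c * ip0 g h.
Proof. by move=> *; rewrite ip0C ip0Zl// ip0C. Qed.

Lemma ip0Nr g h : L2 g -> L2 h -> ip0 g (- h) = - ip0 g h.
Proof. by move=> *; rewrite ip0C ip0Nl// ip0C. Qed.

Lemma ip0Br g h k : L2 g -> L2 h -> L2 k -> ip0 k (g - h) = ip0 k g - ip0 k h.
Proof. by move=> *; rewrite ip0C ip0Bl// !(ip0C k). Qed.

Lemma ip00l h : ip0 0 h = 0.
Proof.
rewrite /ip0 /Rintegral; under eq_integral do rewrite mul0r.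
by rewrite integral0.
Qed.

Lemma ip0_suml (I : Type) (s : seq I) (P : pred I) (F : I -> R -> R) h :
  (forall i, P i -> L2 (F i)) -> L2 h ->
  ip0 (\sum_(i <- s | P i) F i) h = \sum_(i <- s | P i) ip0 (F i) h.
Proof.
move=> LF Lh; suff [] : L2 (\sum_(i <- s | P i) F i) /\
  ip0 (\sum_(i <- s | P i) F i) h = \sum_(i <- s | P i) ip0 (F i) h by [].
apply: (big_rec2 (fun a b => L2 a /\ ip0 a h = b)).
  by split; [exact: L20|exact: ip00l].
move=> i y1 y2 Pi [L2y <-].
have LFi := LF _ Pi.
by split; [exact: L2D|rewrite ip0Dl].
Qed.

Lemma ip0_sumr (I : Type) (s : seq I) (P : pred I) (F : I -> R -> R) h :
  (forall i, P i -> L2 (F i)) -> L2 h ->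
  ip0 h (\sum_(i <- s | P i) F i) = \sum_(i <- s | P i) ip0 h (F i).
Proof.
move=> LF Lh; rewrite ip0C ip0_suml//.
by apply: eq_bigr => i _; rewrite ip0C.
Qed.

Lemma ip0_ge0 g : 0 <= ip0 g g.
Proof. by apply: Rintegral_ge0 => x _; rewrite -expr2 sqr_ge0. Qed.

(** The quadratic polynomial c -> (g + c h, g + c h) is nonnegative; evaluate
it at its minimum. *)
Lemma ip0_CS g h : L2 g -> L2 h -> ip0 g h ^+ 2 <= ip0 g g * ip0 h h.
Proof.
move=> Lg Lh.
have H (c : R) : 0 <= ip0 g g + c * 2 * ip0 g h + c ^+ 2 * ip0 h h.
  have := ip0_ge0 (g + c *: h).
  have Lch := L2Z c Lh; have Ls := L2D Lg Lch.
  rewrite ip0Dl// !ip0Dr// !ip0Zl// !ip0Zr// (ip0C h g).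
  by rewrite (_ : _ + (_ + _) = ip0 g g + c * 2 * ip0 g h + c ^+ 2 * ip0 h h)//; ring.
have [h0|h0] := eqVneq (ip0 h h) 0.
  rewrite h0 mulr0; have [->|gh0] := eqVneq (ip0 g h) 0; first by rewrite expr0n.
  have := H (- (ip0 g g + 1) / (2 * ip0 g h)).
  rewrite h0 mulr0 addr0.
  have -> : - (ip0 g g + 1) / (2 * ip0 g h) * 2 * ip0 g h = - (ip0 g g + 1).
    by field.
  by rewrite opprD addrA subrr sub0r ler0N1.
have hp : 0 < ip0 h h by rewrite lt_neqAle eq_sym h0 ip0_ge0.
have := H (- ip0 g h / ip0 h h).
have -> : ip0 g g + - ip0 g h / ip0 h h * 2 * ip0 g h +
  (- ip0 g h / ip0 h h) ^+ 2 * ip0 h h = ip0 g g - ip0 g h ^+ 2 / ip0 h h.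
  by field.
by rewrite subr_ge0 ler_pdivrMr.
Qed.

(** The parallelogram law without its nonnegative term. All norms below are
handled through their squares, and this inequality replaces the triangle
inequality. *)
Lemma ip0D2 g h : L2 g -> L2 h ->
  ip0 (g + h) (g + h) <= 2 * ip0 g g + 2 * ip0 h h.
Proof.
move=> Lg Lh; have := ip0_ge0 (g - h).
have Ls := L2D Lg Lh; have Ld := L2B Lg Lh.
rewrite ip0Bl// !ip0Br// ip0Dl// !ip0Dr// (ip0C h g); lra.
Qed.

Lemma ip0_ae g h g' h' : measurable_fun setT g -> measurable_fun setT h ->
  measurable_fun setT g' -> measurable_fun setT h' ->
  {ae mu, forall x, g x = g' x} -> {ae mu, forall x, h x = h' x} ->
  ip0 g h = ip0 g' h'.
Proof.
move=> mg mh mg' mh' gg' hh'; congr fine; apply: ae_eq_integral => //.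
- by apply/measurable_EFinP; exact: measurable_funM.
- by apply/measurable_EFinP; exact: measurable_funM.
- by apply: aeOS2 gg' hh' => x -> ->.
Qed.

Lemma le_ip0_ae g h : measurable_fun setT g -> L2 h ->
  {ae mu, forall x, g x ^+ 2 <= h x ^+ 2} -> L2 g /\ ip0 g g <= ip0 h h.
Proof.
move=> mg Lh gh; have [mh ih] := (L2P h).1 Lh.
have H : (\int[mu]_x (g x * g x)%:E <= \int[mu]_x (h x * h x)%:E)%E.
  apply: ae_ge0_le_integral => //.
  - by move=> x _; rewrite lee_fin -expr2 sqr_ge0.
  - by apply/measurable_EFinP; exact: measurable_funM.
  - by move=> x _; rewrite lee_fin -expr2 sqr_ge0.
  - by apply/measurable_EFinP; exact: measurable_funM.
  - by apply: aeOS gh => x + _; rewrite !expr2 lee_fin.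
have Lg : L2 g.
  apply/L2P; split => //; apply/integrableP; split.
    by apply/measurable_EFinP; exact: measurable_funX.
  under eq_integral do rewrite /= ger0_norm ?sqr_ge0// expr2.
  apply: le_lt_trans H _; have /integrable_lty := ih.
  by move=> /(_ measurableT); under eq_integral do rewrite /= expr2.
split => //; rewrite /ip0 /Rintegral fine_le//; apply: integrable_fin_num => //.
exact: L2_mul_int.
Qed.

Lemma L2_aebound (p g : R -> R) (M : R) : measurable_fun setT p -> L2 g ->
  {ae mu, forall x, p x ^+ 2 <= M} ->
  L2 (fun x => p x * g x) /\
  ip0 (fun x => p x * g x) (fun x => p x * g x) <= M * ip0 g g.
Proof.
move=> mp Lg pM.
have [M0|M0] := ltP M 0.
  by have [x] := aeO_exists pM; rewrite leNgt (lt_le_trans M0)// sqr_ge0.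
have Lsg := L2Z (Num.sqrt M) Lg.
have [||Lpg le] := @le_ip0_ae (fun x => p x * g x) (Num.sqrt M *: g) _ Lsg.
- by apply: measurable_funM => //; exact: L2_meas.
- apply: aeOS pM => x pM.
  by rewrite !exprMn sqr_sqrtr// ler_wpM2r// sqr_ge0.
split => //; apply: le_trans le _.
by rewrite ip0Zl// ip0Zr// mulrA -expr2 sqr_sqrtr.
Qed.

Lemma ip0_eq0 g : L2 g -> ip0 g g = 0 -> {ae mu, forall x, g x = 0}.
Proof.
move=> Lg g0; have [mg ig] := (L2P g).1 Lg.
have : (\int[mu]_x `| (g x ^+ 2)%:E |)%E = 0%E.
  under eq_integral do rewrite /= ger0_norm ?sqr_ge0//.
  have := integrable_fin_num measurableT ig => /fineK <-.
  congr EFin; rewrite -g0 /ip0 /Rintegral.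
  by congr fine; apply: eq_integral => x _ /=; rewrite expr2.
move/ae_eq_integral_abs => /(_ measurableT) [].
  by apply/measurable_EFinP; exact: measurable_funX.
move=> A [mA A0 sA]; exists A; split=> // x /= gx; apply: sA => /= /(_ I).
move=> -[] /eqP; rewrite sqrf_eq0 => /eqP; exact: gx.
Qed.

Lemma L2_bounded (g : R -> R) (M : R) : measurable_fun setT g ->
  {ae mu, forall x, g x ^+ 2 <= M ^+ 2} -> L2 g /\ ip0 g g <= M ^+ 2.
Proof.
move=> mg gM.
have L1 : L2 (cst M : R -> R) by exact: Lfun_cst.
have [Lg le] := le_ip0_ae mg L1 gM; split => //; apply: le_trans le _.
rewrite /ip0 (_ : (fun x => _) = cst (M ^+ 2)); last by apply/funext => x; rewrite expr2.
have /= -> := @Rintegral_cst _ _ R mu setT measurableT (M ^+ 2).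
by have /= -> := @muOT; rewrite mulr1.
Qed.

End L2_toolkit.

(** * Pointwise derivatives, integration by parts and the trigonometric systems *)

Section pointwise_derivatives.
Context (R : realType).
Implicit Types (F G : R -> R) (x f g c : R).

(** Differentiation is used with the value as an argument: a derivative is
computed by composing the rules below, and this lemma replaces the computed
value by the wanted one. *)
Lemma isd_eq F x f g : is_derive x 1 F f -> f = g -> is_derive x 1 F g.
Proof. by move=> + <-. Qed.

Lemma isd_val F x f : is_derive x 1 F f -> derive1 F x = f.
Proof. by move=> H; rewrite derive1E; exact: derive_val. Qed.

Lemma isd_derivable F x f : is_derive x 1 F f -> derivable F x 1.
Proof. by case. Qed.

Lemma derivable_isd F x : derivable F x 1 -> is_derive x 1 F (derive1 F x).
Proof. by move=> H; rewrite derive1E; exact: derivableP. Qed.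

Lemma isd_cvg F x f : is_derive x 1 F f -> {for x, continuous F}.
Proof. by move=> [/derivable1_diffP/differentiable_continuous]. Qed.

Lemma isd_cst c x : is_derive x 1 (fun _ : R => c) 0.
Proof. exact: is_derive_cst. Qed.

Lemma isd_id x : is_derive x 1 (fun y : R => y) 1.
Proof. exact: is_derive_id. Qed.

Lemma isdD F G x f g : is_derive x 1 F f -> is_derive x 1 G g ->
  is_derive x 1 (fun y => F y + G y) (f + g).
Proof. exact: is_deriveD. Qed.

Lemma isdN F x f : is_derive x 1 F f -> is_derive x 1 (fun y => - F y) (- f).
Proof. exact: is_deriveN. Qed.

Lemma isdB F G x f g : is_derive x 1 F f -> is_derive x 1 G g ->
  is_derive x 1 (fun y => F y - G y) (f - g).
Proof. by move=> *; apply: isdD => //; exact: isdN. Qed.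

Lemma isdM F G x f g : is_derive x 1 F f -> is_derive x 1 G g ->
  is_derive x 1 (fun y => F y * G y) (f * G x + F x * g).
Proof.
move=> Ff Gg; apply: (isd_eq (is_deriveM Ff Gg)).
by rewrite addrC/= -[F x *: g]/(F x * g) -[G x *: f]/(G x * f) (mulrC f).
Qed.

Lemma isdZ c F x f : is_derive x 1 F f -> is_derive x 1 (fun y => c * F y) (c * f).
Proof.
move=> Ff; apply: (isd_eq (isdM (isd_cst c x) Ff)); by rewrite mul0r add0r.
Qed.

Lemma isd_sqr F x f : is_derive x 1 F f ->
  is_derive x 1 (fun y => F y ^+ 2) (2 * F x * f).
Proof.
move=> Ff; rewrite (_ : (fun y => _) = (fun y => F y * F y)); last first.
  by apply/funext => y; rewrite expr2.
apply: (isd_eq (isdM Ff Ff)); ring.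
Qed.

Lemma isd_comp F G x f g : is_derive (G x) 1 F f -> is_derive x 1 G g ->
  is_derive x 1 (fun y => F (G y)) (f * g).
Proof. exact: is_derive1_comp. Qed.

Lemma isd_sum (I : Type) (s : seq I) (P : pred I) (F : I -> R -> R) (f : I -> R) x :
  (forall i, P i -> is_derive x 1 (F i) (f i)) ->
  is_derive x 1 (fun y => \sum_(i <- s | P i) F i y) (\sum_(i <- s | P i) f i).
Proof.
move=> H; rewrite (_ : (fun y => _) = \sum_(i <- s | P i) F i); last first.
  by apply/funext => y; rewrite fct_sumE.
by elim/big_rec2: _ => [|i a b Pi Hb]; [exact: isd_cst|exact: isdD (H _ Pi) Hb].
Qed.

Lemma isd_continuous F (f : R -> R) : (forall x, is_derive x 1 F (f x)) -> continuous F.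
Proof. by move=> H x; exact: isd_cvg (H x). Qed.

Lemma isd_near F G x f : (\forall y \near x, F y = G y) -> is_derive x 1 F f ->
  is_derive x 1 G f.
Proof.
move=> FG [df vf].
have GF : \forall y \near x, G y = F y by apply: filterS FG => y ->.
split; last by rewrite -vf; exact: near_eq_derive.
exact: near_eq_derivable df.
Qed.

End pointwise_derivatives.

Section interval_integrals.
Context (R : realType).
Local Notation mu := (@muO R).
Local Notation leb := (@lebesgue_measure R).
Implicit Types g h F f : R -> R.

Lemma aeO_itv (P : R -> Prop) :
  (forall x, 0 < x -> x < 1 -> P x) -> {ae mu, forall x, P x}.
Proof.
move=> H; exists (~` `]0, 1[); split.
- by apply: measurableC; exact: measurable_itv.
- by rewrite /= /muO /mrestr setICl measure0.
- move=> x /= nP; rewrite in_itv/= => /andP[x0 x1]; exact/nP/H.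
Qed.

Lemma leb_aeO (P : R -> Prop) :
  {ae leb, forall x, x \in `]0, 1[ -> P x} -> {ae mu, forall x, P x}.
Proof.
move=> [A [mA A0 sA]]; exists (A `|` ~` `]0, 1[); split => //.
- by apply: measurableU => //; apply: measurableC; exact: measurable_itv.
- rewrite /= /muO /mrestr setIUl setICl setU0.
  apply/eqP; rewrite -measure_le0 -A0; apply: le_measure; rewrite ?inE//.
  by apply: measurableI => //; exact: measurable_itv.
- move=> x /= nP; have [x01|x01] := boolP (x \in `]0, 1[); last by right; apply/negP.
  by left; apply: sA => /= /(_ x01).
Qed.

Lemma Rintegral_muO f : mu.-integrable setT (EFin \o f) ->
  \int[mu]_x f x = \int[leb]_(x in `]0, 1[) f x.
Proof.
move=> fi; rewrite /Rintegral; congr fine.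
have mI : measurable (`]0, 1[ : set (measurableTypeR R)) by exact: measurable_itv.
rewrite (negligible_integral (measurableC mI) measurableT fi); last first.
  by rewrite /= /muO /mrestr setICl measure0.
rewrite setTD setCK; apply: eq_measure_integral => A mA AI.
by rewrite /= /muO /mrestr setIidl.
Qed.

Lemma Rintegral_muO_itv f : mu.-integrable setT (EFin \o f) ->
  measurable_fun setT f ->
  \int[mu]_x f x = \int[leb]_(x in `[0, 1]) f x.
Proof.
move=> fi mf; rewrite Rintegral_muO// /Rintegral.
rewrite -integral_itv_obnd_cbnd ?integral_itv_bndo_bndc//.
- by apply/measurable_EFinP; apply: measurable_funS mf.
- by apply/measurable_EFinP; apply: measurable_funS mf.
Qed.

Lemma itv_bounded f : continuous f -> exists M : R, forall x, 0 <= x <= 1 -> `|f x| <= M.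
Proof.
move=> cf.
have cf' : {within `[0, 1], continuous (fun x => `|f x|)}.
  apply: continuous_subspaceT => x.
  by apply: continuous_comp; [exact: cf|exact: norm_continuous].
have [c _ H] := @EVT_max R _ _ _ ler01 cf'.
by exists `|f c| => x x01; apply: H; rewrite in_itv.
Qed.

Lemma continuous_meas f : continuous f -> measurable_fun setT f.
Proof. exact: continuous_measurable_fun. Qed.

Lemma L2_continuous f : continuous f -> L2 f.
Proof.
move=> cf; have [M HM] := itv_bounded cf.
have [] := @L2_bounded R f M (continuous_meas cf).
  apply: aeO_itv => x x0 x1; rewrite -(real_normK (num_real (f x))).
  by rewrite ler_sqr ?nnegrE ?(le_trans (normr_ge0 (f x)))// HM// !ltW.
by [].
Qed.

Lemma L2_int f : L2 f -> mu.-integrable setT (EFin \o f).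
Proof.
move=> Lf; have := L2_mul_int Lf (L2_continuous (@cst_continuous _ _ (1 : R))).
by apply: eq_integrable => // x _ /=; rewrite mulr1.
Qed.

Lemma int_deriv F f : (forall x : R, is_derive x 1 F (f x)) -> continuous f ->
  \int[mu]_x f x = F 1 - F 0.
Proof.
move=> Ff cf; have Lf := L2_continuous cf.
rewrite Rintegral_muO_itv; [|exact: L2_int|exact: L2_meas].
rewrite /Rintegral (@continuous_FTC2 _ f F 0 1 ltr01)//.
- exact: continuous_subspaceT.
- have cF := isd_continuous Ff; split.
  + by move=> x _; exact: isd_derivable (Ff x).
  + by apply: cvg_at_right_filter; exact: cF.
  + by apply: cvg_at_left_filter; exact: cF.
- by move=> x _; exact: isd_val.
Qed.

Lemma continuousD f g : continuous f -> continuous g -> continuous (fun x => f x + g x).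
Proof. by move=> cf cg x; apply: cvgD; [exact: cf|exact: cg]. Qed.

Lemma continuousM f g : continuous f -> continuous g -> continuous (fun x => f x * g x).
Proof. by move=> cf cg x; apply: cvgM; [exact: cf|exact: cg]. Qed.

Lemma ip0_parts F G f g : (forall x : R, is_derive x 1 F (f x)) ->
  (forall x : R, is_derive x 1 G (g x)) -> continuous f -> continuous g ->
  ip0 F g = F 1 * G 1 - F 0 * G 0 - ip0 f G.
Proof.
move=> Ff Gg cf cg.
have cF := isd_continuous Ff; have cG := isd_continuous Gg.
have H := @int_deriv (fun x => F x * G x) (fun x => f x * G x + F x * g x)
  (fun x => isdM (Ff x) (Gg x)).
rewrite -H; last by apply: continuousD; exact: continuousM.
rewrite RintegralD//; first by rewrite /ip0; ring.
all: by apply: L2_mul_int; exact: L2_continuous.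
Qed.

End interval_integrals.

Section trigonometric_systems.
Context (R : realType).
Local Notation mu := (@muO R).

Fact om_key : unit. Proof. exact: tt. Qed.
(** The square root of the eigenvalue of index k + 1. It is opaque so that sums
of its powers are compared as such, without expanding k.+1%:R * pi. *)
Definition om (k : nat) : R := locked_with om_key (k.+1%:R * pi).
Lemma omE k : om k = k.+1%:R * pi. Proof. by rewrite /om locked_withE. Qed.
(** The eigenfunctions, numbered from 0. *)
Definition sinm (k : nat) : R -> R := E k.+1.
(** The normalized derivatives of the eigenfunctions; they are orthonormal as
well and expand the space derivatives of functions vanishing at 0 and 1. *)
Definition cosm (k : nat) (x : R) : R := Num.sqrt 2 * cos (om k * x).

Lemma om_gt0 k : 0 < om k. Proof. by rewrite omE mulr_gt0// ?ltr0n// pi_gt0. Qed.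

Lemma om_ge1 k : 1 <= om k.
Proof.
rewrite omE -natr1 mulrDl mul1r.
have := @pi_ge2 R; have : 0 <= k%:R * pi :> R by rewrite mulr_ge0// pi_ge0.
lra.
Qed.

Lemma sinmE k (x : R) : sinm k x = Num.sqrt 2 * sin (om k * x). Proof. by rewrite omE. Qed.

Lemma isd_sin_om k (x : R) : is_derive x 1 (fun y => sin (om k * y)) (om k * cos (om k * x)).
Proof.
apply: (isd_eq (isd_comp (is_derive_sin _) (isdZ (om k) (isd_id x)))).
by rewrite mulr1 mulrC.
Qed.

Lemma isd_cos_om k (x : R) : is_derive x 1 (fun y => cos (om k * y)) (- (om k * sin (om k * x))).
Proof.
apply: (isd_eq (isd_comp (is_derive_cos _) (isdZ (om k) (isd_id x)))).
by rewrite mulr1 mulrC mulrN.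
Qed.

Lemma isd_sinm k (x : R) : is_derive x 1 (sinm k) (om k * cosm k x).
Proof.
rewrite (_ : sinm k = (fun y => Num.sqrt 2 * sin (om k * y))); last exact/funext/sinmE.
by apply: (isd_eq (isdZ _ (isd_sin_om k x))); rewrite mulrCA. Qed.

Lemma isd_cosm k (x : R) : is_derive x 1 (cosm k) (- (om k * sinm k x)).
Proof. by apply: (isd_eq (isdZ _ (isd_cos_om k x))); rewrite mulrN sinmE mulrCA. Qed.

Lemma continuous_sinm k : continuous (sinm k). Proof. exact: isd_continuous (isd_sinm k). Qed.
Lemma continuous_cosm k : continuous (cosm k). Proof. exact: isd_continuous (isd_cosm k). Qed.

Lemma L2_sinm k : L2 (sinm k). Proof. exact/L2_continuous/continuous_sinm. Qed.
Lemma L2_cosm k : L2 (cosm k). Proof. exact/L2_continuous/continuous_cosm. Qed.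

Lemma sinm0 k : sinm k 0 = 0. Proof. by rewrite sinmE mulr0 sin0 mulr0. Qed.

Lemma sin_natpi (k : nat) : sin (k%:R * pi) = 0 :> R.
Proof.
elim: k => [|k IH]; first by rewrite mul0r sin0.
by rewrite -natr1 mulrDl mul1r sinDpi IH oppr0.
Qed.

Lemma sinm1 k : sinm k 1 = 0. Proof. by rewrite sinmE mulr1 omE sin_natpi mulr0. Qed.

(** Both sides come from one integration by parts of cosm k against sinm l,
whose boundary terms vanish. Exchanging k and l gives two equations, which
force orthogonality when the frequencies differ. *)
Lemma ip0_cparts k l : om k * ip0 (cosm k) (cosm l) = om l * ip0 (sinm k) (sinm l).
Proof.
have H := @ip0_parts R (sinm k) (cosm l) (fun x => om k * cosm k x) (fun x => - (om l * sinm l x))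
   (isd_sinm k) (isd_cosm l).
have ck := @continuous_cosm k; have cl := @continuous_cosm l.
have ek := @continuous_sinm k; have el := @continuous_sinm l.
have {H} := H _ _; rewrite sinm0 sinm1 !mul0r subrr sub0r.
have -> : (fun x => - (om l * sinm l x)) = - (om l *: sinm l) by [].
have -> : (fun x => om k * cosm k x) = om k *: cosm k by [].
have Le := L2_sinm; have Lc := L2_cosm; have L1 := L2Z (om l) (Le l).
rewrite (ip0Nr (Le k) L1) (ip0Zr (om l) (Le k) (Le l)) (ip0Zl (om k) (Lc k) (Lc l)).
move=> H; apply: oppr_inj; rewrite H//.
- by move=> x; apply: cvgZl_tmp; exact: ck.
- by move=> x; apply: cvgN; apply: cvgZl_tmp; exact: el.
Qed.

Lemma om_inj k l : om k = om l -> k = l.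
Proof.
rewrite !omE => /mulIf; have -> : (pi : R) != 0 by rewrite gt_eqF// pi_gt0.
by move=> /(_ isT)/eqP; rewrite eqr_nat => /eqP[].
Qed.

(** For k <> l the relation of [ip0_cparts] and its mirror image form a
homogeneous 2 x 2 system with nonzero determinant. For k = l they say that the
two norms agree, and the norms add up to 2 because the squares of sine and
cosine add up to 1. *)
Lemma ip0_trig k l : ip0 (sinm k) (sinm l) = (k == l)%:R /\ ip0 (cosm k) (cosm l) = (k == l)%:R.
Proof.
have H1 := ip0_cparts k l.
have H2 := ip0_cparts l k; rewrite ip0C (ip0C (sinm l)) in H2.
have [kl|kl] := eqVneq k l; last first.
  have H : (om k ^+ 2 - om l ^+ 2) * ip0 (cosm k) (cosm l) = 0.
    rewrite (_ : _ * _ = om k * (om k * ip0 (cosm k) (cosm l)) - om l * (om l * ip0 (cosm k) (cosm l))); last by ring.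
    by rewrite H1 H2 mulrCA subrr.
  have c0 : ip0 (cosm k) (cosm l) = 0.
    move: H => /eqP; rewrite mulf_eq0 => /orP[|/eqP//].
    rewrite subr_eq0 eqrXn2 ?ltW ?om_gt0// => /eqP/om_inj.
    by move=> E; rewrite E eqxx in kl.
  split => //; have := H1; rewrite c0 mulr0 => /esym/eqP.
  by rewrite mulf_eq0 gt_eqF ?om_gt0//= => /eqP.
rewrite -kl in H1 *; rewrite /=.
have {}H1 : ip0 (cosm k) (cosm k) = ip0 (sinm k) (sinm k).
  by apply: (mulfI _ H1); rewrite gt_eqF ?om_gt0.
suff : ip0 (cosm k) (cosm k) + ip0 (sinm k) (sinm k) = 2.
  by rewrite H1 => H; split; lra.
have Le := L2_sinm k; have Lc := L2_cosm k.
rewrite /ip0 -RintegralD//; [|exact: L2_mul_int..].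
rewrite -(_ : 2 * fine (mu setT) = 2 :> R); last by have /= -> := @muOT R; rewrite mulr1.
rewrite -Rintegral_cst//; congr fine; apply: eq_integral => x _; congr EFin.
rewrite !sinmE /cosm -!expr2 !exprMn sqr_sqrtr// -mulrDr.
by rewrite cos2Dsin2 mulr1.
Qed.

Lemma ip0_sinm k l : ip0 (sinm k) (sinm l) = (k == l)%:R. Proof. by have [] := ip0_trig k l. Qed.
Lemma ip0_cosm k l : ip0 (cosm k) (cosm l) = (k == l)%:R. Proof. by have [] := ip0_trig k l. Qed.

End trigonometric_systems.
Arguments om {R} k.
Arguments sinm {R} k x.
Arguments cosm {R} k x.

(** * Square-summable sequences and the Riesz-Fischer theorem *)

Section square_summable.
Context (R : realType).
Implicit Types a b : nat -> R.

(** Square summability with a bound on the sum of squares, phrased with partial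
sums so that no infinite series appears. *)
Definition ssq a (B : R) := forall N, \sum_(k < N) a k ^+ 2 <= B.

Lemma ssq_ge0 a B : ssq a B -> 0 <= B.
Proof. by move=> /(_ 0%N); rewrite big_ord0. Qed.

Lemma ssq_le a B B' : ssq a B -> B <= B' -> ssq a B'.
Proof. by move=> H BB' N; exact: le_trans (H N) BB'. Qed.

Lemma ssq0 : ssq (fun _ => 0) 0.
Proof. by move=> N; rewrite big1// => i _; rewrite expr0n. Qed.

Lemma ssqD a b A B : ssq a A -> ssq b B -> ssq (fun k => a k + b k) (2 * A + 2 * B).
Proof.
move=> aA bB N; apply: (@le_trans _ _ (2 * \sum_(k < N) a k ^+ 2 + 2 * \sum_(k < N) b k ^+ 2)).
  rewrite !mulr_sumr -big_split; apply: ler_sum => i _ /=.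
  have := sqr_ge0 (a i - b i); lra.
by apply: lerD; apply: ler_wpM2l.
Qed.

Lemma ssqZ a A (c : R) : ssq a A -> ssq (fun k => c * a k) (c ^+ 2 * A).
Proof.
move=> aA N; under eq_bigr do rewrite exprMn.
by rewrite -mulr_sumr ler_wpM2l ?sqr_ge0.
Qed.

Lemma ssq_dom a b B : ssq b B -> (forall k, a k ^+ 2 <= b k ^+ 2) -> ssq a B.
Proof. by move=> H ab N; apply: le_trans (H N); apply: ler_sum => i _. Qed.

Lemma ssq_sum_le a B N M : ssq a B -> \sum_(N <= k < M) a k ^+ 2 <= B.
Proof.
move=> aB; have S0 (m n : nat) : 0 <= \sum_(m <= k < n) a k ^+ 2.
  by apply: sumr_ge0 => i _; exact: sqr_ge0.
have [MN|NM] := leqP M N; first by rewrite big_geq//; exact: ssq_ge0 aB.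
apply: le_trans (aB M); rewrite -(big_mkord xpredT (fun k => a k ^+ 2)).
by rewrite (big_cat_nat (leq0n N) (ltnW NM))/= lerDr.
Qed.

(** If every tail contained a block of size eps, then arbitrarily many disjoint
blocks would exceed B. *)
Lemma ssq_tail a B : ssq a B -> forall eps : R, 0 < eps ->
  exists N0, forall N M, (N0 <= N)%N -> \sum_(N <= k < M) a k ^+ 2 <= eps.
Proof.
move=> aB eps e0; apply: contrapT => H.
have {}H N0 : exists M, (N0 <= M)%N /\ eps < \sum_(N0 <= k < M) a k ^+ 2.
  apply: contrapT => H1; apply: H; exists N0 => N M N0N.
  have [MN|NM] := leqP M N; first by rewrite big_geq// ltW.
  rewrite leNgt; apply/negP => H2; apply: H1; exists M.
  split; first exact: leq_trans N0N (ltnW NM).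
  apply: lt_le_trans H2 _.
  rewrite (big_cat_nat N0N (ltnW NM))/= lerDr.
  by apply: sumr_ge0 => i _; exact: sqr_ge0.
have G n : exists M, n%:R * eps <= \sum_(0 <= k < M) a k ^+ 2.
  elim: n => [|n [M IH]]; first by exists 0%N; rewrite mul0r big_geq.
  have [M' [MM' H2]] := H M; exists M'.
  rewrite (big_cat_nat (leq0n M) MM')/= -natr1 mulrDl mul1r.
  exact: lerD IH (ltW H2).
have := ssq_ge0 aB => B0.
have [M HM] := G (Num.trunc (B / eps)).+1.
have := le_trans HM (ssq_sum_le 0 M aB).
have := truncnS_gt (B / eps); rewrite ltr_pdivrMr//.
by move=> /lt_le_trans H1 /H1; rewrite ltxx.
Qed.

Lemma ssq_CS a b A B N M : ssq a A -> ssq b B ->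
  (\sum_(N <= k < M) a k * b k) ^+ 2 <= A * B.
Proof.
move=> aA bB.
set x := \sum_(N <= k < M) a k ^+ 2; set y := \sum_(N <= k < M) b k ^+ 2.
set z := \sum_(N <= k < M) _.
have H (t : R) : 0 <= x + 2 * t * z + t ^+ 2 * y.
  rewrite /x /y /z !mulr_sumr -!big_split sumr_ge0// => i _ /=.
  rewrite (_ : _ + _ + _ = (a i + t * b i) ^+ 2) ?sqr_ge0//; ring.
have x0 : 0 <= x by apply: sumr_ge0 => i _; exact: sqr_ge0.
have y0 : 0 <= y by apply: sumr_ge0 => i _; exact: sqr_ge0.
have xA : x <= A by exact: ssq_sum_le.
have yB : y <= B by exact: ssq_sum_le.
suff zxy : z ^+ 2 <= x * y by apply: le_trans zxy _; exact: ler_pM.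
have [y1|y1] := eqVneq y 0.
  rewrite y1 mulr0; have [->|z0] := eqVneq z 0; first by rewrite expr0n.
  have := H (- (x + 1) / (2 * z)).
  rewrite y1 mulr0 addr0.
  have -> : 2 * (- (x + 1) / (2 * z)) * z = - (x + 1) by field.
  by rewrite opprD addrA subrr sub0r ler0N1.
have yp : 0 < y by rewrite lt_neqAle eq_sym y1.
have := H (- z / y).
have -> : x + 2 * (- z / y) * z + (- z / y) ^+ 2 * y = x - z ^+ 2 / y by field.
by rewrite subr_ge0 ler_pdivrMr.
Qed.

End square_summable.

Section Riesz_Fischer.
Context (R : realType).
Local Notation mu := (@muO R).
Variable f : nat -> R -> R.
Hypothesis Lf : forall k, L2 (f k).
Hypothesis of_ : forall k l, ip0 (f k) (f l) = (k == l)%:R.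
Implicit Types (a : nat -> R) (g h : R -> R).

Definition psum a N : R -> R := \sum_(k < N) a k *: f k.

Lemma L2_psum a N : L2 (psum a N).
Proof. by apply: L2_sum => k _; exact: L2Z. Qed.

Lemma L2_span a N M : L2 (\sum_(N <= k < M) a k *: f k).
Proof. by apply: L2_sum => k _; exact: L2Z. Qed.

Lemma ip0_span a N M : ip0 (\sum_(N <= k < M) a k *: f k) (\sum_(N <= k < M) a k *: f k)
  = \sum_(N <= k < M) a k ^+ 2.
Proof.
have L k : L2 (a k *: f k) by exact: L2Z.
rewrite ip0_suml//; last exact: L2_span.
apply: eq_big_nat => i NiM; rewrite ip0_sumr//.
rewrite (bigD1_seq i) ?iota_uniq ?mem_index_iota//=.
rewrite ip0Zl// ip0Zr// of_ eqxx mulr1 big1 ?addr0 ?expr2// => j ji.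
by rewrite ip0Zl// ip0Zr// of_ eq_sym (negbTE ji) !mulr0.
Qed.

Lemma psumB a N M : (N <= M)%N -> psum a M - psum a N = \sum_(N <= k < M) a k *: f k.
Proof.
move=> NM; rewrite /psum -!(big_mkord xpredT (fun k => a k *: f k)).
by rewrite (big_cat_nat (leq0n N) NM)/= addrAC subrr add0r.
Qed.

(** The square norm of g minus its projection is nonnegative. *)
Lemma Bessel g : L2 g -> ssq (fun k => ip0 g (f k)) (ip0 g g).
Proof.
move=> Lg N; pose a k := ip0 g (f k).
have := ip0_ge0 (g - psum a N).
have Lp := L2_psum a N.
rewrite ip0Bl ?ip0Br//; try exact: L2B.
have -> : ip0 (psum a N) (psum a N) = \sum_(k < N) a k ^+ 2.
  rewrite /psum -(big_mkord xpredT (fun k => a k *: f k)) ip0_span.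
  by rewrite big_mkord.
have -> : ip0 g (psum a N) = \sum_(k < N) a k ^+ 2.
  rewrite ip0_sumr//; last by move=> i _; exact: L2Z.
  by apply: eq_bigr => i _; rewrite ip0Zr// expr2.
rewrite (ip0C _ g).
have -> : ip0 g (psum a N) = \sum_(k < N) a k ^+ 2.
  rewrite ip0_sumr//; last by move=> i _; exact: L2Z.
  by apply: eq_bigr => i _; rewrite ip0Zr// expr2.
by rewrite subrr subr0 subr_ge0.
Qed.

Lemma fatou_L2 (h : nat -> R -> R) (g : R -> R) (e : R) :
  (forall j, L2 (h j)) -> measurable_fun setT g ->
  {ae mu, forall x, (h j x @[j --> \oo] --> g x)} ->
  (\forall j \near \oo, ip0 (h j) (h j) <= e) ->
  L2 g /\ ip0 g g <= e.
Proof.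
move=> Lh mg hg he.
have mh j : measurable_fun setT (fun x => (h j x ^+ 2)%:E).
  by apply/measurable_EFinP; apply: measurable_funX; exact: L2_meas.
have mlim : measurable_fun setT (fun x => limn_einf (fun j => (h j x ^+ 2)%:E)).
  rewrite (_ : (fun x => _) = (fun x => - limn_esup (fun j => - (h j x ^+ 2)%:E))%E); last first.
    by apply/funext => x; rewrite /limn_einf.
  apply: measurableT_comp => //; apply: measurable_fun_limn_esup => j.
  exact: measurableT_comp.
have F := @fatou _ _ _ mu setT measurableT (fun j x => (h j x ^+ 2)%:E) mh _.
have {F}F : (\int[mu]_x (g x ^+ 2)%:E <= e%:E)%E.
  have -> : (\int[mu]_x (g x ^+ 2)%:E =
             \int[mu]_x limn_einf (fun j => (h j x ^+ 2)%:E))%E.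
    apply: ae_eq_integral => //.
      by apply/measurable_EFinP; exact: measurable_funX.
    apply: aeOS hg => x hx _; apply/esym; apply: (cvg_limn_einf_sup _).1.
    by apply/cvg_EFin; [exact: nearW|]; under eq_fun do rewrite expr2; rewrite expr2; exact: cvgM.
  apply: le_trans (F _) _; first by move=> j x _; rewrite lee_fin sqr_ge0.
  rewrite limn_einf_lim; apply: lime_le; first exact: is_cvg_einfs.
  near=> n; apply: (@le_trans _ _ (\int[mu]_x (h n x ^+ 2)%:E)%E).
    by apply: ereal_inf_lbound; exists n => /=.
  rewrite -[leLHS]fineK; last exact/integrable_fin_num/((L2P _).1 (Lh n)).2.
  rewrite lee_fin; apply: le_trans (_ : _ <= ip0 (h n) (h n)) _; last by near: n.
  by rewrite le_eqVlt; apply/orP; left; apply/eqP; congr fine.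
have Lg : L2 g.
  apply/L2P; split => //; apply/integrableP; split.
    by apply/measurable_EFinP; exact: measurable_funX.
  under eq_integral do rewrite /= ger0_norm ?sqr_ge0//.
  exact: le_lt_trans F (ltry _).
split => //; rewrite -lee_fin; apply: le_trans F.
rewrite /ip0 /Rintegral fineK; last exact/integrable_fin_num/L2_mul_int.
by under eq_integral do rewrite -expr2.
Unshelve. all: end_near. Qed.

(** The tail estimate comes with the limit: it is the only form of convergence
needed later, and it contains both membership in L^2 and the bound on the norm.
The partial sums along a rapid subsequence have increments summable in L^1, so
they converge almost everywhere, and Fatou's lemma transfers every tail
estimate to the limit. *)
Lemma riesz_fischer a B : ssq a B -> exists g, L2 g /\
  forall N (eps : R), (forall M, \sum_(N <= k < M) a k ^+ 2 <= eps) ->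
    ip0 (g - psum a N) (g - psum a N) <= eps.
Proof.
move=> aB.
pose q (j : nat) : R := 2^-1 ^+ j.
have q0 j : 0 < q j by rewrite exprn_gt0// invr_gt0.
have [n nP] : exists n : nat -> nat, forall j N M, (n j <= N)%N ->
    \sum_(N <= k < M) a k ^+ 2 <= q j ^+ 2.
  have /choice[n nP] : forall j, exists N0, forall N M, (N0 <= N)%N ->
    \sum_(N <= k < M) a k ^+ 2 <= q j ^+ 2.
    by move=> j; apply: (ssq_tail aB); rewrite exprn_gt0.
  by exists n.
(* a nondecreasing choice of ranks beyond n j *)
pose m j := (\sum_(i < j.+1) n i + j)%N.
have nm j : (n j <= m j)%N by rewrite /m big_ord_recr/= -addnA addnC -addnA leq_addr.
have mS j : (m j <= m j.+1)%N.
  by rewrite /m [X in (_ <= X + _)%N]big_ord_recr/= -addnA leq_add2l addnS leqW// leq_addl.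
pose b j : R -> R := psum a (m j.+1) - psum a (m j).
have Lb j : L2 (b j) by apply: L2B; exact: L2_psum.
have bq j : ip0 (b j) (b j) <= q j ^+ 2.
  by rewrite /b psumB// ip0_span; exact: nP.
(* 2 q |b| <= b^2 + q^2 turns the L^2 bound into an L^1 bound *)
have ib j : (\int[mu]_x `|(b j x)%:E| <= (q j)%:E)%E.
  have L1 : L2 (cst (q j) : R -> R) by apply: L2_continuous; exact: cst_continuous.
  have -> : (q j)%:E = (\int[mu]_x (2^-1 * (q j)^-1 * q j ^+ 2 + q j / 2)%:E)%E.
    rewrite integral_cst//; have /= -> := @muOT R.
    by rewrite mule1; congr EFin; field; rewrite gt_eqF.
  have i2 := ((L2P _).1 (Lb j)).2.
  apply: (@le_trans _ _ (\int[mu]_x ((2^-1 * (q j)^-1)%:E * (b j x ^+ 2)%:E + (q j / 2)%:E))%E).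
    apply: ge0_le_integral => //.
    - by apply: measurableT_comp => //; apply/measurable_EFinP; exact: L2_meas.
    - apply: emeasurable_funD => //; apply: emeasurable_funM => //.
      exact: measurable_int i2.
    - move=> x _; rewrite -EFinM -EFinD lee_fin.
      have := sqr_ge0 (`|b j x| - q j); rewrite sqrrB real_normK ?num_real// => H.
      rewrite -(ler_pM2l (_ : 0 < 2 * q j)) ?mulr_gt0//.
      have -> : 2 * q j * (2^-1 / q j * b j x ^+ 2 + q j / 2) = b j x ^+ 2 + q j ^+ 2.
        by field; rewrite gt_eqF.
      have := H; rewrite -mulr_natl => {}H; lra.
  rewrite integralD//; last 2 first.
  - exact: integrableZl.
  - exact: finite_measure_integrable_cst.
  rewrite integralZl// -[X in ((_ * X) + _)%E]fineK; last exact: integrable_fin_num.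
  rewrite !integral_cst//; have /= -> := @muOT R.
  rewrite !mule1 -EFinM -EFinD lee_fin lerD2r; apply: ler_wpM2l.
    by rewrite mulr_ge0// invr_ge0 ltW.
  by apply: le_trans (bq j); rewrite le_eqVlt; apply/orP; left; apply/eqP; congr fine.
have bsum : {ae mu, forall x, cvgn (series (fun j => b j x))}.
  have mb j : measurable_fun setT (fun x => `|(b j x)%:E|%E).
    by apply: measurableT_comp => //; apply/measurable_EFinP; exact: L2_meas.
  have Sfin : (\int[mu]_x (\sum_(j <oo) `|(b j x)%:E|) < +oo)%E.
    rewrite integral_nneseries//; apply: (@le_lt_trans _ _ 2%:E); last exact: ltry.
    apply: lime_le; first by apply: is_cvg_nneseries => *; exact: integral_ge0.
    apply: nearW => N; apply: (@le_trans _ _ (\sum_(0 <= j < N) (q j)%:E)%E).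
      by apply: lee_sum.
    rewrite sumEFin lee_fin.
    suff -> : \sum_(0 <= j < N) q j = 2 - 2 * q N by rewrite gerBl mulr_ge0// ltW.
    elim: N => [|N IH]; first by rewrite big_geq// /q expr0 mulr1 subrr.
    by rewrite big_nat_recr//= IH /q exprS; field.
  have /integrable_ae : mu.-integrable setT (fun x => (\sum_(j <oo) `|(b j x)%:E|)%E).
    apply/integrableP; split; first by apply: (@ge0_emeasurable_sum _ _ _ setT (fun j x => `|(b j x)%:E|%E) xpredT).
    by under eq_integral do rewrite gee0_abs ?nneseries_ge0//.
  move=> /(_ measurableT); apply: aeOS => x /(_ I) fx.
  apply: normed_cvg.
  apply: nondecreasing_is_cvgn.
    by apply: nondecreasing_series => i _ _; exact: normr_ge0.
  exists (fine (\sum_(j <oo) `|(b j x)%:E|)%E) => _ [N _ <-].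
  rewrite -lee_fin fineK// /series/= -sumEFin.
  under eq_bigr do rewrite -abse_EFin.
  exact: nneseries_lim_ge.
(* the upper limit is measurable, whether or not the sequence converges *)
pose g x := fine (limn_esup (fun j => (psum a (m j) x)%:E)).
have mg : measurable_fun setT g.
  apply: measurableT_comp; first exact: fine_measurable.
  have mp j : measurable_fun setT (fun x => (psum a (m j) x)%:E).
    by apply/measurable_EFinP; apply: L2_meas; exact: L2_psum.
  exact: (@measurable_fun_limn_esup _ _ _ setT (fun j x => (psum a (m j) x)%:E)).
have gcv : {ae mu, forall x, psum a (m j) x @[j --> \oo] --> g x}.
  apply: aeOS bsum => x /cvg_ex[/= l sl].
  have pl : psum a (m j) x @[j --> \oo] --> psum a (m 0) x + l.
    rewrite (_ : (fun j => _) = (fun j => psum a (m 0) x + series (fun j => b j x) j)).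
      by apply: cvgD => //; exact: cvg_cst.
    apply/funext => j; rewrite /series/=.
    elim: j => [|j IH]; first by rewrite big_geq// addr0.
    by rewrite big_nat_recr//= addrA -IH /b !fctE; ring.
  rewrite /g (_ : limn_esup _ = (psum a (m 0) x + l)%:E)//.
  by apply: (cvg_limn_einf_sup _).2; apply/cvg_EFin; [exact: nearW|].
suff H N (eps : R) : (forall M, \sum_(N <= k < M) a k ^+ 2 <= eps) ->
    L2 (g - psum a N) /\ ip0 (g - psum a N) (g - psum a N) <= eps.
  exists g; split; last by move=> N eps /H[].
  have [] := H 0%N B; first by move=> M; exact: ssq_sum_le.
  by rewrite /psum big_ord0 subr0.
move=> He; apply: (@fatou_L2 (fun j => psum a (m j) - psum a N)).
- by move=> j; apply: L2B; exact: L2_psum.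
- by apply: measurable_funB => //; apply: L2_meas; exact: L2_psum.
- by apply: aeOS gcv => x gx; apply: cvgB => //; exact: cvg_cst.
- exists N => //= j Nj; rewrite psumB; first by rewrite ip0_span.
  by rewrite (leq_trans Nj)// /m leq_addl.
Qed.

End Riesz_Fischer.

(** * Completeness of the sine system *)

Section completeness.
Context (R : realType).
Local Notation mu := (@muO R).
Local Notation leb := (@lebesgue_measure R).
Implicit Types g h : R -> R.

Lemma dct_muO (h : nat -> R -> R) (g k : R -> R) :
  (forall n, measurable_fun setT (h n)) -> measurable_fun setT g ->
  mu.-integrable setT (EFin \o k) ->
  {ae mu, forall x, h n x @[n --> \oo] --> g x} ->
  (forall n x, 0 < x -> x < 1 -> `|h n x| <= k x) ->
  mu.-integrable setT (EFin \o g) /\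
  (\int[mu]_x h n x @[n --> \oo] --> \int[mu]_x g x).
Proof.
move=> mh mg ik hg hk.
have mh' n : measurable_fun setT (EFin \o h n) by exact/measurable_EFinP.
have mg' : measurable_fun setT (EFin \o g) by exact/measurable_EFinP.
have [||ig _ H] := @dominated_convergence _ _ _ mu setT measurableT
  (fun n => EFin \o h n) (EFin \o g) (EFin \o k) mh' mg' _ ik _.
- by apply: aeOS hg => x hx _; apply/cvg_EFin; [exact: nearW|].
- by apply: aeO_itv => x x0 x1 n _; rewrite /= lee_fin hk.
- split => //; rewrite /Rintegral; apply: fine_cvg.
  by rewrite fineK//; exact: integrable_fin_num.
Qed.

Lemma leb_muO_itv (f : R -> \bar R) :
  (\int[leb]_(x in [set` `]0%R, 1%R[]) f x = \int[mu]_(x in [set` `]0%R, 1%R[]) f x)%E.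
Proof.
by apply: eq_measure_integral => A mA AI; rewrite /= /muO /mrestr setIidl.
Qed.

Lemma integrable_muO_leb (f : R -> R) : mu.-integrable setT (EFin \o f) ->
  leb.-integrable [set` `]0, 1[] (EFin \o f).
Proof.
move=> /integrableP[mgs fgs]; apply/integrableP; split.
  exact: measurable_funS mgs.
apply: le_lt_trans fgs; rewrite leb_muO_itv.
apply: ge0_subset_integral => //.
by apply: measurableT_comp.
Qed.

Lemma bernoulli_ge (z : R) n : 0 <= z <= 1 -> 1 - n%:R * z <= (1 - z) ^+ n.
Proof.
move=> /andP[z0 z1]; elim: n => [|n IH]; first by rewrite mul0r subr0 expr0.
rewrite exprS; apply: le_trans (_ : _ <= (1 - z) * (1 - n%:R * z)) _; last first.
  by rewrite ler_wpM2l// subr_ge0.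
rewrite -natr1; have : 0 <= n%:R * z * z by rewrite !mulr_ge0.
lra.
Qed.

(** Bernoulli's inequality for 1 / (1 - z), multiplied out. *)
Lemma bernoulli_le (z : R) n : 0 <= z <= 1 -> (1 - z) ^+ n * (1 + n%:R * z) <= 1.
Proof.
move=> /andP[z0 z1]; elim: n => [|n IH]; first by rewrite mul0r addr0 expr0 mulr1.
rewrite exprS -natr1.
have p0 : 0 <= (1 - z) ^+ n by rewrite exprn_ge0// subr_ge0.
apply: le_trans IH; rewrite mulrAC -subr_ge0.
have nz0 : 0 <= n%:R * z by rewrite mulr_ge0.
rewrite (_ : _ - _ = (1 - z) ^+ n * (z * (z + n%:R * z))); last by ring.
by rewrite !mulr_ge0// addr_ge0.
Qed.

(** Polynomials in q converge to the indicator of q < 1/2 while staying in [0,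
1]: (2 q)^n tends to 0 or to infinity according to the side, and the two
Bernoulli inequalities turn this into the limits 1 and 0. *)
Lemma step_cvg (q : R) : 0 <= q <= 1 -> q != 2^-1 ->
  (1 - q ^+ n) ^+ (2 ^ n) @[n --> \oo] --> ((q < 2^-1)%R%:R : R).
Proof.
move=> q01 qh; have /andP[q0 q1] := q01.
have qn n : 0 <= q ^+ n <= 1 by rewrite exprn_ge0//= exprn_ile1.
have E n : (2 ^ n)%:R * q ^+ n = (2 * q) ^+ n by rewrite natrX exprMn.
case: ltrP => [qlt|qge].
  apply: (@squeeze_cvgr _ _ _ _ (fun n => 1 - (2 * q) ^+ n) (cst 1)).
  - apply: nearW => n; rewrite -E bernoulli_ge//= exprn_ile1// ?subr_ge0.
      by have /andP[] := qn n.
    by have /andP[? _] := qn n; rewrite gerBl.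
  - rewrite -[X in _ --> X]subr0; apply: cvgB; first exact: cvg_cst.
    by apply: cvg_expr; rewrite ger0_norm ?mulr_ge0//; lra.
  - exact: cvg_cst.
have qgt : 2^-1 < q by rewrite lt_neqAle eq_sym qh.
apply: (@squeeze_cvgr _ _ _ _ (cst 0) (fun n => ((2 * q)^-1) ^+ n)).
- apply: nearW => n; have /andP[z0 z1] := qn n.
  have p0 : 0 <= (1 - q ^+ n) ^+ (2 ^ n) by rewrite exprn_ge0// subr_ge0.
  rewrite /= p0/= exprVn -[_^-1]mul1r ler_pdivlMr ?exprn_gt0 ?mulr_gt0//; last by lra.
  apply: le_trans (bernoulli_le (2 ^ n) (qn n)).
  by rewrite E ler_wpM2l// lerDr.
- exact: cvg_cst.
- apply: cvg_expr; rewrite ger0_norm ?invr_ge0 ?mulr_ge0// invf_lt1; first by lra.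
  by lra.
Qed.

Variable g : R -> R.
Hypothesis Lg : L2 g.
Hypothesis g0 : forall k, ip0 g (sinm k) = 0.

Let s x : R := sin (pi * x).
Let y x : R := cos (pi * x).

Let isd_pi (F : R -> R) f x : is_derive (pi * x) 1 F f ->
  is_derive x 1 (fun t => F (pi * t)) (pi * f).
Proof.
move=> H; apply: (isd_eq (isd_comp H (isdZ pi (isd_id x)))).
by rewrite mulr1 mulrC.
Qed.

Let cs : continuous s.
Proof. by apply: isd_continuous => x; apply: isd_pi; exact: is_derive_sin. Qed.

Let cy : continuous y.
Proof. by apply: isd_continuous => x; apply: isd_pi; exact: is_derive_cos. Qed.

Let csk k : continuous (fun x : R => sin (k%:R * (pi * x))).
Proof.
apply: (@isd_continuous _ _ (fun x => cos (k%:R * (pi * x)) * (k%:R * (pi * 1)))) => x.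
Qed.

Let cyj j : continuous (fun x => y x ^+ j).
Proof.
elim: j => [|j IH]; first by under eq_fun do rewrite expr0; exact: cst_continuous.
by under eq_fun do rewrite exprS; exact: continuousM.
Qed.

(** Orthogonality to sin (k pi x) cos (pi x)^j for all k, by induction on j
with the formula for the product of a sine and a cosine. *)
Let orth_cosn j k : ip0 g (fun x => sin (k%:R * (pi * x)) * y x ^+ j) = 0.
Proof.
elim: j k => [|j IH] k.
  under [X in ip0 _ X]eq_fun do rewrite expr0 mulr1.
  case: k => [|k].
    rewrite (_ : (fun x => _) = 0) ?(ip0C g) ?ip00l//.
    by apply/funext => x; rewrite mul0r sin0.
  have := g0 k; rewrite (_ : sinm k = Num.sqrt 2 *: (fun x => sin (k.+1%:R * (pi * x)))).
    rewrite ip0Zr//; last by apply: L2_continuous; exact: csk.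
    by move=> /eqP; rewrite mulf_eq0 gt_eqF ?sqrtr_gt0//= => /eqP.
  by apply/funext => x; rewrite sinmE omE -mulrA.
have Lj k' : L2 (fun x => sin (k'%:R * (pi * x)) * y x ^+ j).
  by apply: L2_continuous; apply: continuousM; [exact: csk|exact: cyj].
case: k => [|k].
  rewrite (_ : (fun x => _) = 0) ?(ip0C g) ?ip00l//.
  by apply/funext => x; rewrite mul0r sin0 mul0r.
rewrite (_ : (fun x => _) = 2^-1 *: ((fun x => sin (k.+2%:R * (pi * x)) * y x ^+ j)
   + (fun x => sin (k%:R * (pi * x)) * y x ^+ j))).
  by rewrite ip0Zr// ?ip0Dr// ?IH ?addr0 ?mulr0//; exact: L2D.
apply/funext => x; rewrite !fctE.
have -> : k.+2%:R * (pi * x) = k.+1%:R * (pi * x) + pi * x :> R.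
  by rewrite -[k.+2%:R]natr1 mulrDl mul1r.
have -> : k%:R * (pi * x) = k.+1%:R * (pi * x) - pi * x :> R.
  by have -> : k.+1%:R = k%:R + 1 :> R; [rewrite natr1|ring].
by rewrite sinD sinB exprS -/(y x) -[_ *: _]/(_ * _); field.
Qed.

Let orth_poly (p : {poly R}) : \int[mu]_x (g x * s x * p.[y x]) = 0.
Proof.
have L i : L2 (fun x => s x * y x ^+ i) by apply: L2_continuous; exact: continuousM.
transitivity (ip0 g (\sum_(i < size p) p`_i *: (fun x => s x * y x ^+ i))).
  congr fine; apply: eq_integral => x _; congr EFin.
  rewrite horner_coef -mulrA fct_sumE !mulr_sumr; apply: eq_bigr => i _.
  by rewrite -[(_ *: _) x]/(_ * _); ring.
rewrite ip0_sumr//; last by move=> i _; exact: L2Z.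
rewrite big1// => i _; rewrite ip0Zr//.
rewrite (_ : (fun x => _) = (fun x => sin (1%:R * (pi * x)) * y x ^+ i)).
  by rewrite orth_cosn mulr0.
by apply/funext => x; rewrite mul1r.
Qed.

Let Lgs : L2 (fun x => g x * s x).
Proof.
have [] := @L2_aebound _ s g 1 (continuous_meas cs) Lg.
  by apply: aeOT => x; rewrite /s -(cos2Dsin2 (pi * x)) lerDr sqr_ge0.
by move=> + _; under eq_fun do rewrite mulrC.
Qed.

Let pix (x : R) : 0 < x -> x < 1 -> pi * x \in `[0, pi].
Proof.
move=> x0 x1; rewrite in_itv/= (mulr_ge0 (pi_ge0 R) (ltW x0))/=.
by rewrite -[leRHS]mulr1 ler_wpM2l ?pi_ge0// ltW.
Qed.

(** The interval ]a, b[ is the set where a quadratic polynomial in cos (pi x)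
is below 1/2, because cosine is monotone on [0, pi]; so its indicator is a
bounded limit of polynomials in cos (pi x). *)
Let orth_itv (a b : R) : 0 < a -> a < b -> b < 1 ->
  \int[mu]_x (g x * s x * (a < x < b)%R%:R) = 0.
Proof.
move=> a0 ab b1.
have b0 := lt_trans a0 ab; have a1 := lt_trans ab b1.
pose y0 := (y a + y b) / 2; pose r := (y a - y b) / 2.
have yI x : -1 <= y x <= 1 by rewrite cos_geN1 cos_le1.
(* the factor 1/8 keeps q between 0 and 1, as |cos - cos| <= 2 *)
pose qp : {poly R} := (2^-1)%:P + 8^-1 *: ((('X - y0%:P) ^+ 2) - (r ^+ 2)%:P).
pose q x : R := 2^-1 + 8^-1 * ((y x - y0) ^+ 2 - r ^+ 2).
have qE x : qp.[y x] = q x by rewrite /qp !hornerE.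
have q01 x : 0 <= q x <= 1.
  have := yI x; have := yI a; have := yI b; rewrite /q /y0 /r => B A X.
  have -> : (y x - (y a + y b) / 2) ^+ 2 - ((y a - y b) / 2) ^+ 2
          = (y x - y a) * (y x - y b) by field.
  have : `|(y x - y a) * (y x - y b)| <= 4.
    rewrite normrM (_ : 4 = 2 * 2 :> R); last by ring.
    apply: ler_pM => //.
      by rewrite ler_norml; apply/andP; split; lra.
    by rewrite ler_norml; apply/andP; split; lra.
  by rewrite ler_norml => /andP[H1 H2]; apply/andP; split; lra.
have qlt x : 0 < x -> x < 1 -> (q x < 2^-1) = (a < x < b).
  move=> x0 x1; rewrite /q -subr_gt0 opprD addrA subrr sub0r oppr_gt0.
  have -> : (y x - y0) ^+ 2 - r ^+ 2 = (y x - y a) * (y x - y b).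
    by rewrite /y0 /r; field.
  rewrite pmulr_rlt0 ?invr_gt0//.
  have E1 : (y x < y a) = (a < x) by rewrite ltr_cos ?pix// ltr_pM2l ?pi_gt0.
  have E2 : (y b < y x) = (x < b) by rewrite ltr_cos ?pix// ltr_pM2l ?pi_gt0.
  have E3 : (y a < y x) = (x < a) by rewrite ltr_cos ?pix// ltr_pM2l ?pi_gt0.
  have E4 : (y x < y b) = (b < x) by rewrite ltr_cos ?pix// ltr_pM2l ?pi_gt0.
  apply/idP/idP => [|/andP[ax xb]]; last first.
    by rewrite nmulr_rlt0 ?subr_gt0 ?E2// subr_lt0 E1.
  case: (ltgtP a x) => [ax|xa|<-]; last by rewrite subrr mul0r ltxx.
    by rewrite nmulr_rlt0 ?subr_lt0 ?E1// subr_gt0 E2.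
  rewrite pmulr_rlt0 ?subr_gt0 ?E3// subr_lt0 E4 => bx.
  by have := lt_trans ab (lt_trans bx xa); rewrite ltxx.
have qh x : 0 < x -> x < 1 -> x != a -> x != b -> q x != 2^-1.
  move=> x0 x1 xa xb; rewrite /q -subr_eq0 addrAC subrr add0r mulf_neq0//.
  have -> : (y x - y0) ^+ 2 - r ^+ 2 = (y x - y a) * (y x - y b).
    by rewrite /y0 /r; field.
  rewrite mulf_neq0// subr_eq0; [apply: contraNneq xa => /cos_inj|apply: contraNneq xb => /cos_inj];
    rewrite !pix// => /(_ isT isT)/mulfI ->//; exact/lt0r_neq0/pi_gt0.
pose P n x : R := (1 - q x ^+ n) ^+ (2 ^ n).
have PE n x : ((1 - qp ^+ n) ^+ (2 ^ n)).[y x] = P n x.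
  by rewrite /P -qE; move: (qp) => p; rewrite !(horner_exp, hornerE).
have cP n : continuous (P n).
  rewrite (_ : P n = (fun x => ((1 - qp ^+ n) ^+ (2 ^ n)).[y x])); last first.
    by apply/funext => x; rewrite PE.
  by move=> x; apply: continuous_comp; [exact: cy|exact: continuous_horner].
have P1 n x : `|P n x| <= 1.
  have /andP[z0 z1] := q01 x.
  have z2 : 0 <= 1 - q x ^+ n by rewrite subr_ge0 exprn_ile1.
  by rewrite ger0_norm /P ?exprn_ge0// exprn_ile1// gerBl exprn_ge0.
have [|||||ig H] := @dct_muO (fun n x => g x * s x * P n x)
  (fun x => g x * s x * (a < x < b)%R%:R) (fun x => `|g x * s x|).
- move=> n; apply: measurable_funM; first exact: L2_meas Lgs.
  exact: continuous_meas.
- apply: measurable_funM; first exact: L2_meas Lgs.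
  rewrite (_ : (fun x => _) = \1_(`]a, b[ : set R)).
    by apply: measurable_indic; exact: measurable_itv.
  by apply/funext => x; rewrite indicE; congr (nat_of_bool _)%:R; rewrite mem_setE in_itv.
- exact/integrable_norm/L2_int.
- have ab0 : {ae mu, forall x, x != a /\ x != b}.
      exists [set a; b]; split.
      * by apply: measurableU; exact: measurable_set1.
      * apply/eqP; rewrite /= /muO /mrestr -measure_le0.
        apply: (@le_trans _ _ (leb [set a; b])).
          apply: le_measure; rewrite ?inE//; last exact: measurableU.
          by apply: measurableI; [exact: measurableU|exact: measurable_itv].
        apply: le_trans (measureU2 _ _ _) _; [exact: measurable_set1..|].
        by move: (@lebesgue_measure_set1 R a) (@lebesgue_measure_set1 R b) => /= -> ->; rewrite adde0.
      * move=> x /= nx; apply: contrapT => /not_orP[/eqP xa /eqP xb].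
        by apply: nx.
    have in01 : {ae mu, forall x, 0 < x < 1} by apply: aeO_itv => x -> ->.
    apply: aeOS2 ab0 in01 => x [xa xb] /andP[x0 x1].
    apply: cvgM; first exact: cvg_cst.
    by rewrite -qlt//; apply: step_cvg; [exact: q01|exact: qh].
- move=> n x _ _; rewrite normrM; apply: ler_piMr => //.
- suff E n : \int[mu]_x (g x * s x * P n x) = 0.
    rewrite -(cvg_lim (@Rhausdorff R) H); apply: cvg_lim; first exact: Rhausdorff.
    by under eq_fun do rewrite E; exact: cvg_cst.
  rewrite -[RHS](orth_poly ((1 - qp ^+ n) ^+ (2 ^ n))).
  by congr fine; apply: eq_integral => x _; rewrite PE.
Qed.

(** By [orth_itv] the primitive of g(x) sin (pi x) is constant on the unit
interval; by Lebesgue's differentiation theorem its derivative is g(x) sin (pi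
x) almost everywhere, and the sine is positive there. *)
Lemma sinm_complete : {ae mu, forall x, g x = 0}.
Proof.
pose I : set R := [set` `]0, 1[].
have mI : measurable (I : set (measurableTypeR R)) by exact: measurable_itv.
pose f : R -> R := (fun x => g x * s x) \_ I.
have intI : leb.-integrable I (EFin \o (fun x => g x * s x)).
  exact: integrable_muO_leb (L2_int Lgs).
have intf : leb.-integrable setT (EFin \o f).
  have /(integrable_mkcond _ mI) := intI.
  by apply: eq_integrable => // x _; rewrite /f/= restrict_EFin.
have := @FTC1Ny R f.
have locf := open_integrable_locally openT intf.
have intfS A : measurable (A : set (measurableTypeR R)) -> leb.-integrable A (EFin \o f).
  by move=> mA; apply: integrableS intf.
move=> /(_ _ locf)/= []; first by move=> y'; apply: intfS; exact: measurable_itv.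
move=> A [mA A0 sA]; apply: leb_aeO; exists A; split => // x /= /not_implyP[x01 gx].
apply: sA => /= -[dF F'].
apply: gx; have := x01; rewrite in_itv/= => /andP[x0 x1].
have : g x * s x = 0.
  rewrite -[LHS](_ : f x = _); last by rewrite /f patchE mem_set.
  rewrite -F' derive1E -(derive_cst (\int[leb]_(t in `]-oo, x]) f t) x 1).
  apply: near_eq_derive; rewrite ?oner_neq0//.
  have Ieq (a b : R) : 0 < a -> a < b -> b < 1 ->
    \int[leb]_(t in `]-oo, b]) f t = \int[leb]_(t in `]-oo, a]) f t.
    move=> a0 ab b1; apply/eqP; rewrite -subr_eq0; apply/eqP.
    rewrite Rintegral_itvB//; last 2 first.
    - by apply: intfS; exact: measurable_itv.
    - by rewrite bnd_simp ltW.
    rewrite -[RHS](orth_itv a0 ab b1) Rintegral_muO; last first.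
      have Lgi := @L2_aebound _ (fun x => (a < x < b)%R%:R) _ 1 _ Lgs.
      have mi : measurable_fun setT (fun x : R => (a < x < b)%R%:R : R).
        rewrite (_ : (fun x => _) = \1_(`]a, b[ : set R)).
          by apply: measurable_indic; exact: measurable_itv.
        by apply/funext => t; rewrite indicE; congr (nat_of_bool _)%:R; rewrite mem_setE in_itv.
      have [||L _] := Lgi; first exact: mi.
        by apply: aeOT => t; case: (a < t < b); rewrite ?expr1n// expr0n ler01.
      by apply: eq_integrable (L2_int L) => // t _ /=; rewrite mulrC.
    rewrite -Rintegral_itv_bndo_bndc; last by apply: intfS; exact: measurable_itv.
    rewrite [LHS]Rintegral_mkcond [RHS]Rintegral_mkcond.
    congr fine; apply: eq_integral => t _; congr EFin.
    rewrite /f !patchE !mem_setE !in_itv/=.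
    case: (ltrP a t) => at_; last by rewrite /= mulr0 if_same.
    case: (ltrP t b) => tb /=; last by rewrite mulr0 if_same.
    by rewrite (lt_trans a0 at_) (lt_trans tb b1) mulr1.
  near=> t; rewrite /= /cst.
  have t0 : 0 < t by near: t; exact: lt_nbhsr.
  have t1 : t < 1 by near: t; exact: lt_nbhsl.
  case: (ltgtP t x) => [tx|xt|->//]; first by rewrite -(Ieq t x).
  by rewrite (Ieq x t).
move=> /eqP; rewrite mulf_eq0 => /orP[/eqP//|]; rewrite gt_eqF//.
apply: sin_gt0_pi; rewrite mulr_gt0 ?pi_gt0//=.
by rewrite -[ltRHS]mulr1 ltr_pM2l ?pi_gt0.
Unshelve. all: end_near. Qed.

End completeness.

(** * Sine coefficients, Parseval's identity and the embedding into bounded functions *)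

Section orthonormal_expansions.
Context (R : realType).
Local Notation mu := (@muO R).
Variable f : nat -> R -> R.
Hypothesis Lf : forall k, L2 (f k).
Hypothesis of_ : forall k l, ip0 (f k) (f l) = (k == l)%:R.
Implicit Types (a : nat -> R) (g h : R -> R).

(** The function g is the sum of the orthogonal series with coefficients a, in
the quantitative form of [riesz_fischer]: every bound on a tail of a bounds the
distance of g to the partial sum. *)
Definition expands a g := L2 g /\
  forall N (eps : R), (forall M, \sum_(N <= k < M) a k ^+ 2 <= eps) ->
    ip0 (g - psum f a N) (g - psum f a N) <= eps.

Lemma le_eps_eq0 (x : R) : 0 <= x -> (forall eps, 0 < eps -> x <= eps) -> x = 0.
Proof.
move=> x0 H; apply/eqP; rewrite eq_le x0 andbT leNgt; apply/negP => xp.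
have := H (x / 2); rewrite divr_gt0// => /(_ isT); lra.
Qed.

Lemma expands_psum_small a g B : ssq a B -> expands a g -> forall eps, 0 < eps ->
  exists N0, forall N, (N0 <= N)%N -> ip0 (g - psum f a N) (g - psum f a N) <= eps.
Proof.
move=> aB [Lg H] eps e0; have [N0 HN] := ssq_tail aB e0.
by exists N0 => N N0N; apply: H => M; exact: HN.
Qed.

Lemma expands_ip0 a g B h : ssq a B -> expands a g -> L2 h ->
  (fun N => \sum_(k < N) a k * ip0 (f k) h) @ \oo --> ip0 g h.
Proof.
move=> aB ag Lh; apply/cvgrPdist_le => e e0.
have h1 : 0 < ip0 h h + 1 by rewrite ltr_wpDl// ip0_ge0.
have [N0 HN] := expands_psum_small aB ag (divr_gt0 (exprn_gt0 2 e0) h1).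
near=> N.
have Lp := L2_psum Lf a N; have Lg := ag.1; have Ld := L2B Lg Lp.
have -> : \sum_(k < N) a k * ip0 (f k) h = ip0 (psum f a N) h.
  rewrite ip0_suml//; last by move=> i _; exact: L2Z.
  by apply: eq_bigr => i _; rewrite ip0Zl.
rewrite -ip0Bl// -ler_sqr ?nnegrE ?(ltW e0)// real_normK ?num_real//.
apply: le_trans (ip0_CS Ld Lh) _.
apply: le_trans (ler_wpM2r (ip0_ge0 h) (HN N _)) _; first by near: N; exists N0.
by rewrite mulrAC -mulrA ler_piMr ?sqr_ge0// ler_pdivrMr// mul1r lerDl.
Unshelve. all: end_near. Qed.

Lemma expands_coef a g B k : ssq a B -> expands a g -> ip0 g (f k) = a k.
Proof.
move=> aB ag; rewrite -(cvg_lim (@Rhausdorff R) (expands_ip0 aB ag (Lf k))).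
apply: cvg_lim; first exact: Rhausdorff.
apply: cvg_near_cst.
exists k.+1 => // N /= kN; rewrite (bigD1 (Ordinal kN))//= of_ eqxx mulr1.
rewrite big1 ?addr0// => j ji; rewrite of_ (_ : (_ == _) = false) ?mulr0//.
by apply: contraNF ji => /eqP jk; apply/eqP/val_inj.
Qed.

Lemma expands_norm a g B : ssq a B -> expands a g -> ip0 g g <= B.
Proof.
move=> aB [Lg H]; have := H 0%N B; rewrite /psum big_ord0 subr0; apply => M.
exact: ssq_sum_le.
Qed.

Lemma expands_exists a B : ssq a B -> exists g, expands a g.
Proof. by move=> /(riesz_fischer Lf of_)[g ag]; exists g. Qed.

End orthonormal_expansions.

Section sine_coefficients.
Context (R : realType).
Local Notation mu := (@muO R).
Implicit Types (a c : nat -> R) (g h : R -> R) (s k N : nat) (B : R).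

(** Sine coefficients, numbered from 0. *)
Definition cf g k : R := ip0 g (sinm k).

(** The sequence a belongs to the domain of A^{s/2}, with square norm at most
B. *)
Definition bd s a B := ssq (fun k => om k ^+ s * a k) B.

Lemma cfD g h k : L2 g -> L2 h -> cf (g + h) k = cf g k + cf h k.
Proof. by move=> *; rewrite /cf ip0Dl//; exact: L2_sinm. Qed.

Lemma cfB g h k : L2 g -> L2 h -> cf (g - h) k = cf g k - cf h k.
Proof. by move=> *; rewrite /cf ip0Bl//; exact: L2_sinm. Qed.

Lemma cfZ (x : R) g k : L2 g -> cf (x *: g) k = x * cf g k.
Proof. by move=> *; rewrite /cf ip0Zl//; exact: L2_sinm. Qed.

Lemma cf0 k : cf 0 k = 0. Proof. exact: ip00l. Qed.

Lemma cf_ae g h : L2 g -> L2 h -> {ae mu, forall x, g x = h x} -> cf g = cf h.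
Proof.
move=> Lg Lh gh; apply/funext => k; have Ls := @L2_sinm R k.
by apply: ip0_ae gh _; try exact: L2_meas; exact: aeOT.
Qed.

Lemma bd_ge0 s a B : bd s a B -> 0 <= B. Proof. exact: ssq_ge0. Qed.

Lemma bd_le s a B B' : bd s a B -> B <= B' -> bd s a B'. Proof. exact: ssq_le. Qed.

Lemma bd_anti s s' a B : (s' <= s)%N -> bd s a B -> bd s' a B.
Proof.
move=> ss /ssq_dom; apply => k; rewrite !exprMn ler_wpM2r ?sqr_ge0//.
by rewrite ler_sqr ?nnegrE ?exprn_ge0 ?(ltW (om_gt0 _ _))// ler_weXn2l// om_ge1.
Qed.

Lemma bdD s a c A B : bd s a A -> bd s c B ->
  bd s (fun k => a k + c k) (2 * A + 2 * B).
Proof.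
move=> aA cB; rewrite /bd (_ : (fun k => _) = (fun k => om k ^+ s * a k + om k ^+ s * c k)).
  exact: ssqD.
by apply/funext => k; rewrite mulrDr.
Qed.

Lemma bdZ s a A (x : R) : bd s a A -> bd s (fun k => x * a k) (x ^+ 2 * A).
Proof.
move=> aA; rewrite /bd (_ : (fun k => _) = (fun k => x * (om k ^+ s * a k))).
  exact: ssqZ.
by apply/funext => k; rewrite mulrCA.
Qed.

Lemma bdN s a A : bd s a A -> bd s (fun k => - a k) A.
Proof.
move=> aA; have := bdZ (-1) aA; rewrite sqrrN expr1n mul1r.
by under [X in bd _ X]eq_fun do rewrite mulN1r.
Qed.

Lemma bdB s a c A B : bd s a A -> bd s c B ->
  bd s (fun k => a k - c k) (2 * A + 2 * B).
Proof. by move=> aA cB; apply: bdD => //; exact: bdN. Qed.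

Lemma bd0 s : bd s (fun _ => 0) 0.
Proof. by rewrite /bd; under eq_fun do rewrite mulr0; exact: ssq0. Qed.

Lemma bdS s a B : bd s.+1 a B <-> bd s (fun k => om k * a k) B.
Proof.
rewrite /bd (_ : (fun k => om k ^+ s.+1 * a k) = (fun k => om k ^+ s * (om k * a k)))//.
by apply/funext => k; rewrite exprSr mulrA.
Qed.

Lemma bd_ssq a B : bd 0 a B = ssq a B.
Proof. by rewrite /bd; under eq_fun do rewrite expr0 mul1r. Qed.

Lemma bd_coef s a B k : bd s a B -> a k ^+ 2 <= B.
Proof.
move=> /(bd_anti (leq0n s)); rewrite bd_ssq => H.
by have := ssq_sum_le k k.+1 H; rewrite big_nat1.
Qed.

Lemma bd_eq0 s a : (forall eps, 0 < eps -> bd s a eps) -> forall k, a k = 0.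
Proof.
move=> H k; apply/eqP; rewrite -sqrf_eq0; apply/eqP/le_eps_eq0; first exact: sqr_ge0.
by move=> e e0; exact: bd_coef (H _ e0).
Qed.

Lemma cf_bessel g : L2 g -> bd 0 (cf g) (ip0 g g).
Proof. by move=> Lg; rewrite bd_ssq; apply: Bessel => //; [exact: L2_sinm|exact: ip0_sinm]. Qed.

Lemma cf_ssq g : L2 g -> ssq (cf g) (ip0 g g).
Proof. by move=> Lg; rewrite -bd_ssq; exact: cf_bessel. Qed.

(** By Riesz-Fischer every square-summable sequence is the coefficient sequence
of some function. *)
Lemma syn_exists c B : bd 0 c B -> exists g, expands sinm c g /\ cf g = c.
Proof.
rewrite bd_ssq => cB.
have [g cg] := expands_exists (@L2_sinm R) (@ip0_sinm R) cB.
exists g; split => //; apply/funext => k.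
by apply: (expands_coef _ _ _ cB cg); [exact: L2_sinm|exact: ip0_sinm].
Qed.

Lemma cf_inj g h : L2 g -> L2 h -> cf g = cf h -> {ae mu, forall x, g x = h x}.
Proof.
move=> Lg Lh gh; have H : {ae mu, forall x, (g - h) x = 0}.
  apply: sinm_complete; first exact: L2B.
  by move=> k; rewrite -/(cf _ k) cfB// gh subrr.
by apply: aeOS H => x /eqP; rewrite subr_eq0 => /eqP.
Qed.

(** Completeness: g agrees almost everywhere with the function synthesized from
its own coefficients. *)
Lemma cf_expands g : L2 g -> expands sinm (cf g) g.
Proof.
move=> Lg; have [h [[Lh H] hg]] := syn_exists (cf_bessel Lg).
have gh := cf_inj Lg Lh (esym hg).
split=> // N eps He; have := H N eps He.
have Lp := L2_psum (@L2_sinm R) (cf g) N.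
have mg : measurable_fun setT (g - psum sinm (cf g) N) by apply: L2_meas; exact: L2B.
have mh : measurable_fun setT (h - psum sinm (cf g) N) by apply: L2_meas; exact: L2B.
rewrite (ip0_ae mg mg mh mh) //.
  by apply: aeOS gh => x; rewrite !fctE => ->.
by apply: aeOS gh => x; rewrite !fctE => ->.
Qed.

Lemma parseval_le g B : L2 g -> bd 0 (cf g) B -> ip0 g g <= B.
Proof. by rewrite bd_ssq => Lg gB; exact: expands_norm gB (cf_expands Lg). Qed.

Lemma parseval g h : L2 g -> L2 h ->
  (fun N => \sum_(k < N) cf g k * cf h k) @ \oo --> ip0 g h.
Proof.
move=> Lg Lh; have := expands_ip0 (@L2_sinm R) (cf_ssq Lg) (cf_expands Lg) Lh.
rewrite /cf; under eq_fun => N do under eq_bigr => k _ do rewrite (ip0C (sinm k)).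
by [].
Qed.

(** As pi^2 >= 4 the terms are at most 1 / (2 (k + 1)^2), and 1 / (2 (M + 2)^2)
is at most the decrease of 1 / (2 (M + 1)), which makes the sum telescope. *)
Lemma sum_sinm2 N (x : R) : \sum_(k < N) ((om k)^-1 * sinm k x) ^+ 2 <= 1.
Proof.
have H : forall M, \sum_(k < M.+1) ((om k)^-1 * sinm k x) ^+ 2 <= 1 - (2 * M.+1%:R)^-1.
  have b k : ((om k)^-1 * sinm k x) ^+ 2 <= 2^-1 * (k.+1%:R ^+ 2)^-1.
    rewrite exprMn sinmE exprMn sqr_sqrtr// exprVn.
    have s1 : sin (om k * x) ^+ 2 <= 1.
      by rewrite -(cos2Dsin2 (om k * x)) lerDr sqr_ge0.
    apply: (@le_trans _ _ ((om k ^+ 2)^-1 * 2)).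
      rewrite ler_wpM2l ?invr_ge0 ?sqr_ge0//.
      by rewrite -[leRHS]mulr1 ler_wpM2l.
    rewrite ler_pdivrMl ?exprn_gt0 ?om_gt0// mulrA ler_pdivlMr ?exprn_gt0 ?ltr0n//.
    rewrite omE exprMn; have := @pi_ge2 R => p2.
    have : 4 <= (pi : R) ^+ 2 by rewrite (_ : 4 = 2 ^+ 2 :> R); [rewrite ler_sqr ?nnegrE ?pi_ge0|ring].
    have : 0 < (k.+1%:R : R) ^+ 2 by rewrite exprn_gt0 ?ltr0n.
    move: (_ ^+ 2) (_ ^+ 2) => A B A0 B4; nra.
  elim=> [|M IH].
    by rewrite big_ord_recr big_ord0/= add0r; apply: le_trans (b 0%N) _; rewrite expr1n; lra.
  rewrite big_ord_recr/=; apply: le_trans (lerD IH (b _)) _.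
  set y : R := M.+1%:R; have y0 : 0 < y by rewrite ltr0n.
  have -> : M.+2%:R = y + 1 :> R by rewrite natr1.
  have y1 : 0 < y + 1 by rewrite addr_gt0.
  rewrite -subr_ge0 (_ : _ - _ = (2 * y * (y + 1) ^+ 2)^-1).
    by rewrite invr_ge0 !mulr_ge0// ?exprn_ge0 ?ltW.
  by field; rewrite !gt_eqF.
case: N => [|N]; first by rewrite big_ord0.
by apply: le_trans (H N) _; rewrite gerBl invr_ge0 mulr_ge0.
Qed.

(** Cauchy-Schwarz against the sequence of [sum_sinm2]. *)
Lemma psum_sup a B N (x : R) : bd 1 a B -> psum sinm a N x ^+ 2 <= B.
Proof.
move=> aB; rewrite /psum fct_sumE.
rewrite (_ : \sum_(k < N) _ = \sum_(0 <= k < N) (om k ^+ 1 * a k) * ((om k)^-1 * sinm k x)).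
  have S : ssq (fun k => (om k)^-1 * sinm k x) 1 by move=> M; exact: sum_sinm2.
  by apply: le_trans (ssq_CS 0 N aB S) _; rewrite mulr1.
rewrite big_mkord; apply: eq_bigr => k _; rewrite -[LHS]/(a k * sinm k x).
by rewrite expr1; field; rewrite gt_eqF// om_gt0.
Qed.

(** The domain of A^{1/2} embeds into the bounded functions. The part of |g|
above the square root of B is dominated by the distance of g to any partial
sum, since these satisfy the bound everywhere; so its norm vanishes. *)
Lemma sup_bound g B : L2 g -> bd 1 (cf g) B -> {ae mu, forall x, g x ^+ 2 <= B}.
Proof.
move=> Lg gB; have B0 := bd_ge0 gB.
(* the excess of |g| over its claimed bound *)
pose p x := Num.max (`|g x| - Num.sqrt B) 0.
have mp : measurable_fun setT p.
  apply: measurable_maxr => //; apply: measurable_funB => //.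
  by apply: measurableT_comp => //; exact: L2_meas.
have Lp N := L2_psum (@L2_sinm R) (cf g) N.
have pg N : L2 p /\ ip0 p p <= ip0 (g - psum sinm (cf g) N) (g - psum sinm (cf g) N).
  apply: le_ip0_ae => //; first exact: L2B.
  apply: aeOT => x; rewrite -[leRHS]real_normK ?num_real//.
  rewrite ler_sqr ?nnegrE ?normr_ge0 /p ?le_max ?lexx ?orbT//.
  rewrite ge_max normr_ge0 andbT lerBlDr.
  apply: (@le_trans _ _ (`|(g - psum sinm (cf g) N) x| + `|psum sinm (cf g) N x|)).
    by apply: le_trans (ler_normD _ _); rewrite !fctE subrK.
  rewrite lerD2l -ler_sqr ?nnegrE ?sqrtr_ge0// real_normK ?num_real// sqr_sqrtr//.
  exact: psum_sup.
have p0 : ip0 p p = 0.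
  apply: le_eps_eq0 => [|e e0]; first exact: ip0_ge0.
  have [N HN] := expands_psum_small (cf_ssq Lg) (cf_expands Lg) e0.
  exact: le_trans (pg N).2 (HN _ (leqnn _)).
apply: aeOS (ip0_eq0 (pg 0%N).1 p0) => x; rewrite /p => px.
rewrite -[g x ^+ 2]real_normK ?num_real// -[leRHS]sqr_sqrtr//.
rewrite ler_sqr ?nnegrE ?sqrtr_ge0// -subr_le0 -px le_max lexx//.
Qed.

End sine_coefficients.

(** * Calculus on an interval *)

Section calculus.
Context (R : realType).
Local Notation leb := (@lebesgue_measure R).
Implicit Types (F G f g : R -> R) (a b x t : R).

Lemma MVT_isd F f a b : a < b ->
  (forall x, a < x < b -> is_derive x 1 F (f x)) ->
  {within `[a, b], continuous F} ->
  exists x, a < x < b /\ F b - F a = f x * (b - a).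
Proof.
move=> ab Ff cF.
have Ff' x : x \in `]a, b[ -> is_derive x 1 F (f x) by rewrite in_itv; exact: Ff.
by have [x xab E] := MVT ab Ff' cF; exists x; rewrite in_itv in xab.
Qed.

Lemma le_of_deriv F f a b : a <= b ->
  (forall x, a < x < b -> is_derive x 1 F (f x)) ->
  {within `[a, b], continuous F} ->
  (forall x, a < x < b -> 0 <= f x) -> F a <= F b.
Proof.
rewrite le_eqVlt => /predU1P[->//|ab] Ff cF f0.
have [x [xab E]] := MVT_isd ab Ff cF.
by rewrite -subr_ge0 E mulr_ge0 ?f0// subr_ge0 ltW.
Qed.

Lemma isd_within F f a b : (forall x, a <= x <= b -> is_derive x 1 F (f x)) ->
  {within `[a, b], continuous F}.
Proof.
move=> Ff; apply: derivable_within_continuous => x; rewrite in_itv => xab.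
exact: isd_derivable (Ff x xab).
Qed.

Lemma eq_of_deriv F f a b : a <= b ->
  (forall x, a < x < b -> is_derive x 1 F (f x)) ->
  {within `[a, b], continuous F} ->
  (forall x, a < x < b -> f x = 0) -> F a = F b.
Proof.
rewrite le_eqVlt => /predU1P[->//|ab] Ff cF f0.
have [x [xab E]] := MVT_isd ab Ff cF.
by apply/eqP; rewrite eq_sym -subr_eq0 E f0 ?mul0r.
Qed.

(** The fundamental theorem of calculus gives a primitive on a half-line. *)
Lemma antiderivative_half g a : continuous g ->
  exists G, forall x, a < x -> is_derive x 1 G (g x).
Proof.
move=> cg; exists (fun x => \int[leb]_(t in `[a, x]) g t) => x ax.
have xx1 : x < x + 1 by rewrite ltrDl.
have [|||dG G'] := @continuous_FTC1 R g (BLeft a) x (x + 1) xx1.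
- by apply: continuous_compact_integrable; [exact: segment_compact|exact: continuous_subspaceT].
- by rewrite (@lte_fin R).
- exact: cg.
by rewrite -G'; exact: derivable_isd.
Qed.

(** The primitives on the half-lines ]-n, oo[, normalized at 0, agree where two
of them are defined, so they glue to a primitive on the whole line. Being
defined everywhere it avoids one-sided derivatives at the ends of a time
interval. *)
Lemma antiderivative g : continuous g ->
  exists G, forall x, is_derive x 1 G (g x).
Proof.
move=> cg.
have /choice[H HP] : forall n : nat, exists G, forall x, - n%:R < x -> is_derive x 1 G (g x).
  by move=> n; exact: antiderivative_half.
pose N x := (Num.trunc `|x|).+2.
have NP x : `|x| + 1 < (N x)%:R by rewrite /N -natr1 ltrD2r truncnS_gt.
have HH n m x : `|x| < n%:R -> `|x| < m%:R -> H n x - H n 0 = H m x - H m 0.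
  move=> xn xm.
  have D (y : R) : `|y| <= `|x| -> is_derive y 1 (fun y => H n y - H m y) 0.
    move=> yx; rewrite -(subrr (g y)); apply: isdB; apply: HP.
      by have := le_lt_trans yx xn; rewrite ltr_norml => /andP[].
    by have := le_lt_trans yx xm; rewrite ltr_norml => /andP[].
  suff : H n x - H m x = H n 0 - H m 0 by lra.
  case: (lerP 0 x) => x0.
    apply/esym; apply: (@eq_of_deriv (fun y => H n y - H m y) (cst 0)) => //.
      move=> y /andP[y0 yx]; apply: D; rewrite !ger0_norm// ltW//.
    apply: (@isd_within _ (cst 0)) => y /andP[y0 yx]; apply: D.
    by rewrite !ger0_norm.
  apply: (@eq_of_deriv (fun y => H n y - H m y) (cst 0)) => //.
    exact: ltW.
    by move=> y /andP[y0 yx]; apply: D; rewrite !ltr0_norm// lerN2 ltW.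
  apply: (@isd_within _ (cst 0)) => y /andP[y0 yx]; apply: D.
  by rewrite (ltr0_norm x0) ler0_norm// lerN2.
exists (fun x => H (N x) x - H (N x) 0) => x.
have D : is_derive x 1 (fun y => H (N x) y - H (N x) 0) (g x).
  have hx : - (N x)%:R < x by have := NP x; have := ler_norm (- x); rewrite normrN; lra.
  by apply: (isd_eq (isdB (HP _ _ hx) (isd_cst _ x))); rewrite subr0.
apply: isd_near D; near=> y; apply: HH; last by have := NP y; lra.
have : `|y - x| < 1 by near: y; exists 1 => //= z /=; rewrite distrC.
have := ler_normD (y - x) x; rewrite subrK; have := NP x; lra.
Unshelve. all: end_near. Qed.

(** Gronwall's argument: the difference z - y multiplied by exp (- k t) is
nondecreasing. *)
Lemma comparison (y z dy dz : R -> R) (k T : R) :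
  (forall t, 0 < t < T -> is_derive t 1 y (dy t)) ->
  (forall t, 0 < t < T -> is_derive t 1 z (dz t)) ->
  {within `[0, T], continuous y} -> {within `[0, T], continuous z} ->
  (forall t, 0 < t < T -> dy t - dz t <= k * (y t - z t)) ->
  y 0 <= z 0 -> forall t, 0 <= t <= T -> y t <= z t.
Proof.
move=> Hy Hz cy cz H y0 t /andP[t0 tT].
have E x : is_derive x 1 (fun s => expR (- k * s)) (expR (- k * x) * - k).
  apply: (isd_eq (isd_comp (is_derive_expR _) (isdZ (- k) (isd_id x)))).
  by rewrite mulr1.
have sub : `[0, t] `<=` `[0, T].
  by move=> x /=; rewrite !in_itv/= => /andP[-> /le_trans]; apply.
pose D s := expR (- k * s) * (z s - y s).
have : D 0 <= D t.
  apply: (@le_of_deriv D (fun s => expR (- k * s) * - k * (z s - y s) +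
     expR (- k * s) * (dz s - dy s))) => //.
  - move=> x /andP[x0 xt]; have x0T : 0 < x < T by rewrite x0 (lt_le_trans xt tT).
    exact: (isdM (E x) (isdB (Hz _ x0T) (Hy _ x0T))).
  - have cE : {within `[0, t], continuous (fun s => expR (- k * s))}.
      by apply: (isd_within (f := fun x => expR (- k * x) * - k)) => x _; exact: E.
    move=> x; apply: cvgM; first exact: cE.
    apply: cvgB; [exact: (continuous_subspaceW sub cz)|exact: (continuous_subspaceW sub cy)].
  - move=> x /andP[x0 xt]; have x0T : 0 < x < T by rewrite x0 (lt_le_trans xt tT).
    rewrite -mulrA -mulrDr mulr_ge0 ?expR_ge0//.
    have := H _ x0T; lra.
rewrite /D mulr0 expR0 mul1r => H0.
have : 0 <= expR (- k * t) * (z t - y t) by apply: le_trans H0; rewrite subr_ge0.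
by rewrite pmulr_rge0 ?expR_gt0// subr_ge0.
Qed.

End calculus.

(** * Smooth functions: Sobolev norms and reflection parity *)

Section smooth_functions.
Context (R : realType).
Implicit Types (f g : R -> R) (k s : nat) (x : R).

(** Differentiable k times. Smoothness is stated with this inductive form
because it follows the recursion of the Leibniz rule. *)
Fixpoint ndiff k f : Prop := match k with
  | 0 => True
  | k'.+1 => (forall x, derivable f x 1) /\ ndiff k' (derive1 f)
  end.

Definition smooth f := forall k, ndiff k f.

Lemma ndiffS k f : ndiff k.+1 f -> ndiff k f.
Proof. by elim: k f => [//|k IH] f [df /IH]. Qed.

Lemma derive1D f g : (forall x, derivable f x 1) -> (forall x, derivable g x 1) ->
  derive1 (fun x => f x + g x) = (fun x => derive1 f x + derive1 g x).
Proof.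
by move=> df dg; apply/funext => x; apply: isd_val; apply: isdD; exact: derivable_isd.
Qed.

Lemma derive1M f g : (forall x, derivable f x 1) -> (forall x, derivable g x 1) ->
  derive1 (fun x => f x * g x) = (fun x => derive1 f x * g x + f x * derive1 g x).
Proof.
by move=> df dg; apply/funext => x; apply: isd_val; apply: isdM; exact: derivable_isd.
Qed.

Lemma ndiff_add k f g : ndiff k f -> ndiff k g -> ndiff k (fun x => f x + g x).
Proof.
elim: k f g => [//|k IH] f g [df sf] [dg sg]; split.
  by move=> x; apply: isd_derivable; apply: isdD; exact: derivable_isd.
by rewrite derive1D//; exact: IH.
Qed.

Lemma ndiff_mul k f g : ndiff k f -> ndiff k g -> ndiff k (fun x => f x * g x).
Proof.
elim: k f g => [//|k IH] f g sf sg.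
have [[df sf'] [dg sg']] := (sf, sg); split.
  by move=> x; apply: isd_derivable; apply: isdM; exact: derivable_isd.
rewrite derive1M//; apply: ndiff_add; apply: IH => //; exact: ndiffS.
Qed.

Lemma smooth_derivable f x : smooth f -> derivable f x 1.
Proof. by move=> /(_ 1%N)[]. Qed.

Lemma smooth_isd f : smooth f -> forall x, is_derive x 1 f (derive1 f x).
Proof. by move=> sf x; apply: derivable_isd; exact: smooth_derivable. Qed.

Lemma smooth_derive1 f : smooth f -> smooth (derive1 f).
Proof. by move=> sf k; have [] := sf k.+1. Qed.

Lemma smooth_continuous f : smooth f -> continuous f.
Proof. by move=> sf; exact: isd_continuous (smooth_isd sf). Qed.

Lemma smooth_L2 f : smooth f -> L2 f.
Proof. by move=> sf; exact/L2_continuous/smooth_continuous. Qed.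

Lemma smooth_mul f g : smooth f -> smooth g -> smooth (fun x => f x * g x).
Proof. by move=> sf sg k; exact: ndiff_mul. Qed.

(** The sum of the squares of the L^2 norms of the derivatives of order at most
s. *)
Fixpoint sob s f : R := match s with
  | 0 => ip0 f f
  | s'.+1 => ip0 f f + sob s' (derive1 f)
  end.

Lemma sob_ge0 s f : 0 <= sob s f.
Proof. by elim: s f => [|s IH] f /=; rewrite ?addr_ge0 ?ip0_ge0. Qed.

Lemma sob_leS s f : sob s f <= sob s.+1 f.
Proof.
elim: s f => [|s IH] f /=; first by rewrite lerDl ip0_ge0.
by rewrite lerD2l; exact: IH.
Qed.

Lemma sob_le s s' f : (s <= s')%N -> sob s f <= sob s' f.
Proof.
by elim: s' => [|s' IH]; [rewrite leqn0 => /eqP->|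
  rewrite leq_eqVlt => /predU1P[->//|/IH H]; exact: le_trans H (sob_leS _ _)].
Qed.

Lemma sob_deriv s f : sob s (derive1 f) <= sob s.+1 f.
Proof. by rewrite /= lerDr ip0_ge0. Qed.

Lemma sob_ip0 s f : ip0 f f <= sob s f.
Proof. exact: (@sob_le 0 s). Qed.

Lemma sobD s f g : smooth f -> smooth g ->
  sob s (fun x => f x + g x) <= 2 * sob s f + 2 * sob s g.
Proof.
elim: s f g => [|s IH] f g sf sg /=; first by apply: ip0D2; exact: smooth_L2.
rewrite derive1D; [|by move=> x; exact: smooth_derivable..].
have := IH _ _ (smooth_derive1 sf) (smooth_derive1 sg).
have := ip0D2 (smooth_L2 sf) (smooth_L2 sg).
rewrite -[f + g]/(fun x => f x + g x); lra.
Qed.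

(** With K a primitive of f^2 + f'^2, both K - f^2 and K + f^2 are
nondecreasing; so f(x)^2 differs from f(y)^2 by at most the square of the
Sobolev norm. Average over y. *)
Lemma sobolev f : smooth f -> forall x, 0 <= x <= 1 -> f x ^+ 2 <= 2 * sob 1 f.
Proof.
move=> sf.
have cf := smooth_continuous sf; have cf' := smooth_continuous (smooth_derive1 sf).
pose k x := f x ^+ 2 + derive1 f x ^+ 2.
have ck : continuous k.
  rewrite (_ : k = fun x => f x * f x + derive1 f x * derive1 f x).
    by apply: continuousD; exact: continuousM.
  by apply/funext => x; rewrite /k !expr2.
have [K Kk] := antiderivative ck.
have K1 : K 1 - K 0 = sob 1 f.
  rewrite -(int_deriv Kk ck)/= /ip0 -RintegralD//; last 2 first.
  - by apply: L2_mul_int; exact: smooth_L2.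
  - by apply: L2_mul_int; exact/smooth_L2/smooth_derive1.
have Kmon x y : x <= y -> K x <= K y.
  move=> xy; apply: (@le_of_deriv _ K k) => //.
  - by apply: (isd_within (f := k)) => z _; exact: Kk.
  - by move=> z _; rewrite addr_ge0 ?sqr_ge0.
have D x : is_derive x 1 (fun y => f y ^+ 2) (2 * f x * derive1 f x).
  exact: isd_sqr (smooth_isd sf x).
have up x y : x <= y -> K x - f x ^+ 2 <= K y - f y ^+ 2.
  move=> xy; apply: (@le_of_deriv _ (fun y => K y - f y ^+ 2)
    (fun x => k x - 2 * f x * derive1 f x)) => //.
  - by apply: (isd_within (f := (fun x => k x - 2 * f x * derive1 f x))) => z _; exact: (isdB (Kk z) (D z)).
  - by move=> z _; rewrite /k; have := sqr_ge0 (f z - derive1 f z); lra.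
have dn x y : x <= y -> K x + f x ^+ 2 <= K y + f y ^+ 2.
  move=> xy; apply: (@le_of_deriv _ (fun y => K y + f y ^+ 2)
    (fun x => k x + 2 * f x * derive1 f x)) => //.
  - by apply: (isd_within (f := (fun x => k x + 2 * f x * derive1 f x))) => z _; exact: (isdD (Kk z) (D z)).
  - by move=> z _; rewrite /k; have := sqr_ge0 (f z + derive1 f z); lra.
move=> x /andP[x0 x1].
have H y : 0 <= y <= 1 -> f x ^+ 2 <= f y ^+ 2 + sob 1 f.
  move=> /andP[y0 y1]; rewrite -K1.
  have := Kmon _ _ x0; have := Kmon _ _ x1; have := Kmon _ _ y0; have := Kmon _ _ y1.
  by case: (lerP x y) => xy; [have := dn _ _ xy|have := up _ _ (ltW xy)]; lra.
suff : f x ^+ 2 <= ip0 f f + sob 1 f by have := @sob_ip0 1 f; lra.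
have c2 : continuous (fun y : R => f y ^+ 2 + sob 1 f).
  apply: continuousD; last exact: cst_continuous.
  by under eq_fun do rewrite expr2; exact: continuousM.
have Lc (z : R) : L2 (fun _ : R => z) by apply: L2_continuous; exact: cst_continuous.
have Ic (z : R) : \int[@muO R]_y z = z.
  by rewrite (Rintegral_cst _ measurableT); have /= -> := @muOT R; rewrite mulr1.
have -> : ip0 f f + sob 1 f = \int[@muO R]_y (f y ^+ 2 + sob 1 f).
  rewrite RintegralD//; last 2 first.
  - by apply: L2_int; apply: L2_continuous; under eq_fun do rewrite expr2; exact: continuousM.
  - exact: L2_int (Lc _).
  by rewrite Ic /ip0; congr (fine _ + _); apply: eq_integral => y _; rewrite expr2.
have i1 := L2_int (Lc (f x ^+ 2)); have i2 := L2_int (L2_continuous c2).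
rewrite -[leLHS]Ic Rintegral_muO// [leRHS]Rintegral_muO//.
have mI : measurable ([set` `]0, 1[] : set (measurableTypeR R)) by exact: measurable_itv.
apply: (le_Rintegral mI).
- exact: integrable_muO_leb.
- exact: integrable_muO_leb.
- by move=> y /=; rewrite in_itv/= => /andP[y0 y1]; apply: H; rewrite !ltW.
Qed.

Lemma sup_mul_L2 f g (M : R) : continuous f -> (forall x, 0 <= x <= 1 -> f x ^+ 2 <= M) ->
  L2 g -> L2 (fun x => f x * g x) /\
    ip0 (fun x => f x * g x) (fun x => f x * g x) <= M * ip0 g g.
Proof.
move=> cf fM Lg; apply: L2_aebound => //; first exact: continuous_meas.
by apply: aeO_itv => x x0 x1; apply: fM; rewrite !ltW.
Qed.

Let step_arith (P Q p q x X Y M C : R) : P <= 2 * x -> Q <= 2 * p + 2 * q ->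
  p <= C * X -> q <= C * Y -> x <= M -> C * X <= C * M -> C * Y <= C * M ->
  P + Q <= (2 + 4 * C) * M.
Proof. lra. Qed.

(** The algebra property of the Sobolev spaces of order at least 1. One
derivative falls on one of the factors, the induction hypothesis bounds the
remaining ones, and [sobolev] bounds the undifferentiated factor in the base
case. *)
Lemma sob_mul s : (0 < s)%N -> exists2 C : R, 0 <= C &
  forall f g, smooth f -> smooth g -> sob s (fun x => f x * g x) <= C * (sob s f * sob s g).
Proof.
case: s => [//|s] _; elim: s => [|s [C C0 IH]].
  (* 10 = 2 + 2 (2 + 2), from two products bounded in the maximum norm *)
  exists 10 => // f g sf sg; rewrite /=.
  rewrite derive1M; [|by move=> x; exact: smooth_derivable..].
  have Sf := sobolev sf; have Sg := sobolev sg.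
  have sf' := smooth_derive1 sf; have sg' := smooth_derive1 sg.
  have [_ H1] := sup_mul_L2 (smooth_continuous sf) Sf (smooth_L2 sg).
  have [L2' H2] := sup_mul_L2 (smooth_continuous sg) Sg (smooth_L2 sf').
  have [L3' H3] := sup_mul_L2 (smooth_continuous sf) Sf (smooth_L2 sg').
  have := ip0D2 L2' L3'.
  rewrite (_ : (fun x => g x * _) = (fun x => derive1 f x * g x)) in H2 *; last first.
    by apply/funext => x; rewrite mulrC.
  move=> H4; apply: le_trans (lerD H1 H4) _.
  move: H2 H3; rewrite -[sob 1 f]/(ip0 f f + _) -[sob 1 g]/(ip0 g g + _)/=.
  have := ip0_ge0 f; have := ip0_ge0 g.
  have := ip0_ge0 (derive1 f); have := ip0_ge0 (derive1 g).
  move: (ip0 f f) (ip0 g g) (ip0 (derive1 f) (derive1 f)) (ip0 (derive1 g) (derive1 g)).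
  move: (ip0 _ _) (ip0 _ _) => P Q a b a' b' b'0 a'0 b0 a0 H2 H3.
  have ab : 0 <= a * b by rewrite mulr_ge0.
  have ab' : 0 <= a * b' by rewrite mulr_ge0.
  have a'b : 0 <= a' * b by rewrite mulr_ge0.
  have a'b' : 0 <= a' * b' by rewrite mulr_ge0.
  lra.
exists (2 + 4 * C); first by rewrite addr_ge0// mulr_ge0.
move=> f g sf sg.
have sf' := smooth_derive1 sf; have sg' := smooth_derive1 sg.
have -> : sob s.+2 (fun x => f x * g x) = ip0 (fun x => f x * g x) (fun x => f x * g x) +
    sob s.+1 (derive1 (fun x => f x * g x)) by [].
rewrite derive1M; [|by move=> x; exact: smooth_derivable..].
have [_ H1] := sup_mul_L2 (smooth_continuous sf) (sobolev sf) (smooth_L2 sg).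
have H2 := sobD s.+1 (smooth_mul sf' sg) (smooth_mul sf sg').
have H3 := IH _ _ sf' sg; have H4 := IH _ _ sf sg'.
have f1 : sob 1 f <= sob s.+2 f by exact: sob_le.
have f2 := sob_deriv s.+1 f; have f3 := sob_leS s.+1 f.
have g1 : ip0 g g <= sob s.+2 g by exact: sob_ip0.
have g2 := sob_deriv s.+1 g; have g3 := sob_leS s.+1 g.
have X1 : sob 1 f * ip0 g g <= sob s.+2 f * sob s.+2 g.
  exact: (ler_pM (sob_ge0 _ _) (ip0_ge0 _) f1 g1).
have X2 : sob s.+1 (derive1 f) * sob s.+1 g <= sob s.+2 f * sob s.+2 g.
  exact: (ler_pM (sob_ge0 _ _) (sob_ge0 _ _) f2 g3).
have X3 : sob s.+1 f * sob s.+1 (derive1 g) <= sob s.+2 f * sob s.+2 g.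
  exact: (ler_pM (sob_ge0 _ _) (sob_ge0 _ _) f3 g2).
have X2' := ler_wpM2l C0 X2; have X3' := ler_wpM2l C0 X3.
rewrite -mulrA in H1.
exact: step_arith H1 H2 H3 H4 X1 X2' X3'.
Qed.

End smooth_functions.

Section reflection_parity.
Context (R : realType).
Implicit Types (f g : R -> R) (x sg : R).

(** Even (sg = 1) or odd (sg = -1) both about 0 and about 1. Sine polynomials
are odd and cosine polynomials even; the class is stable under products and
derivatives, which gives at once all boundary conditions needed for repeated
integration by parts. *)
Definition refl sg f := forall x, f (- x) = sg * f x /\ f (2 - x) = sg * f x.

Lemma refl_mul sg tau f g : refl sg f -> refl tau g -> refl (sg * tau) (fun x => f x * g x).
Proof.
by move=> Hf Hg x; have [-> ->] := Hf x; have [-> ->] := Hg x; split; ring.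
Qed.

Lemma refl_derive1 sg f : refl sg f -> (forall x, derivable f x 1) ->
  refl (- sg) (derive1 f).
Proof.
move=> Hf df x; split.
  have : is_derive x 1 (fun y => f (- y)) (derive1 f (- x) * -1).
    exact: (isd_comp (derivable_isd (df _)) (isdN (isd_id x))).
  rewrite (_ : (fun y => _) = (fun y => sg * f y)); last by apply/funext => y; have [] := Hf y.
  move/isd_val => E; have := isd_val (isdZ sg (derivable_isd (df x))).
rewrite E => E'; rewrite mulNr -E'; ring.
have : is_derive x 1 (fun y => f (2 - y)) (derive1 f (2 - x) * (0 - 1)).
  exact: (isd_comp (derivable_isd (df _)) (isdB (isd_cst 2 x) (isd_id x))).
rewrite (_ : (fun y => f (2 - y)) = (fun y => sg * f y)); last by apply/funext => y; have [] := Hf y.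
move/isd_val => E; have := isd_val (isdZ sg (derivable_isd (df x))).
rewrite E => E'; rewrite mulNr -E'; ring.
Qed.

Lemma refl_boundary f : refl (-1) f -> f 0 = 0 /\ f 1 = 0.
Proof.
move=> Hf; have [] := Hf 0; have [_] := Hf 1.
rewrite oppr0 (_ : 2 - 1 = 1 :> R); last by ring.
by move=> H1 H0 _; split; lra.
Qed.

(** Integration by parts; an odd function vanishes at 0 and 1. *)
Lemma om_sinm f k : smooth f -> refl (-1) f -> om k * ip0 f (sinm k) = ip0 (derive1 f) (cosm k).
Proof.
move=> sf rf; have [f0 f1] := refl_boundary rf.
have := @ip0_parts R f (cosm k) (derive1 f) (fun x => - (om k * sinm k x)) (smooth_isd sf) (@isd_cosm R k).
have Ls := @L2_sinm R k; have Lf := smooth_L2 sf.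
rewrite f0 f1 !mul0r subrr sub0r -[(fun x => - _)]/(- (om k *: sinm k)).
rewrite ip0Nr//; last exact: L2Z.
rewrite ip0Zr// => H; apply: oppr_inj; apply: H.
  exact/smooth_continuous/smooth_derive1.
by move=> x; apply: cvgN; apply: cvgZl_tmp; exact: continuous_sinm.
Qed.

Lemma om_cosm f k : smooth f -> om k * ip0 f (cosm k) = - ip0 (derive1 f) (sinm k).
Proof.
move=> sf.
have := @ip0_parts R f (sinm k) (derive1 f) (fun x => om k * cosm k x) (smooth_isd sf) (@isd_sinm R k).
have Ls := @L2_cosm R k; have Lf := smooth_L2 sf.
rewrite sinm0 sinm1 !mulr0 subrr sub0r -[(fun x => om k * _)]/(om k *: cosm k).
rewrite ip0Zr//; apply.
  exact/smooth_continuous/smooth_derive1.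
by move=> x; apply: cvgZl_tmp; exact: continuous_cosm.
Qed.

(** Integrating by parts s times turns omega^s times a coefficient of f into a
coefficient of its derivative of order s, alternately against sines and
cosines; the parity of f makes the boundary terms vanish. Conclude with
Bessel's inequality. *)
Lemma sob_bessel s f : smooth f ->
  (refl (-1) f -> ssq (fun k => om k ^+ s * ip0 f (sinm k)) (sob s f)) /\
  (refl 1 f -> ssq (fun k => om k ^+ s * ip0 f (cosm k)) (sob s f)).
Proof.
elim: s f => [|s IH] f sf.
  split=> _; under eq_fun do rewrite expr0 mul1r; apply: Bessel; try exact: smooth_L2.
  - exact: L2_sinm.
  - exact: ip0_sinm.
  - exact: L2_cosm.
  - exact: ip0_cosm.
have sf' := smooth_derive1 sf; have df x : derivable f x 1 := smooth_derivable sf.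
have [IH1 IH2] := IH _ sf'; have D := sob_deriv s f; split => rf.
  rewrite (_ : (fun k => _) = (fun k => om k ^+ s * ip0 (derive1 f) (cosm k))).
    by apply: ssq_le D; apply: IH2; rewrite -[1]opprK; exact: refl_derive1.
  by apply/funext => k; rewrite exprSr -mulrA om_sinm.
apply: (@ssq_le _ _ (sob s (derive1 f))) => //.
apply: ssq_dom (IH1 (refl_derive1 rf df)) _ => k.
by rewrite (exprSr (om k) s) -mulrA om_cosm// mulrN sqrrN.
Qed.

Lemma refl_sinm k : refl (-1) (@sinm R k).
Proof.
move=> x; rewrite !sinmE; split; first by rewrite mulrN sinN; ring.
have -> : om k * (2 - x) = om k + om k - om k * x by ring.
have s0 : sin (om k) = 0 :> R by rewrite omE sin_natpi.
have c1 : cos (om k) ^+ 2 = 1 :> R by rewrite -(cos2Dsin2 (om k)) s0 expr0n addr0.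
by rewrite sinB sinD cosD !s0 !mulr0 !mul0r -expr2 c1; ring.
Qed.

Lemma refl_psum a N : refl (-1) (psum (@sinm R) a N).
Proof.
move=> x; rewrite /psum !fct_sumE !mulr_sumr; split; apply: eq_bigr => k _.
  by have [H _] := @refl_sinm k x; rewrite -[LHS]/(_ * _) H -[(_ *: _) x]/(_ * _); ring.
by have [_ H] := @refl_sinm k x; rewrite -[LHS]/(_ * _) H -[(_ *: _) x]/(_ * _); ring.
Qed.

Lemma isd_psum_sinm a N x : is_derive x 1 (psum (@sinm R) a N)
  (psum (@cosm R) (fun k => om k * a k) N x).
Proof.
rewrite (_ : psum sinm a N = (fun y => \sum_(k < N) a k * sinm k y)); last first.
  by apply/funext => y; rewrite /psum fct_sumE.
apply: (@isd_eq _ _ _ (\sum_(k < N) a k * (om k * cosm k x))).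
  by apply: isd_sum => k _; apply: isdZ; exact: isd_sinm.
rewrite /psum fct_sumE; apply: eq_bigr => k _; rewrite -[RHS]/(_ * _); ring.
Qed.

Lemma isd_psum_cosm a N x : is_derive x 1 (psum (@cosm R) a N)
  (psum (@sinm R) (fun k => - (om k * a k)) N x).
Proof.
rewrite (_ : psum cosm a N = (fun y => \sum_(k < N) a k * cosm k y)); last first.
  by apply/funext => y; rewrite /psum fct_sumE.
apply: (@isd_eq _ _ _ (\sum_(k < N) a k * - (om k * sinm k x))).
  by apply: isd_sum => k _; apply: isdZ; exact: isd_cosm.
rewrite /psum fct_sumE; apply: eq_bigr => k _; rewrite -[RHS]/(_ * _); ring.
Qed.

Lemma derive1_psum a N :
  derive1 (psum (@sinm R) a N) = psum (@cosm R) (fun k => om k * a k) N /\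
  derive1 (psum (@cosm R) a N) = psum (@sinm R) (fun k => - (om k * a k)) N.
Proof.
by split; apply/funext => x; apply: isd_val; [exact: isd_psum_sinm|exact: isd_psum_cosm].
Qed.

Lemma smooth_psum a N : smooth (psum (@sinm R) a N) /\ smooth (psum (@cosm R) a N).
Proof.
suff H k : forall a, ndiff k (psum (@sinm R) a N) /\ ndiff k (psum (@cosm R) a N).
  by split=> k; have [] := H k a.
elim: k => [//|k IH] b; have [D1 D2] := derive1_psum b N; split; split.
- by move=> x; exact: isd_derivable (isd_psum_sinm b N x).
- by rewrite D1; have [] := IH (fun k => om k * b k).
- by move=> x; exact: isd_derivable (isd_psum_cosm b N x).
- by rewrite D2; have [] := IH (fun k => - (om k * b k)).
Qed.

Lemma ip0_psumE (f : nat -> R -> R) a N : (forall k, L2 (f k)) ->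
  (forall k l, ip0 (f k) (f l) = (k == l)%:R) ->
  ip0 (psum f a N) (psum f a N) = \sum_(k < N) a k ^+ 2.
Proof.
by move=> Lf fo; rewrite /psum -(big_mkord xpredT (fun k => a k *: f k)) ip0_span// big_mkord.
Qed.

(** The derivatives of a sine polynomial are again trigonometric polynomials
with orthonormal terms, and each of the s + 1 norms is at most the one of
highest order because omega_k >= 1. *)
Lemma sob_psum s a B N : bd s a B -> sob s (psum (@sinm R) a N) <= s.+1%:R * B.
Proof.
suff H : forall a B, bd s a B -> sob s (psum (@sinm R) a N) <= s.+1%:R * B /\
    sob s (psum (@cosm R) a N) <= s.+1%:R * B by move=> /H[].
elim: s => [|s IH] {}a {}B.
  rewrite bd_ssq => aB; rewrite /= mul1r !ip0_psumE//;
    [exact: L2_cosm|exact: ip0_cosm|exact: L2_sinm|exact: ip0_sinm].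
move=> aB; have := bd_anti (leq0n _) aB; rewrite bd_ssq => a0.
have := (bdS _ _ _).1 aB => a1; have a2 := bdN a1.
have [D1 D2] := derive1_psum a N; rewrite /= D1 D2.
rewrite (ip0_psumE a N (@L2_sinm R) (@ip0_sinm R)) (ip0_psumE a N (@L2_cosm R) (@ip0_cosm R)).
have -> : s.+2%:R * B = B + s.+1%:R * B by rewrite -natr1; ring.
split; apply: lerD => //.
  by have [] := IH _ _ a1.
by have [] := IH _ _ a2.
Qed.

End reflection_parity.

(** * Products of three functions in the domains of fractional powers *)

Section triple_products.
Context (R : realType).
Local Notation mu := (@muO R).
Implicit Types (a b c : nat -> R) (f g h u v w : R -> R) (s k N : nat) (A B D M : R).

(** Fatou's lemma for sequences. *)
Lemma ssq_cvg (c_ : nat -> nat -> R) a M : (forall N, ssq (c_ N) M) ->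
  (forall k, c_ N k @[N --> \oo] --> a k) -> ssq a M.
Proof.
move=> cM ca n.
have H : (fun N => \sum_(k < n) c_ N k ^+ 2) @ \oo --> \sum_(k < n) a k ^+ 2.
  elim: n => [|n IH]; first by under eq_fun do rewrite big_ord0; rewrite big_ord0; exact: cvg_cst.
  under eq_fun do rewrite big_ord_recr/= expr2; rewrite big_ord_recr/= expr2.
  by apply: cvgD => //; apply: cvgM; exact: ca.
rewrite -(cvg_lim (@Rhausdorff R) H); apply: limr_le.
  by apply/cvg_ex; eexists; exact: H.
by apply: nearW => N; exact: cM.
Qed.

Lemma cf_sqr g k : L2 g -> cf g k ^+ 2 <= ip0 g g.
Proof. by move=> /cf_bessel/bd_coef. Qed.

Lemma cf_cvg (h_ : nat -> R -> R) h k : (forall N, L2 (h_ N)) -> L2 h ->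
  (forall eps, 0 < eps -> exists N0, forall N, (N0 <= N)%N ->
    ip0 (h - h_ N) (h - h_ N) <= eps) ->
  cf (h_ N) k @[N --> \oo] --> cf h k.
Proof.
move=> Lh_ Lh H; apply/cvgrPdist_le => e e0.
have [N0 HN] := H _ (exprn_gt0 2 e0).
exists N0 => // N /= N0N; rewrite -cfB//.
rewrite -ler_sqr ?nnegrE ?(ltW e0)// real_normK ?num_real//.
by apply: le_trans (cf_sqr k (L2B Lh (Lh_ N))) (HN _ N0N).
Qed.

Definition ae_bounded f M := measurable_fun setT f /\ {ae mu, forall x, f x ^+ 2 <= M}.

Lemma ae_bounded_ge0 f M : ae_bounded f M -> 0 <= M.
Proof. by move=> [_ /aeO_exists[x]]; apply: le_trans; exact: sqr_ge0. Qed.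

Lemma ae_bounded_mul f g M : ae_bounded f M -> L2 g ->
  L2 (fun x => f x * g x) /\ ip0 (fun x => f x * g x) (fun x => f x * g x) <= M * ip0 g g.
Proof. by move=> [mf fM] Lg; exact: L2_aebound. Qed.

Lemma ae_bounded_mul2 f g h M D : ae_bounded f M -> ae_bounded g D -> L2 h ->
  L2 (fun x => f x * (g x * h x)) /\
  ip0 (fun x => f x * (g x * h x)) (fun x => f x * (g x * h x)) <= M * D * ip0 h h.
Proof.
move=> fM gD Lh; have [L1 H1] := ae_bounded_mul gD Lh; have [L2' H2] := ae_bounded_mul fM L1.
split=> //; apply: le_trans H2 _; rewrite -mulrA ler_wpM2l//; exact: ae_bounded_ge0 fM.
Qed.

Lemma bd_ae_bounded g s B : L2 g -> (0 < s)%N -> bd s (cf g) B -> ae_bounded g B.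
Proof.
move=> Lg s0 gB; split; first exact: L2_meas.
by apply: sup_bound => //; exact: bd_anti gB.
Qed.

Lemma psum_ae_bounded a s B N : (0 < s)%N -> bd s a B -> ae_bounded (psum sinm a N) B.
Proof.
move=> s0 aB; split; first by apply: L2_meas; apply: L2_psum; exact: L2_sinm.
by apply: aeOT => x; apply: psum_sup; exact: bd_anti aB.
Qed.

(** The product of three sine polynomials is odd about 0 and 1, so [sob_bessel]
applies to it; its Sobolev norm is estimated by [sob_mul]. *)
Lemma tri_psum s : (0 < s)%N -> exists2 C : R, 0 <= C & forall a b c A B D N,
  bd s a A -> bd s b B -> bd s c D ->
  bd s (cf (fun x => psum sinm a N x * (psum sinm b N x * psum sinm c N x))) (C * (A * (B * D))).
Proof.
move=> s0; have [C C0 HC] := @sob_mul R s s0.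
exists (C ^+ 2 * s.+1%:R ^+ 3) => [|a b c A B D N aA bB cD].
  by rewrite mulr_ge0// exprn_ge0.
have [sa _] := smooth_psum a N; have [sb _] := smooth_psum b N; have [sc _] := smooth_psum c N.
have sbc := smooth_mul sb sc; have sabc := smooth_mul sa sbc.
have [H _] := sob_bessel s sabc.
apply: ssq_le (H _) _.
  have := refl_mul (refl_psum a N) (refl_mul (refl_psum b N) (refl_psum c N)).
  by rewrite !mulN1r opprK.
have Ha := sob_psum N aA; have Hb := sob_psum N bB; have Hc := sob_psum N cD.
have Hbc := HC _ _ sb sc; have Habc := HC _ _ sa sbc.
apply: le_trans Habc _.
have -> : C ^+ 2 * s.+1%:R ^+ 3 * (A * (B * D)) =
   C * ((s.+1%:R * A) * (C * ((s.+1%:R * B) * (s.+1%:R * D)))) by ring.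
rewrite ler_wpM2l//; apply: ler_pM (sob_ge0 _ _) (sob_ge0 _ _) Ha _.
apply: le_trans Hbc _; rewrite ler_wpM2l//.
exact: ler_pM (sob_ge0 _ _) (sob_ge0 _ _) Hb Hc.
Qed.

Lemma psum_cf_cvg g eps : L2 g -> 0 < eps -> exists N0, forall N, (N0 <= N)%N ->
  ip0 (g - psum sinm (cf g) N) (g - psum sinm (cf g) N) <= eps.
Proof. by move=> Lg e0; exact: (expands_psum_small (cf_ssq Lg) (cf_expands Lg) e0). Qed.

(** The domain of A^{s/2} is stable under products of three factors when s >=
1. The estimate of [tri_psum] passes to the limit: all factors are bounded
functions, so the products of the partial sums converge in L^2 and hence in
every coefficient. *)
Lemma triple_product s : (0 < s)%N -> exists2 C : R, 0 <= C & forall u v w A B D,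
  L2 u -> L2 v -> L2 w -> bd s (cf u) A -> bd s (cf v) B -> bd s (cf w) D ->
  L2 (fun x => u x * (v x * w x)) /\
  bd s (cf (fun x => u x * (v x * w x))) (C * (A * (B * D))).
Proof.
move=> s0; have [C C0 HC] := tri_psum s0; exists C => // u v w A B D Lu Lv Lw uA vB wD.
have Au := bd_ae_bounded Lu s0 uA; have Av := bd_ae_bounded Lv s0 vB; have Aw := bd_ae_bounded Lw s0 wD.
have [L3 _] := ae_bounded_mul2 Au Av Lw; split => //.
pose U N := psum sinm (cf u) N; pose V N := psum sinm (cf v) N; pose W N := psum sinm (cf w) N.
have LU N : L2 (U N) by exact/L2_psum/L2_sinm.
have LV N : L2 (V N) by exact/L2_psum/L2_sinm.
have LW N : L2 (W N) by exact/L2_psum/L2_sinm.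
have AU N : ae_bounded (U N) A by exact: psum_ae_bounded uA.
have AV N : ae_bounded (V N) B by exact: psum_ae_bounded vB.
have L3N N : L2 (fun x => U N x * (V N x * W N x)) by have [] := ae_bounded_mul2 (AU N) (AV N) (LW N).
have A0 := ae_bounded_ge0 Au; have B0 := ae_bounded_ge0 Av; have D0 := ae_bounded_ge0 Aw.
apply: (@ssq_cvg (fun N k => om k ^+ s * cf (fun x => U N x * (V N x * W N x)) k)).
  by move=> N; exact: HC.
move=> k; apply: cvgM; first exact: cvg_cst.
apply: cf_cvg => // eps e0.
have K0 : 0 < 2 * (B * D) + (4 * (A * D) + 4 * (A * B)) + 1.
  by rewrite ltr_wpDl// !addr_ge0// !mulr_ge0.
have d0 := divr_gt0 e0 K0.
have [N1 H1] := psum_cf_cvg Lu d0; have [N2 H2] := psum_cf_cvg Lv d0.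
have [N3 H3] := psum_cf_cvg Lw d0.
exists (maxn N1 (maxn N2 N3)) => N; rewrite !geq_max => /and3P[n1 n2 n3].
have LuU := L2B Lu (LU N); have LvV := L2B Lv (LV N); have LwW := L2B Lw (LW N).
have [T1 E1] := ae_bounded_mul2 Av Aw LuU.
have [T2 E2] := ae_bounded_mul2 (AU N) Aw LvV.
have [T3 E3] := ae_bounded_mul2 (AU N) (AV N) LwW.
rewrite (_ : _ - _ = (fun x => v x * (w x * (u - U N) x)) +
  ((fun x => U N x * (w x * (v - V N) x)) + (fun x => U N x * (V N x * (w - W N) x)))); last first.
  by apply/funext => x; rewrite !fctE; ring.
apply: le_trans (ip0D2 T1 (L2D T2 T3)) _.
have E4 := ip0D2 T2 T3.
have F1 := ler_wpM2l (mulr_ge0 B0 D0) (H1 N n1).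
have F2 := ler_wpM2l (mulr_ge0 A0 D0) (H2 N n2).
have F3 := ler_wpM2l (mulr_ge0 A0 B0) (H3 N n3).
have Ee : eps = (2 * (B * D) + (4 * (A * D) + 4 * (A * B)) + 1) *
   (eps / (2 * (B * D) + (4 * (A * D) + 4 * (A * B)) + 1)).
  by rewrite mulrC divfK// gt_eqF.
move: (eps / _) Ee d0 F1 F2 F3 E1 E2 E3 E4 => d Ee d0 F1 F2 F3 E1 E2 E3 E4.
rewrite Ee; move: (ip0 _ _) (ip0 _ _) (ip0 _ _) (ip0 _ _) (ip0 _ _) (ip0 _ _) (ip0 _ _) E1 E2 E3 E4 F1 F2 F3.
move=> p1 p2 p3 p4 p5 p6 p7; lra.
Qed.

End triple_products.

(** * Smooth cut-off functions *)

Section cutoff.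
Context (R : realType).
Implicit Types (f g F : R -> R) (k s j : nat) (x y t : R) (p q : {poly R}).

(** Differentiability in the form of a first order expansion without quotients.
*)
Lemma isd_eps F x (d : R) : (forall eps, 0 < eps -> exists2 del, 0 < del &
    forall h, `|h| < del -> `|F (x + h) - F x - d * h| <= eps * `|h|) ->
  is_derive x 1 F d.
Proof.
move=> H.
have D : (fun h => h^-1 *: (F (h *: (1 : R) + x) - F x)) @ 0^' --> d.
  apply/cvgrPdist_le => e e0; have [del d0 Hd] := H e e0.
  near=> h.
  have h0 : h != 0 by near: h; exact: nbhs_dnbhs_neq.
  have hd : `|h| < del.
    near: h; apply: dnbhs0_lt => //.
  have -> : h^-1 *: (F (h *: (1 : R) + x) - F x) = h^-1 * (F (x + h) - F x).
    by rewrite -[h *: 1]/(h * 1) mulr1 (addrC h).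
  rewrite -(ler_pM2r (_ : 0 < `|h|)) ?normr_gt0// -normrM.
  have -> : (d - h^-1 * (F (x + h) - F x)) * h = - (F (x + h) - F x - d * h).
    by field.
  by rewrite normrN; exact: Hd.
split; first by apply/cvg_ex; exists d.
by apply: cvg_lim => //; exact: Rhausdorff.
Unshelve. all: end_near. Qed.

Lemma expR_ge_pow n t : 0 <= t -> t ^+ n <= n%:R ^+ n * expR t.
Proof.
move=> t0; case: n => [|n]; first by rewrite expr0 mul1r -[leLHS]addr0 (le_trans _ (expR_ge1Dx _))// lerD2l.
have -> : t ^+ n.+1 = n.+1%:R ^+ n.+1 * (t / n.+1%:R) ^+ n.+1.
  by rewrite -exprMn mulrC divfK// pnatr_eq0.
rewrite ler_wpM2l ?exprn_ge0//.
have -> : expR t = expR (t / n.+1%:R) ^+ n.+1.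
  by rewrite -expRM_natr divfK// pnatr_eq0.
rewrite ler_pXn2r ?nnegrE ?expR_ge0 ?divr_ge0//.
by apply: le_trans (expR_ge1Dx _); rewrite lerDr.
Qed.

(** p(1/y) exp (-1/y), extended by 0: for all polynomials p at once, this
family contains the standard flat function and is closed under differentiation.
*)
Definition polyexp p y : R := if 0 < y then p.[y^-1] * expR (- y^-1) else 0.

Lemma poly_exp_bound p : exists2 C : R, 0 <= C & forall t, 0 <= t ->
  `|p.[t]| * expR (- t) <= C.
Proof.
exists (\sum_(i < size p) `|p`_i| * i%:R ^+ i) => [|t t0].
  by apply: sumr_ge0 => i _; rewrite mulr_ge0.
rewrite horner_coef; apply: (@le_trans _ _ ((\sum_(i < size p) `|p`_i| * t ^+ i) * expR (- t))).
  rewrite ler_wpM2r ?expR_ge0//; apply: le_trans (ler_norm_sum _ _ _) _.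
  by apply: ler_sum => i _; rewrite normrM (ger0_norm (exprn_ge0 _ t0)).
rewrite mulr_suml; apply: ler_sum => i _; rewrite -mulrA ler_wpM2l//.
by rewrite expRN ler_pdivrMr ?expR_gt0//; exact: expR_ge_pow.
Qed.

(** A quadratic bound at 0 makes the derivative at 0 exist and vanish. *)
Lemma polyexp_quad p : exists2 C : R, 0 <= C & forall y, `|polyexp p y| <= C * y ^+ 2.
Proof.
have [C C0 HC] := poly_exp_bound ('X ^+ 2 * p); exists C => // y.
rewrite /polyexp; case: ifPn => y0; last by rewrite normr0 mulr_ge0 ?sqr_ge0.
have yi0 : 0 <= y^-1 by rewrite invr_ge0 ltW.
have := HC _ yi0; rewrite !hornerE normrM (ger0_norm (exprn_ge0 2 yi0)).
rewrite normrM (ger0_norm (expR_ge0 _)) exprVn -mulrA mulrC ler_pdivrMr ?exprn_gt0//.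
by rewrite /= expr2 mulrA.
Qed.

(** The derivative of p(1/y) exp (-1/y) is (1/y)^2 (p - p')(1/y) exp (-1/y). *)
Lemma isd_polyexp p y : is_derive y 1 (polyexp p) (polyexp ('X ^+ 2 * (p - p^`())) y).
Proof.
case: (ltgtP 0 y) => [y0|y0|<-].
- have yn0 : y != 0 by rewrite gt_eqF.
  have Dinv : is_derive y 1 (fun x : R => x^-1) (- y ^- 2).
    apply: (isd_eq (is_deriveV yn0 (isd_id y))); by rewrite -[_ *: _]/(_ * _) mulr1.
  have D1 : is_derive y 1 (fun x => p.[x^-1]) (p^`().[y^-1] * - y ^- 2).
    exact: (isd_comp (is_derive_poly p y^-1) Dinv).
  have D2 : is_derive y 1 (fun x : R => expR (- x^-1)) (expR (- y^-1) * y ^- 2).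
    by apply: (isd_eq (isd_comp (is_derive_expR _) (isdN Dinv))); rewrite opprK.
  have D := isdM D1 D2.
  apply: (@isd_near _ (fun x => p.[x^-1] * expR (- x^-1))).
    near=> z; rewrite /polyexp ifT//; near: z; exact: lt_nbhsr.
  apply: (isd_eq D); rewrite /polyexp y0 hornerM hornerXn hornerD hornerN exprVn. move: (p.[_]) (p^`().[_]) (expR _) => a b c.  by field.
- have -> : polyexp ('X ^+ 2 * (p - p^`())) y = 0 by rewrite /polyexp ltNge (ltW y0).
  have D0 := isd_cst (0 : R) y; apply: isd_near D0.
  near=> z; rewrite /polyexp ifF//; apply/negbTE; rewrite -leNgt ltW//; near: z; exact: lt_nbhsl.
- have -> : polyexp ('X ^+ 2 * (p - p^`())) 0 = 0 by rewrite /polyexp ltxx.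
  have [C C0 HC] := polyexp_quad p.
  apply: isd_eps => e e0; exists (e / (C + 1)); first by rewrite divr_gt0// ltr_wpDl.
  move=> h hd; rewrite add0r mul0r subr0 (_ : polyexp p 0 = 0) ?subr0; last by rewrite /polyexp ltxx.
  apply: le_trans (HC h) _; rewrite -real_normK ?num_real// expr2 mulrA ler_wpM2r//.
  have : `|h| * (C + 1) < e by rewrite -ltr_pdivlMr// ltr_wpDl.
  have := normr_ge0 h; nra.
Unshelve. all: end_near. Qed.

Lemma ndiff_horner k q : ndiff k (horner q).
Proof.
elim: k q => [//|k IH] q; split; first by move=> x; exact: isd_derivable (is_derive_poly _ _).
by rewrite (_ : derive1 _ = horner q^`())//; apply/funext => x; apply: isd_val.
Qed.

Lemma ndiff_polyexp k p q : ndiff k (fun x => polyexp p q.[x]).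
Proof.
elim: k p => [//|k IH] p.
have D x : is_derive x 1 (fun x => polyexp p q.[x]) (polyexp ('X ^+ 2 * (p - p^`())) q.[x] * q^`().[x]).
  exact: (isd_comp (isd_polyexp p q.[x]) (is_derive_poly q x)).
split; first by move=> x; exact: isd_derivable (D x).
rewrite (_ : derive1 _ = (fun x => polyexp ('X ^+ 2 * (p - p^`())) q.[x] * q^`().[x])).
  by apply: ndiff_mul; [exact: IH|exact: ndiff_horner].
by apply/funext => x; exact: isd_val (D x).
Qed.

Lemma smooth_polyexp p q : smooth (fun x => polyexp p q.[x]).
Proof. by move=> k; exact: ndiff_polyexp. Qed.

(** Positive exactly where x (1 - x) exceeds 1 / (j + 1). *)
Definition chiq j : {poly R} := j.+1%:R *: ('X * (1 - 'X)) - 1.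
(** A cut-off equal to exp (-1/y), with y = (j + 1) x (1 - x) - 1, where y is
positive. It is supported in a compact subset of the open unit interval and
increases to 1 there. *)
Definition chi j x : R := polyexp 1 (chiq j).[x].

Lemma chiqE j x : (chiq j).[x] = j.+1%:R * (x * (1 - x)) - 1.
Proof. by rewrite /chiq !hornerE. Qed.

Lemma chi_ge0 j x : 0 <= chi j x.
Proof. by rewrite /chi /polyexp; case: ifP => // _; rewrite hornerC mul1r expR_ge0. Qed.

Lemma chi_le1 j x : chi j x <= 1.
Proof.
rewrite /chi /polyexp; case: ifPn => // h; rewrite hornerC mul1r.
by rewrite -expR0 ler_expR lerNl oppr0 invr_ge0 ltW.
Qed.

Lemma chi_supp j x : chi j x != 0 -> j.+1%:R^-1 <= x <= 1 - j.+1%:R^-1.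
Proof.
rewrite /chi /polyexp; case: ifPn => [|_]; last by rewrite eqxx.
rewrite chiqE subr_gt0 => H _.
have j0 : 0 < j.+1%:R :> R by rewrite ltr0n.
have {}H : j.+1%:R^-1 < x * (1 - x) by rewrite -[ltLHS]mulr1 ltr_pdivrMl.
move: H; move: (j.+1%:R^-1) (invr_gt0 (j.+1%:R : R)); rewrite j0 => d d0 H.
have x0 : 0 < x by apply: contraTT isT => /=; rewrite -leNgt => x0; nra.
have x1 : x < 1 by apply: contraTT isT => /=; rewrite -leNgt => x1; nra.
by apply/andP; split; nra.
Qed.

Lemma isd_chi j x : is_derive x 1 (chi j) (polyexp ('X ^+ 2) (chiq j).[x] * (chiq j)^`().[x]).
Proof.
have := isd_comp (isd_polyexp 1 (chiq j).[x]) (is_derive_poly (chiq j) x).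
by rewrite derivC subr0 mulr1.
Qed.

Lemma dchiq j x : (chiq j)^`().[x] = j.+1%:R * (1 - 2 * x).
Proof. rewrite /chiq !poly.derivE !hornerE; ring. Qed.

Lemma chiq_pos x : 0 < x -> x < 1 -> \forall j \near \oo, 0 < (chiq j).[x].
Proof.
move=> x0 x1; have p0 : 0 < x * (1 - x) by rewrite mulr_gt0// subr_gt0.
exists (Num.trunc (1 / (x * (1 - x)))).+1 => // n /= Hn.
rewrite chiqE subr_gt0 -ltr_pdivrMr//.
apply: lt_trans (truncnS_gt _) _; rewrite -(ler_nat R) in Hn.
by apply: le_lt_trans Hn _; rewrite ltr_nat.
Qed.

Lemma chi_y_cvg x : 0 < x -> x < 1 -> ((chiq j).[x])^-1 @[j --> \oo] --> (0 : R).
Proof.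
move=> x0 x1; have p0 : 0 < x * (1 - x) by rewrite mulr_gt0// subr_gt0.
apply/gtr0_cvgV0; first exact: chiq_pos.
under eq_fun do rewrite chiqE.
apply/cvgryPge => A; near=> j.
rewrite lerBrDr -ler_pdivrMr//.
near: j; exists (Num.trunc ((A + 1) / (x * (1 - x)))).+1 => // n /= Hn.
apply: le_trans (ltW (truncnS_gt _)) _; rewrite -(ler_nat R) in Hn.
by apply: le_trans Hn _; rewrite ler_nat.
Unshelve. all: end_near. Qed.

Lemma polyexp_cvg1 (y : nat -> R) p : (y j)^-1 @[j --> \oo] --> (0 : R) ->
  (\forall j \near \oo, 0 < y j) -> polyexp p (y j) @[j --> \oo] --> p.[0].
Proof.
move=> y0 yp.
have H : p.[(y j)^-1] * expR (- (y j)^-1) @[j --> \oo] --> p.[0] * expR (- 0).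
  apply: cvgM.
    by apply: (cvg_comp _ _ y0); exact: continuous_horner.
  by apply: continuous_cvg; [exact: continuous_expR|exact: cvgN].
rewrite oppr0 expR0 mulr1 in H.
apply: cvg_trans H; apply: near_eq_cvg.
by apply: filterS yp => j yj; rewrite /polyexp yj.
Qed.

Lemma chi_cvg x : 0 < x -> x < 1 -> chi j x @[j --> \oo] --> (1 : R).
Proof.
move=> x0 x1; have := polyexp_cvg1 (p := 1) (chi_y_cvg x0 x1) (chiq_pos x0 x1).
by rewrite hornerC.
Qed.

(** Both t exp (- t) and t^2 exp (- t) are at most 2. *)
Lemma texp_bound t : 0 <= t -> (t + t ^+ 2) * expR (- t) <= 4.
Proof.
move=> t0; rewrite expRN ler_pdivrMr ?expR_gt0//.
have -> : expR t = expR (t / 2) ^+ 2 by rewrite -expRM_natr divfK.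
have h : 1 + t / 2 <= expR (t / 2) by exact: expR_ge1Dx.
apply: (@le_trans _ _ (4 * (1 + t / 2) ^+ 2)); first by nra.
rewrite ler_wpM2l// ler_sqr ?nnegrE ?expR_ge0//; lra.
Qed.

Section approximation.
Variables (g : R -> R) (C : R).
Hypothesis sg : smooth g.
Hypothesis gC : forall x, 0 < x -> x < 1 -> `|g x| <= C * (x * (1 - x)).

(** The derivative of the cut-off grows like j near the boundary, on a strip
where x (1 - x) is of order 1 / j; a function g vanishing at the boundary
compensates this growth. *)
Lemma dchi_bound j x : 0 < x -> x < 1 -> `|derive1 (chi j) x * g x| <= 4 * C.
Proof.
move=> x0 x1; have p0 : 0 < x * (1 - x) by rewrite mulr_gt0// subr_gt0.
have C0 : 0 <= C.
  by have := le_trans (normr_ge0 _) (gC x0 x1); rewrite pmulr_lge0.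
rewrite (isd_val (isd_chi j x)) dchiq /polyexp; case: ifPn => y0; last first.
  by rewrite !mul0r normr0 mulr_ge0.
rewrite hornerXn; set t := _^-1.
have t0 : 0 < t by rewrite invr_gt0.
have j0 : 0 < j.+1%:R :> R by rewrite ltr0n.
have yE : j.+1%:R * (x * (1 - x)) = t^-1 + 1 by rewrite /t invrK chiqE subrK.
rewrite (normrM _ (g x)) (normrM (t ^+ 2 * _)) (normrM (j.+1%:R)) (normrM (t ^+ 2)).
rewrite (gtr0_norm (expR_gt0 _)) (ger0_norm (exprn_ge0 2 (ltW t0))) (gtr0_norm j0).
have b1 : `|1 - 2 * x| <= 1 by rewrite ler_norml; apply/andP; split; lra.
apply: (@le_trans _ _ (t ^+ 2 * expR (- t) * (j.+1%:R * 1) * (C * (x * (1 - x))))).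
  have te0 : 0 <= t ^+ 2 * expR (- t) by rewrite mulr_ge0 ?expR_ge0// exprn_ge0// ltW.
  apply: ler_pM; [by rewrite mulr_ge0// mulr_ge0// ltW|by []| |exact: gC].
  by rewrite ler_wpM2l// ler_wpM2l// ltW.
have -> : t ^+ 2 * expR (- t) * (j.+1%:R * 1) * (C * (x * (1 - x))) =
  C * (t ^+ 2 * expR (- t) * (j.+1%:R * (x * (1 - x)))) by ring.
rewrite yE mulrC ler_wpM2r//.
apply: le_trans (texp_bound (ltW t0)).
by rewrite le_eqVlt; apply/orP; left; apply/eqP; field; rewrite gt_eqF.
Qed.

Lemma dchi_cvg x : 0 < x -> x < 1 -> derive1 (chi j) x * g x @[j --> \oo] --> (0 : R).
Proof.
move=> x0 x1; have p0 : 0 < x * (1 - x) by rewrite mulr_gt0// subr_gt0.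
rewrite -[X in _ --> X](mul0r (g x)); apply: cvgM; last exact: cvg_cst.
have E : forall j, derive1 (chi j) x =
    (polyexp ('X ^+ 2) (chiq j).[x] + polyexp 'X (chiq j).[x]) * (1 - 2 * x) / (x * (1 - x)).
  move=> j; rewrite (isd_val (isd_chi j x)) dchiq /polyexp; case: ifPn => y0; last first.
    by rewrite addr0 !mul0r.
  have yE : j.+1%:R = ((chiq j).[x] + 1) / (x * (1 - x)).
    by rewrite chiqE subrK mulfK// gt_eqF.
  rewrite hornerXn hornerX [in LHS]yE; field.
  by rewrite !gt_eqF// subr_gt0.
under eq_fun do rewrite E -mulrA.
suff : (polyexp ('X ^+ 2) (chiq j).[x] + polyexp 'X (chiq j).[x]) * ((1 - 2 * x) / (x * (1 - x)))
  @[j --> \oo] --> 0 * ((1 - 2 * x) / (x * (1 - x))) by rewrite mul0r.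
apply: cvgM; last exact: cvg_cst.
suff : polyexp ('X ^+ 2) (chiq j).[x] + polyexp 'X (chiq j).[x] @[j --> \oo] --> (0 + 0 : R) by rewrite addr0.
have H1 := polyexp_cvg1 (p := 'X ^+ 2) (chi_y_cvg x0 x1) (chiq_pos x0 x1).
have H2 := polyexp_cvg1 (p := 'X) (chi_y_cvg x0 x1) (chiq_pos x0 x1).
rewrite hornerXn expr0n in H1; rewrite hornerX in H2.
exact: cvgD H1 H2.
Qed.

End approximation.

End cutoff.

(** * The space of functions vanishing at the boundary, in sine coefficients *)

Section density.
Context (R : realType).
Local Notation mu := (@muO R).
Implicit Types (f g h phi psi : R -> R) (k : nat) (x : R).

Lemma ip0_dct0 (h : nat -> R -> R) (b : R -> R) :
  (forall n, measurable_fun setT (h n)) -> L2 b ->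
  (forall x, 0 < x -> x < 1 -> h n x @[n --> \oo] --> (0 : R)) ->
  (forall n x, 0 < x -> x < 1 -> `|h n x| <= b x) ->
  ip0 (h n) (h n) @[n --> \oo] --> (0 : R).
Proof.
move=> mh Lb h0 hb.
have [|||||_] := @dct_muO R (fun n x => h n x * h n x) (fun _ => 0) (fun x => b x * b x).
- by move=> n; exact: measurable_funM.
- exact: measurable_cst.
- exact: L2_mul_int.
- apply: aeO_itv => x x0 x1; rewrite -[X in _ --> X](mul0r (0 : R)).
  by apply: cvgM; exact: h0.
- by move=> n x x0 x1; rewrite normrM; apply: ler_pM => //; exact: hb.
rewrite /ip0; have -> : \int[mu]_x 0 = 0 :> R by rewrite /Rintegral integral0.
by [].
Qed.

Lemma smooth_test (g : R -> R) j : smooth g -> test_fun (fun x => chi j x * g x) /\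
  smooth (fun x => chi j x * g x).
Proof.
move=> sg; have sp : smooth (fun x => chi j x * g x).
  by apply: smooth_mul => //; exact: smooth_polyexp.
split => //; split.
  suff H k : smooth (derive1n k (fun x => chi j x * g x)).
    by move=> k x; exact: smooth_derivable (H k).
  by elim: k => [//|k IH]; rewrite derive1nS; exact: smooth_derive1.
exists j.+1%:R^-1, (1 - j.+1%:R^-1); split.
- by rewrite invr_gt0.
- by rewrite ltrBlDr ltrDl invr_gt0.
- by move=> x; rewrite mulf_eq0 negb_or => /andP[/chi_supp].
Qed.

Lemma test_smooth phi : test_fun phi -> smooth phi.
Proof.
move=> [dp _] k; elim: k phi dp => [//|k IH] phi dp; split; first exact: (dp 0%N).
by apply: IH => n x; rewrite -derive1Sn; exact: dp.
Qed.

Lemma test_boundary phi : test_fun phi -> phi 0 = 0 /\ phi 1 = 0.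
Proof.
move=> [_ [a [b [a0 b1 H]]]]; split.
  by apply: contrapT => /eqP/H/andP[/(lt_le_trans a0)]; rewrite ltxx.
by apply: contrapT => /eqP/H/andP[_ /le_lt_trans/(_ b1)]; rewrite ltxx.
Qed.

Lemma vanish_bound g : smooth g -> g 0 = 0 -> g 1 = 0 ->
  exists C : R, forall x, 0 < x -> x < 1 -> `|g x| <= C * (x * (1 - x)).
Proof.
move=> sg g0 g1.
have [M HM] := itv_bounded (smooth_continuous (smooth_derive1 sg)).
exists (2 * M) => x x0 x1.
have M0 : 0 <= M by apply: le_trans (HM 0 _); rewrite ?lexx ?ler01.
have W (a b : R) : {within `[a, b], continuous g}.
  by apply: (isd_within (f := derive1 g)) => y _; exact: smooth_isd.
have [y [/andP[y0 y1] Ey]] := MVT_isd x0 (fun y _ => smooth_isd sg y) (W _ _).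
have [z [/andP[z0 z1] Ez]] := MVT_isd x1 (fun y _ => smooth_isd sg y) (W _ _).
rewrite g0 !subr0 in Ey; rewrite g1 sub0r in Ez.
have B1 : `|g x| <= M * x.
  rewrite Ey normrM (gtr0_norm x0) ler_wpM2r ?(ltW x0)//.
  by apply: HM; rewrite (ltW y0)/= ltW// (lt_trans y1).
have B2 : `|g x| <= M * (1 - x).
  rewrite -normrN Ez normrM (@gtr0_norm _ (1 - x)) ?subr_gt0// ler_wpM2r ?subr_ge0 ?(ltW x1)//.
  by apply: HM; rewrite (ltW z1) andbT ltW// (lt_trans x0).
case: (lerP x 2^-1) => h.
  apply: le_trans B1 _; rewrite (_ : 2 * M * _ = M * (2 * (x * (1 - x)))); last by ring.
  by rewrite ler_wpM2l//; nra.
apply: le_trans B2 _; rewrite (_ : 2 * M * _ = M * (2 * (x * (1 - x)))); last by ring.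
by rewrite ler_wpM2l//; nra.
Qed.

(** A smooth function vanishing at 0 and 1 is approximated in W^{1,2} by its
products with the cut-offs; [dchi_bound] dominates the only critical term, chi'
g. *)
Lemma test_dense g eps : smooth g -> g 0 = 0 -> g 1 = 0 -> 0 < eps ->
  exists phi, [/\ test_fun phi, ip0 (g - phi) (g - phi) <= eps &
    ip0 (derive1 g - derive1 phi) (derive1 g - derive1 phi) <= eps].
Proof.
move=> sg g0 g1 e0; have [C gC] := vanish_bound sg g0 g1.
have sg' := smooth_derive1 sg.
pose p j x := chi j x * g x.
have sp j : smooth (p j) by have [] := smooth_test j sg.
have sc j : smooth (@chi R j) by exact: smooth_polyexp.
have H1 : ip0 (g - p n) (g - p n) @[n --> \oo] --> (0 : R).
  apply: (@ip0_dct0 (fun n => g - p n) (fun x => `|g x|)).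
  - by move=> n; apply: L2_meas; apply: L2B; exact: smooth_L2.
  - apply: L2_continuous => x; apply: continuous_comp; last exact: norm_continuous.
    exact: smooth_continuous.
  - move=> x x0 x1; rewrite -[X in _ --> X](subrr (1 * g x)).
    rewrite [X in X @ _](_ : _ = (fun n => 1 * g x - chi n x * g x)); last first.
      by apply/funext => n; rewrite mul1r.
    by apply: cvgB; [exact: cvg_cst|apply: cvgM; [exact: chi_cvg|exact: cvg_cst]].
  - move=> n x x0 x1; rewrite (_ : (g - p n) x = (1 - chi n x) * g x).
      rewrite normrM ler_piMl// ger0_norm ?subr_ge0 ?chi_le1// gerBl chi_ge0//.
    by rewrite /p !fctE; ring.
have D n : derive1 (p n) = (fun x => derive1 (chi n) x * g x + chi n x * derive1 g x).
  by rewrite derive1M//; move=> x; exact: smooth_derivable.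
have H2 : ip0 (derive1 g - derive1 (p n)) (derive1 g - derive1 (p n)) @[n --> \oo] --> (0 : R).
  apply: (@ip0_dct0 (fun n => derive1 g - derive1 (p n)) (fun x => `|derive1 g x| + 4 * C)).
  - by move=> n; apply: L2_meas; apply: L2B; apply: smooth_L2; exact: smooth_derive1.
  - apply: L2_continuous; apply: continuousD; last exact: cst_continuous.
    move=> x; apply: continuous_comp; last exact: norm_continuous.
    exact: smooth_continuous.
  - move=> x x0 x1.
    rewrite [X in X @ _](_ : _ = (fun n => 1 * derive1 g x - (derive1 (chi n) x * g x + chi n x * derive1 g x))); last first.
      by apply/funext => n; rewrite mul1r D.
    rewrite [X in _ --> X](_ : 0 = 1 * derive1 g x - (0 + 1 * derive1 g x)); last by ring.
    apply: cvgB; first exact: cvg_cst.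
    apply: cvgD; first by apply: dchi_cvg.
    by apply: cvgM; [exact: chi_cvg|exact: cvg_cst].
  - move=> n x x0 x1; rewrite D.
    rewrite (_ : (derive1 g - _) x = (1 - chi n x) * derive1 g x - derive1 (chi n) x * g x); last first.
      by rewrite !fctE; ring.
    apply: le_trans (ler_normB _ _) _; apply: lerD; last by apply: (dchi_bound gC).
    by rewrite normrM ler_piMl// ger0_norm ?subr_ge0 ?chi_le1// gerBl chi_ge0.
have /cvgr0_norm_le/(_ _ e0)[N1 _ K1] := H1.
have /cvgr0_norm_le/(_ _ e0)[N2 _ K2] := H2.
exists (p (maxn N1 N2)); split.
- by have [] := smooth_test (maxn N1 N2) sg.
- by apply: le_trans (ler_norm _) (K1 _ _); rewrite /= leq_maxl.
- by apply: le_trans (ler_norm _) (K2 _ _); rewrite /= leq_maxr.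
Qed.

End density.

Section weak_derivatives.
Context (R : realType).
Local Notation mu := (@muO R).
Implicit Types (f g h phi psi : R -> R) (k N : nat) (x B : R).

Lemma sinm_test_approx k eps : 0 < eps -> exists phi, test_fun phi /\
  ip0 (@sinm R k - phi) (sinm k - phi) <= eps.
Proof.
move=> e0.
have E : psum (@sinm R) (fun j => (j == k)%:R) k.+1 = sinm k.
  rewrite /psum big_ord_recr/= eqxx scale1r big1 ?add0r// => j _.
  by rewrite (ltn_eqF (ltn_ord j)) scale0r.
have [sp _] := @smooth_psum R (fun j => (j == k)%:R) k.+1; rewrite E in sp.
have [phi [tp H _]] := test_dense sp (sinm0 _ k) (sinm1 _ k) e0.
by exists phi.
Qed.

(** Test functions approximate every sinm k in L^2, so [sinm_complete] applies.
*)
Lemma test_dual_zero h : L2 h -> (forall phi, test_fun phi -> ip0 h phi = 0) ->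
  {ae mu, forall x, h x = 0}.
Proof.
move=> Lh H; apply: sinm_complete => // k.
apply/eqP; rewrite -sqrf_eq0; apply/eqP/le_eps_eq0 => [|e e0]; first exact: sqr_ge0.
have h1 : 0 < ip0 h h + 1 by rewrite ltr_wpDl// ip0_ge0.
have [phi [tp Hp]] := sinm_test_approx k (divr_gt0 e0 h1).
have Lp := smooth_L2 (test_smooth tp); have Ls := @L2_sinm R k.
rewrite (_ : ip0 h (sinm k) = ip0 h (sinm k - phi)); last first.
  by rewrite ip0Br// (H _ tp) subr0.
apply: le_trans (ip0_CS Lh (L2B Ls Lp)) _.
apply: le_trans (ler_wpM2l (ip0_ge0 h) Hp) _.
by rewrite mulrCA ler_piMr ?(ltW e0)// ler_pdivrMr// mul1r lerDl.
Qed.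

Lemma wderiv_uniq g h h' : is_wderiv g h -> is_wderiv g h' -> {ae mu, forall x, h x = h' x}.
Proof.
move=> [Lh Hh] [Lh' Hh'].
have : {ae mu, forall x, (h - h') x = 0}.
  apply: test_dual_zero; first exact: L2B.
  move=> phi tp; have Lp := smooth_L2 (test_smooth tp).
  by rewrite ip0Bl//; apply: oppr_inj; rewrite opprB -(opprK (ip0 h' _)) -Hh'// -Hh// addrC subrr oppr0.
by apply: aeOS => x /eqP; rewrite subr_eq0 => /eqP.
Qed.

Lemma is_wderiv_wderiv g h : is_wderiv g h -> is_wderiv g (wderiv g).
Proof. by move=> H; apply: (@xgetPex _ 0 [set h | is_wderiv g h]); exists h. Qed.

Lemma wderiv_ae g h : is_wderiv g h -> {ae mu, forall x, wderiv g x = h x}.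
Proof. by move=> H; exact: (wderiv_uniq (is_wderiv_wderiv H) H). Qed.

Lemma ip1_wderiv g h : is_wderiv g h -> ip1 g g = ip0 h h.
Proof.
move=> wg; have mh := L2_meas wg.1; have mw := L2_meas (is_wderiv_wderiv wg).1.
by apply: (ip0_ae mw mw mh mh); exact: wderiv_ae.
Qed.

Lemma is_wderivB g g' h h' : L2 g -> L2 g' -> is_wderiv g h -> is_wderiv g' h' ->
  is_wderiv (g - g') (h - h').
Proof.
move=> Lg Lg' [Lh Hh] [Lh' Hh']; split; first exact: L2B.
move=> phi tp; have sp := test_smooth tp.
have Lp := smooth_L2 sp; have Lp' := smooth_L2 (smooth_derive1 sp).
by rewrite !ip0Bl// Hh// Hh'//; ring.
Qed.

Lemma smooth_is_wderiv g : smooth g -> is_wderiv g (derive1 g).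
Proof.
move=> sg; have sg' := smooth_derive1 sg; split; first exact: smooth_L2.
move=> phi tp; have sp := test_smooth tp; have sp' := smooth_derive1 sp.
have [p0 p1] := test_boundary tp.
rewrite (ip0_parts (smooth_isd sg) (smooth_isd sp) (smooth_continuous sg') (smooth_continuous sp')).
by rewrite p0 p1 !mulr0 subrr sub0r.
Qed.

Lemma test_cosm phi k : test_fun phi -> ip0 (derive1 phi) (cosm k) = om k * ip0 phi (sinm k).
Proof.
move=> tp; have sp := test_smooth tp; have sp' := smooth_derive1 sp.
have [p0 p1] := test_boundary tp.
have := ip0_parts (smooth_isd sp) (@isd_cosm R k) (smooth_continuous sp').
rewrite p0 p1 !mul0r subrr sub0r -[(fun x => - _)]/(- (om k *: sinm k)).
have Ls := @L2_sinm R k; have Lp := smooth_L2 sp.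
rewrite ip0Nr//; last exact: L2Z.
rewrite ip0Zr// => H; apply: oppr_inj; apply/esym; apply: H.
by move=> x; apply: cvgN; apply: cvgZl_tmp; exact: continuous_sinm.
Qed.

Lemma H10_wderiv g : H10 g -> L2 g /\ is_wderiv g (wderiv g).
Proof. by move=> [[Lg [h gh]] _]; split => //; exact: is_wderiv_wderiv gh. Qed.

Let combination_bound (a b P Q w : R) : a ^+ 2 <= Q -> b ^+ 2 <= P -> 0 <= P -> 0 <= Q ->
  (a - w * b) ^+ 2 <= (P + Q) * (2 + 2 * w ^+ 2).
Proof.
move=> b1 b2 p1 p2; have q0 := sqr_ge0 w.
apply: (@le_trans _ _ (2 * a ^+ 2 + 2 * (w ^+ 2 * b ^+ 2))).
  by rewrite -exprMn; have := sqr_ge0 (a + w * b); lra.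
have X1 := ler_wpM2l q0 b2; have X2 := mulr_ge0 q0 p1; have X3 := mulr_ge0 q0 p2.
by move: X1 X2 X3; move: (w ^+ 2) => W X1 X2 X3; lra.
Qed.

(** True for test functions by integration by parts; both sides are continuous
for the norm of W^{1,2}, in which test functions are dense in H^1_0. *)
Lemma H10_cosm g k : H10 g -> ip0 (wderiv g) (cosm k) = om k * cf g k.
Proof.
move=> Hg; have [Lg wg] := H10_wderiv Hg; have [_ approx] := Hg.
have Lw := wg.1; have Lc := @L2_cosm R k; have Ls := @L2_sinm R k.
apply/eqP; rewrite -subr_eq0 -sqrf_eq0; apply/eqP/le_eps_eq0 => [|e e0]; first exact: sqr_ge0.
have K0 : 0 < 2 + 2 * om k ^+ 2 :> R by rewrite ltr_wpDr// mulr_ge0 ?sqr_ge0.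
have d0 : 0 < Num.sqrt (e / (2 + 2 * om k ^+ 2)) by rewrite sqrtr_gt0 divr_gt0.
have [phi tp] := approx _ d0.
have sp := test_smooth tp; have Lp := smooth_L2 sp; have wp := smooth_is_wderiv sp.
have Lp' := wp.1.
rewrite /= ltr_sqrt ?divr_gt0// => Hp.
have wgp := is_wderivB Lg Lp wg wp.
have Ew : ip1 (g - phi) (g - phi) = ip0 (wderiv g - derive1 phi) (wderiv g - derive1 phi).
  exact: ip1_wderiv.
rewrite Ew in Hp.
have b1 := ip0_CS (L2B Lw Lp') Lc; have b2 := ip0_CS (L2B Lg Lp) Ls.
rewrite ip0_cosm eqxx mulr1 in b1; rewrite ip0_sinm eqxx mulr1 in b2.
have E : ip0 (wderiv g) (cosm k) - om k * cf g k =
   ip0 (wderiv g - derive1 phi) (cosm k) - om k * ip0 (g - phi) (sinm k).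
  by rewrite !ip0Bl// test_cosm// /cf; ring.
rewrite E.
have p1 := ip0_ge0 (g - phi); have p2 := ip0_ge0 (wderiv g - derive1 phi).
have {}Hp : (ip0 (g - phi) (g - phi) + ip0 (wderiv g - derive1 phi) (wderiv g - derive1 phi))
   * (2 + 2 * om k ^+ 2) <= e by rewrite -ler_pdivlMr// ltW.
apply: le_trans Hp.
exact: combination_bound b1 b2 p1 p2.
Qed.

(** The cosine coefficients of the weak derivative are omega_k times the sine
coefficients of g; apply Bessel's inequality. *)
Lemma H10_bd g : H10 g -> bd 1 (cf g) (ip1 g g).
Proof.
move=> Hg; have [_ [Lw _]] := H10_wderiv Hg.
rewrite /bd (_ : (fun k => _) = (fun k => ip0 (wderiv g) (cosm k))).
  by apply: Bessel => //; [exact: L2_cosm|exact: ip0_cosm].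
by apply/funext => k; rewrite H10_cosm// expr1.
Qed.

(** Synthesize a function from the cosine coefficients omega_k (g, sinm k) and
check on test functions, mode by mode, that it is the weak derivative of g. *)
Lemma bd_wderiv g B : L2 g -> bd 1 (cf g) B -> exists h,
  expands cosm (fun k => om k * cf g k) h /\ is_wderiv g h.
Proof.
move=> Lg gB.
have aB : ssq (fun k => om k * cf g k) B.
  by move: gB; rewrite /bd; under eq_fun do rewrite expr1.
have [h ah] := expands_exists (@L2_cosm R) (@ip0_cosm R) aB.
exists h; split => //; split; first exact: ah.1.
move=> phi tp; have sp := test_smooth tp; have sp' := smooth_derive1 sp.
have Lp := smooth_L2 sp; have Lp' := smooth_L2 sp'.
have L1 := expands_ip0 (@L2_sinm R) (cf_ssq Lg) (cf_expands Lg) Lp'.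
have L2_ := expands_ip0 (@L2_cosm R) aB ah Lp.
rewrite -(cvg_lim (@Rhausdorff R) L1); apply: cvg_lim; first exact: Rhausdorff.
rewrite (_ : (fun N => _) = (fun N => - \sum_(j < N) (om j * cf g j) * ip0 (cosm j) phi)).
  exact: cvgN.
apply/funext => N; rewrite -sumrN; apply: eq_bigr => j _.
have [_ /(_ _ tp)->] : is_wderiv (@sinm R j) (om j *: cosm j).
  have E : psum (@sinm R) (fun i => (i == j)%:R) j.+1 = sinm j.
    rewrite /psum big_ord_recr/= eqxx scale1r big1 ?add0r// => i _.
    by rewrite (ltn_eqF (ltn_ord i)) scale0r.
  have [spj _] := @smooth_psum R (fun i => (i == j)%:R) j.+1; rewrite E in spj.
  have := smooth_is_wderiv spj.
  rewrite (_ : derive1 (sinm j) = om j *: cosm j)//.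
  by apply/funext => x; exact: isd_val (isd_sinm j x).
by rewrite (ip0Zl _ (@L2_cosm R j) Lp); ring.
Qed.

(** The converse of [H10_bd]: the partial sums converge to g in W^{1,2}, and
each of them is a smooth function vanishing at 0 and 1, hence a limit of test
functions. *)
Lemma bd_H10 g B : L2 g -> bd 1 (cf g) B -> H10 g /\ ip1 g g <= B.
Proof.
move=> Lg gB; have [h [ah wg]] := bd_wderiv Lg gB.
have aB : ssq (fun k => om k * cf g k) B.
  by move: gB; rewrite /bd; under eq_fun do rewrite expr1.
have Lh := ah.1.
have Ew : ip1 g g = ip0 h h.
  exact: ip1_wderiv.
split; last by rewrite Ew; exact: expands_norm aB ah.
split; first by split => //; exists h.
(* each of the two square norms is at most 2 d + 2 d *)
move=> e e0; pose d := e ^+ 2 / 16.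
have d0 : 0 < d by rewrite divr_gt0// exprn_gt0.
have [N1 H1] := expands_psum_small (cf_ssq Lg) (cf_expands Lg) d0.
have [N2 H2] := expands_psum_small aB ah d0.
pose N := maxn N1 N2.
have {}H1 := H1 N (leq_maxl _ _); have {}H2 := H2 N (leq_maxr _ _).
have [sS _] := smooth_psum (cf g) N; have [DS _] := derive1_psum (cf g) N.
have [f0 f1] := refl_boundary (refl_psum (cf g) N).
have [phi [tp H3 H4]] := test_dense sS f0 f1 d0.
rewrite DS in H4.
exists phi => //.
have sp := test_smooth tp; have Lp := smooth_L2 sp; have wp := smooth_is_wderiv sp.
have Lp' := wp.1; have wgp := is_wderivB Lg Lp wg wp.
rewrite /= (_ : ip1 (g - phi) (g - phi) = ip0 (h - derive1 phi) (h - derive1 phi)); last first.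
  exact: ip1_wderiv.
have LS := L2_psum (@L2_sinm R) (cf g) N.
have LC := L2_psum (@L2_cosm R) (fun k => om k * cf g k) N.
have X1 := ip0D2 (L2B Lg LS) (L2B LS Lp); have X2 := ip0D2 (L2B Lh LC) (L2B LC Lp').
rewrite addrA subrK in X1; rewrite addrA subrK in X2.
rewrite -[ltRHS]ger0_norm ?(ltW e0)// -sqrtr_sqr ltr_sqrt ?exprn_gt0//.
have dE : 16 * d = e ^+ 2 by rewrite /d mulrC divfK.
rewrite -dE; move: X1 X2 H1 H2 H3 H4 d0.
move: (ip0 _ _) (ip0 _ _) (ip0 _ _) (ip0 _ _) (ip0 _ _) (ip0 _ _) => p1 p2 p3 p4 p5 p6; lra.
Qed.

(** Parseval's identity for the cosine coefficients of the weak derivatives. *)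
Lemma ip1_lim g phi : H10 g -> H10 phi ->
  (fun N => \sum_(k < N) (om k * cf g k) * (om k * cf phi k)) @ \oo --> ip1 g phi.
Proof.
move=> Hg Hp; have [Lg wg] := H10_wderiv Hg; have [Lp wp] := H10_wderiv Hp.
have gB := H10_bd Hg; have [h [ah wh]] := bd_wderiv Lg gB.
have aB : ssq (fun k => om k * cf g k) (ip1 g g).
  by move: gB; rewrite /bd; under eq_fun do rewrite expr1.
have -> : ip1 g phi = ip0 h (wderiv phi).
  apply: ip0_ae; try (apply: L2_meas); [exact: wg.1|exact: wp.1|exact: ah.1|exact: wp.1| |exact: aeOT].
  exact: wderiv_uniq wg wh.
have := expands_ip0 (@L2_cosm R) aB ah wp.1.
by under eq_fun do under eq_bigr do rewrite ip0C H10_cosm//.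
Qed.

End weak_derivatives.

(** * The forced wave equation in coefficients: energy estimates and Picard iteration *)

Section energy_norm.
Context (R : realType).
Implicit Types (a b c d : nat -> R) (s k N K : nat) (B D : R).

(** A block of the square norm of (a, b) in the product of the domains of
A^{(s+1)/2} and A^{s/2}. *)
Definition energy_sum s a b K N : R :=
  \sum_(K <= k < N) ((om k ^+ s.+1 * a k) ^+ 2 + (om k ^+ s * b k) ^+ 2).

(** The pair (a, b) has square norm at most B in the product of the domains of
A^{(s+1)/2} and A^{s/2}. *)
Definition bdE s a b B := forall N, energy_sum s a b 0 N <= B.

Lemma energy_sum_ge0 s a b K N : 0 <= energy_sum s a b K N.
Proof. by apply: sumr_ge0 => k _; rewrite addr_ge0 ?sqr_ge0. Qed.

Lemma bdE_ge0 s a b B : bdE s a b B -> 0 <= B.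
Proof. by move=> /(_ 0%N); rewrite /energy_sum big_geq. Qed.

Lemma bdE_le s a b B D : bdE s a b B -> B <= D -> bdE s a b D.
Proof. by move=> H BD N; exact: le_trans (H N) BD. Qed.

Lemma bdEl s a b B : bdE s a b B -> bd s.+1 a B.
Proof.
move=> H N; apply: le_trans (H N); rewrite /energy_sum big_mkord; apply: ler_sum => k _.
by rewrite lerDl sqr_ge0.
Qed.

Lemma bdEr s a b B : bdE s a b B -> bd s b B.
Proof.
move=> H N; apply: le_trans (H N); rewrite /energy_sum big_mkord; apply: ler_sum => k _.
by rewrite lerDr sqr_ge0.
Qed.

Lemma bdE_intro s a b B D : bd s.+1 a B -> bd s b D -> bdE s a b (B + D).
Proof. by move=> aB bD N; rewrite /energy_sum big_mkord big_split; exact: lerD. Qed.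

Lemma energy_sumD s a b c d K N :
  energy_sum s (fun k => a k + c k) (fun k => b k + d k) K N <= 2 * energy_sum s a b K N + 2 * energy_sum s c d K N.
Proof.
rewrite /energy_sum !mulr_sumr -big_split; apply: ler_sum => k _ /=.
rewrite !mulrDr; move: (om k ^+ s.+1 * a k) (om k ^+ s.+1 * c k) (om k ^+ s * b k) (om k ^+ s * d k).
move=> x y z t; have := sqr_ge0 (x - y); have := sqr_ge0 (z - t); lra.
Qed.

Lemma energy_sumN s a b K N : energy_sum s (fun k => - a k) (fun k => - b k) K N = energy_sum s a b K N.
Proof. by apply: eq_bigr => k _; rewrite !mulrN !sqrrN. Qed.

Lemma energy_sumB s a b c d K N :
  energy_sum s (fun k => a k - c k) (fun k => b k - d k) K N <= 2 * energy_sum s a b K N + 2 * energy_sum s c d K N.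
Proof. by apply: le_trans (energy_sumD _ _ _ _ _ _ _) _; rewrite energy_sumN. Qed.

Lemma bdED s a b c d B D : bdE s a b B -> bdE s c d D ->
  bdE s (fun k => a k + c k) (fun k => b k + d k) (2 * B + 2 * D).
Proof.
move=> H1 H2 N; apply: le_trans (energy_sumD _ _ _ _ _ _ _) _.
by apply: lerD; apply: ler_wpM2l.
Qed.

Lemma bdEN s a b B : bdE s a b B -> bdE s (fun k => - a k) (fun k => - b k) B.
Proof. by move=> H N; rewrite energy_sumN. Qed.

Lemma bdEB s a b c d B D : bdE s a b B -> bdE s c d D ->
  bdE s (fun k => a k - c k) (fun k => b k - d k) (2 * B + 2 * D).
Proof. by move=> H1 /bdEN; exact: bdED. Qed.

Lemma bdE_anti s s' a b B : (s' <= s)%N -> bdE s a b B -> bdE s' a b B.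
Proof.
move=> ss H N; apply: le_trans (H N); apply: ler_sum => k _.
have W (i j : nat) (x : R) : (i <= j)%N -> (om k ^+ i * x) ^+ 2 <= (om k ^+ j * x) ^+ 2.
  move=> ij; rewrite !exprMn ler_wpM2r ?sqr_ge0// ler_sqr ?nnegrE ?exprn_ge0 ?(ltW (om_gt0 _ _))//.
  by rewrite ler_weXn2l// om_ge1.
by apply: lerD; apply: W.
Qed.

Lemma bdE_eq0 s a b : (forall e, 0 < e -> bdE s a b e) -> forall k, a k = 0 /\ b k = 0.
Proof.
move=> H k; split.
  by apply: (@bd_eq0 R s.+1) => e e0; exact: bdEl (H _ e0).
by apply: (@bd_eq0 R s) => e e0; exact: bdEr (H _ e0).
Qed.

Lemma bdE_cvg s (a_ b_ : nat -> nat -> R) a b B : (forall j, bdE s (a_ j) (b_ j) B) ->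
  (forall k, a_ j k @[j --> \oo] --> a k) -> (forall k, b_ j k @[j --> \oo] --> b k) ->
  bdE s a b B.
Proof.
move=> H ca cb N; rewrite /energy_sum.
have C : energy_sum s (a_ j) (b_ j) 0 N @[j --> \oo] --> energy_sum s a b 0 N.
  rewrite /energy_sum; elim: N => [|N IH].
    by rewrite big_geq//; under eq_fun do rewrite big_geq//; exact: cvg_cst.
  under eq_fun do rewrite big_nat_recr//= !expr2; rewrite big_nat_recr//= !expr2.
  apply: cvgD; first exact: IH.
  by apply: cvgD; apply: cvgM; apply: cvgM => //; exact: cvg_cst.
rewrite -/(energy_sum s a b 0 N) -(cvg_lim (@Rhausdorff R) C); apply: limr_le.
  by apply/cvg_ex; eexists; exact: C.
by apply: nearW => j; exact: H.
Qed.

Lemma bdE_tail s a b B : bdE s a b B -> forall e, 0 < e ->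
  exists K, forall N, energy_sum s a b K N <= e.
Proof.
move=> H e e0; have e2 : 0 < e / 2 by rewrite divr_gt0.
have [K1 H1] := ssq_tail (bdEl H) e2; have [K2 H2] := ssq_tail (bdEr H) e2.
exists (maxn K1 K2) => N; rewrite /energy_sum big_split [e]splitr; apply: lerD.
  by apply: H1; rewrite leq_maxl.
by apply: H2; rewrite leq_maxr.
Qed.

End energy_norm.

Section energy_estimate.
Context (R : realType).
Implicit Types (a b g : R -> nat -> R) (s k N K : nat) (T B : R).

(** The modes of the wave equation with forcing - g; the equation is required
at interior times, and continuity up to the ends is stated apart by [contT]. *)
Definition solves T a b g := forall t, 0 < t < T -> forall k,
  is_derive t 1 (fun r => a r k) (b t k) /\
  is_derive t 1 (fun r => b r k) (- om k ^+ 2 * a t k - g t k).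

Definition contT T a b := forall k, {within `[0, T], continuous (fun r => a r k)} /\
  {within `[0, T], continuous (fun r => b r k)}.

(** The contributions of the elastic and of the kinetic energy cancel, so that
only the work of the forcing remains. *)
Lemma isd_energy_sum s a b g T K N t : solves T a b g -> 0 < t < T ->
  is_derive t 1 (fun r => energy_sum s (a r) (b r) K N)
    (- (2 * \sum_(K <= k < N) (om k ^+ s * b t k) * (om k ^+ s * g t k))).
Proof.
move=> sol t0T; rewrite /energy_sum.
apply: (@isd_eq _ _ _ (\sum_(K <= k < N) (2 * (om k ^+ s.+1 * a t k) * (om k ^+ s.+1 * b t k) +
   2 * (om k ^+ s * b t k) * (om k ^+ s * (- om k ^+ 2 * a t k - g t k))))).
  apply: isd_sum => k _; have [Da Db] := sol t t0T k.
  exact: (isdD (isd_sqr (isdZ _ Da)) (isd_sqr (isdZ _ Db))).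
rewrite -mulrN -sumrN mulr_sumr; apply: eq_bigr => k _; rewrite exprSr; ring.
Qed.

Lemma contT_energy_sum s a b T K N : contT T a b ->
  {within `[0, T], continuous (fun r => energy_sum s (a r) (b r) K N)}.
Proof.
move=> ct; rewrite /energy_sum.
have H (l : seq nat) : {within `[0, T], continuous (fun r => \sum_(k <- l)
   ((om k ^+ s.+1 * a r k) ^+ 2 + (om k ^+ s * b r k) ^+ 2))}.
  elim: l => [|k l IH].
    rewrite (_ : (fun r => _) = cst 0); first by move=> x; exact: cvg_cst.
    by apply/funext => r; rewrite big_nil.
  rewrite (_ : (fun r => _) = (fun r => om k ^+ s.+1 * a r k * (om k ^+ s.+1 * a r k) +
    om k ^+ s * b r k * (om k ^+ s * b r k) + \sum_(k <- l)
   ((om k ^+ s.+1 * a r k) ^+ 2 + (om k ^+ s * b r k) ^+ 2))); last first.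
    by apply/funext => r; rewrite big_cons !expr2.
  have [ca cb] := ct k => x; apply: cvgD; last exact: IH.
  by apply: cvgD; apply: cvgM; apply: cvgM; try exact: cvg_cst; [exact: ca|exact: ca|exact: cb|exact: cb].
exact: H.
Qed.

(** Comparison with a supersolution z: the work of the forcing is at most the
energy plus the square norm w of the forcing. *)
Lemma energy_le s a b g T K N (w z dz : R -> R) : solves T a b g -> contT T a b ->
  (forall t, 0 < t < T -> \sum_(K <= k < N) (om k ^+ s * g t k) ^+ 2 <= w t) ->
  (forall t : R, is_derive t 1 z (dz t)) -> (forall t, 0 < t < T -> z t + w t <= dz t) ->
  energy_sum s (a 0) (b 0) K N <= z 0 ->
  forall t, 0 <= t <= T -> energy_sum s (a t) (b t) K N <= z t.
Proof.
move=> sol ct gw Dz zw e0.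
apply: (@comparison R _ z _ dz 1 T (fun t H => isd_energy_sum s K N sol H) (fun t _ => Dz t)) => //.
- exact: contT_energy_sum.
- exact: (isd_within (f := dz)).
- move=> t t0T; rewrite mul1r.
  have H1 := gw t t0T; have H2 := zw t t0T.
  suff : - (2 * \sum_(K <= k < N) (om k ^+ s * b t k) * (om k ^+ s * g t k)) <=
     energy_sum s (a t) (b t) K N + \sum_(K <= k < N) (om k ^+ s * g t k) ^+ 2 by lra.
  rewrite /energy_sum -mulrN -sumrN mulr_sumr -big_split; apply: ler_sum => k _ /=.
  move: (om k ^+ s.+1 * a t k) (om k ^+ s * b t k) (om k ^+ s * g t k) => x y u.
  have := sqr_ge0 (y + u); have := sqr_ge0 x; lra.
Qed.

Lemma isd_expc (Q kap t : R) : is_derive t 1 (fun r => Q * expR (kap * r)) (kap * (Q * expR (kap * t))).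
Proof.
apply: (isd_eq (isdZ Q (isd_comp (is_derive_expR _) (isdZ kap (isd_id t))))).
rewrite mulr1; ring.
Qed.

(** The supersolution Q exp (kap t) absorbs a forcing of square norm (kap - 1)
Q exp (kap t). *)
Lemma energy_exp s a b g T (Q kap : R) : solves T a b g -> contT T a b ->
  (forall t, 0 < t < T -> bd s (g t) ((kap - 1) * (Q * expR (kap * t)))) ->
  bdE s (a 0) (b 0) Q ->
  forall t, 0 <= t <= T -> bdE s (a t) (b t) (Q * expR (kap * t)).
Proof.
move=> sol ct gw e0 t t0T N.
apply: (@energy_le s a b g T 0 N (fun t => (kap - 1) * (Q * expR (kap * t)))
  (fun t => Q * expR (kap * t))
  (fun t => kap * (Q * expR (kap * t))) sol ct) => //.
- by move=> r r0T; rewrite big_mkord; exact: gw.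
- by move=> r; exact: isd_expc.
- by move=> r _; rewrite mulrBl mul1r addrC subrK.
- by rewrite mulr0 expR0 mulr1.
Qed.

End energy_estimate.

Section linear_modes.
Context (R : realType).

(** Duhamel's formula for the harmonic oscillator, with the integral of sin (w
(t - r)) g(r) split by the addition formula into two primitives. *)
Lemma mode_solve (w : R) (g : R -> R) (a0 b0 : R) : 0 < w -> continuous g ->
  exists a b : R -> R, [/\ a 0 = a0, b 0 = b0 & forall t : R, is_derive t 1 a (b t) /\
    is_derive t 1 b (- w ^+ 2 * a t - g t)].
Proof.
move=> w0 cg; have wn0 : w != 0 by rewrite gt_eqF.
have Ds (t : R) : is_derive t 1 (fun r => sin (w * r)) (w * cos (w * t)).
  apply: (isd_eq (isd_comp (is_derive_sin _) (isdZ w (isd_id t)))); by rewrite mulr1 mulrC.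
have Dc (t : R) : is_derive t 1 (fun r => cos (w * r)) (- (w * sin (w * t))).
  apply: (isd_eq (isd_comp (is_derive_cos _) (isdZ w (isd_id t)))); rewrite mulr1; ring.
have cs := isd_continuous Ds; have cc := isd_continuous Dc.
have [C0 DC0] := antiderivative (continuousM cc cg).
have [S0 DS0] := antiderivative (continuousM cs cg).
pose C t := C0 t - C0 0; pose S t := S0 t - S0 0.
have DC (t : R) : is_derive t 1 C (cos (w * t) * g t).
  by apply: (isd_eq (isdB (DC0 t) (isd_cst (C0 0) t))); rewrite subr0.
have DS (t : R) : is_derive t 1 S (sin (w * t) * g t).
  by apply: (isd_eq (isdB (DS0 t) (isd_cst (S0 0) t))); rewrite subr0.
have cs1 (t : R) : sin (w * t) ^+ 2 = 1 - cos (w * t) ^+ 2.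
  by rewrite -(cos2Dsin2 (w * t)); ring.
exists (fun t => a0 * cos (w * t) + (b0 / w) * sin (w * t)
  - w^-1 * (sin (w * t) * C t - cos (w * t) * S t)).
exists (fun t => - (w * a0) * sin (w * t) + b0 * cos (w * t)
  - (cos (w * t) * C t + sin (w * t) * S t)); split.
- by rewrite !mulr0 sin0 cos0 /C /S !subrr; ring.
- by rewrite !mulr0 sin0 cos0 /C /S !subrr; ring.
- move=> t; split.
    apply: (isd_eq (isdB (isdD (isdZ a0 (Dc t)) (isdZ (b0 / w) (Ds t)))
      (isdZ w^-1 (isdB (isdM (Ds t) (DC t)) (isdM (Dc t) (DS t)))))).
    by field.
  apply: (isd_eq (isdB (isdD (isdZ (- (w * a0)) (Ds t)) (isdZ b0 (Dc t)))
    (isdD (isdM (Dc t) (DC t)) (isdM (Ds t) (DS t))))).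
  have := cs1 t; move: (sin _) (cos _) (C t) (S t) (g t) => x y c z u xy.
  apply/eqP; rewrite -subr_eq0; apply/eqP.
  transitivity ((1 - y ^+ 2 - x ^+ 2) * u); first by field.
  by rewrite xy subrr mul0r.
Qed.

Lemma modes_solve (g : R -> nat -> R) (a0 b0 : nat -> R) :
  (forall k, continuous (fun t => g t k)) ->
  exists ab : (R -> nat -> R) * (R -> nat -> R), [/\ ab.1 0 = a0, ab.2 0 = b0 & forall (t : R) k,
    is_derive t 1 (fun r => ab.1 r k) (ab.2 t k) /\
    is_derive t 1 (fun r => ab.2 r k) (- om k ^+ 2 * ab.1 t k - g t k)].
Proof.
move=> cg.
have /choice[F HF] : forall k, exists ab : (R -> R) * (R -> R),
  [/\ ab.1 0 = a0 k, ab.2 0 = b0 k & forall t : R, is_derive t 1 ab.1 (ab.2 t) /\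
    is_derive t 1 ab.2 (- om k ^+ 2 * ab.1 t - g t k)].
  move=> k; have [a [b H]] := mode_solve (a0 k) (b0 k) (om_gt0 R k) (cg k).
  by exists (a, b).
exists (fun t k => (F k).1 t, fun t k => (F k).2 t); split => /=.
- by apply/funext => k; have [] := HF k.
- by apply/funext => k; have [] := HF k.
- by move=> t k; have [_ _ H] := HF k; exact: H.
Qed.

End linear_modes.

Section clamping.
Context (R : realType).
Variable T : R.
Hypothesis T0 : 0 < T.

(** The projection of the line onto [0, T]. Composing a forcing with it extends
the equation to all times, so that solutions are differentiable on both sides
at 0 and T. *)
Definition clamp (t : R) : R := Num.max 0 (Num.min t T).

Lemma clamp_in t : 0 <= clamp t <= T.
Proof. by rewrite /clamp le_max lexx/= ge_max (ltW T0)/= ge_min lexx orbT. Qed.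

Lemma clamp_id t : 0 <= t <= T -> clamp t = t.
Proof. by move=> /andP[t0 tT]; rewrite /clamp min_l// max_r. Qed.

Lemma clamp_lip t r : `|clamp t - clamp r| <= `|t - r|.
Proof.
rewrite /clamp /Num.max /Num.min.
have := ler_norm (t - r); have := ler_norm (- (t - r)); rewrite normrN => n1 n2.
set u := if t < T then t else T; set v := if r < T then r else T.
have uE : u = if t < T then t else T by [].
have vE : v = if r < T then r else T by [].
clearbody u v; move: uE vE.
case: (ltP t T) => h1; case: (ltP r T) => h2; move=> uE vE;
  case: (ltP 0 u) => h3; case: (ltP 0 v) => h4;
  rewrite ler_norml; apply/andP; split; lra.
Qed.

End clamping.

Section Picard.
Context (R : realType).
Implicit Types (a b c d : nat -> R) (k N K : nat) (B D t e : R).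
Variables (s : nat) (T : R).
Hypothesis T0 : 0 < T.
Variable G : R -> (nat -> R) -> (nat -> R) -> nat -> R.

(** Stated for squares of norms, like every estimate on coefficient sequences.
*)
Definition lipschitz_on_bounded := forall B, exists2 L, 0 <= L &
  forall t a b c d D, 0 <= t <= T -> bdE s a b B -> bdE s c d B ->
    bdE s (fun k => a k - c k) (fun k => b k - d k) D ->
    bd s (fun k => G t a b k - G t c d k) (L * D).

Definition linear_growth := exists2 C, 0 <= C &
  forall t a b B, 0 <= t <= T -> bdE s a b B -> bd s (G t a b) (C * B).

(** Continuity in time of the forcing, uniformly on bounded sets of (a, b). *)
Definition time_continuous := forall B e, 0 < e -> exists2 del, 0 < del &
  forall t r a b, 0 <= t <= T -> 0 <= r <= T -> `|t - r| < del -> bdE s a b B ->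
    bd s (fun k => G t a b k - G r a b k) e.

Definition ucont (a b : R -> nat -> R) := forall e, 0 < e -> exists2 del, 0 < del &
  forall t r, 0 <= t <= T -> 0 <= r <= T -> `|t - r| < del ->
    bdE s (fun k => a t k - a r k) (fun k => b t k - b r k) e.

Definition ucont1 (g : R -> nat -> R) := forall e, 0 < e -> exists2 del, 0 < del &
  forall t r, 0 <= t <= T -> 0 <= r <= T -> `|t - r| < del ->
    bd s (fun k => g t k - g r k) e.

Lemma isd_contT (a b : R -> nat -> R) (f h : R -> nat -> R) :
  (forall (t : R) k, is_derive t 1 (fun r => a r k) (f t k) /\
     is_derive t 1 (fun r => b r k) (h t k)) -> forall T', contT T' a b.
Proof.
move=> H T' k; split.
  by apply: (isd_within (f := fun t => f t k)) => t _; have [] := H t k.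
by apply: (isd_within (f := fun t => h t k)) => t _; have [] := H t k.
Qed.

Lemma solves_sub (a b a' b' g g' : R -> nat -> R) T' : solves T' a b g -> solves T' a' b' g' ->
  solves T' (fun t k => a t k - a' t k) (fun t k => b t k - b' t k) (fun t k => g t k - g' t k).
Proof.
move=> H H' t t0T k; have [Da Db] := H t t0T k; have [Da' Db'] := H' t t0T k.
split; first exact: (isdB Da Da').
apply: (isd_eq (isdB Db Db')); ring.
Qed.

Lemma contT_sub (a b a' b' : R -> nat -> R) T' : contT T' a b -> contT T' a' b' ->
  contT T' (fun t k => a t k - a' t k) (fun t k => b t k - b' t k).
Proof.
move=> H H' k; have [ca cb] := H k; have [ca' cb'] := H' k.
by split=> t; apply: cvgB; [exact: ca|exact: ca'|exact: cb|exact: cb'].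
Qed.

Lemma kap_arith (L Q x : R) : (1 + 4 * L - 1) * (4^-1 * Q * x) = L * (Q * x).
Proof. by field. Qed.

(** The difference of two solutions is forced by the difference of the
forcings. Each application of the energy estimate divides its bound by 4, if
the bound carries the weight exp (kap t) with kap = 1 + 4 L; so the difference
vanishes. *)
Lemma picard_unique (a b a' b' : R -> nat -> R) B : lipschitz_on_bounded ->
  solves T a b (fun t => G t (a t) (b t)) -> solves T a' b' (fun t => G t (a' t) (b' t)) ->
  contT T a b -> contT T a' b' -> a 0 = a' 0 -> b 0 = b' 0 ->
  (forall t, 0 <= t <= T -> bdE s (a t) (b t) B /\ bdE s (a' t) (b' t) B) ->
  forall t, 0 <= t <= T -> a t = a' t /\ b t = b' t.
Proof.
move=> GL sol sol' ct ct' a00 b00 HB.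
have [L L0 HL] := GL B; pose kap := 1 + 4 * L.
have B0 : 0 <= B by have [/bdE_ge0] := HB 0 (introT andP (conj (lexx 0) (ltW T0))).
have H j : forall t, 0 <= t <= T -> bdE s (fun k => a t k - a' t k) (fun k => b t k - b' t k)
   (4^-1 ^+ j * (4 * B) * expR (kap * t)).
  elim: j => [|j IH].
    move=> t t0T; have [h1 h2] := HB t t0T; apply: bdE_le (bdEB h1 h2) _.
    rewrite expr0 mul1r; apply: (@le_trans _ _ (4 * B)); first by lra.
    rewrite ler_peMr ?mulr_ge0// -expR0 ler_expR mulr_ge0//; last by case/andP: t0T.
    by rewrite addr_ge0// mulr_ge0.
  rewrite exprS -mulrA.
  apply: (energy_exp (solves_sub sol sol') (contT_sub ct ct')).
    move=> t /andP[t0 tT]; have t0T : 0 <= t <= T by rewrite !ltW.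
    rewrite /kap kap_arith; have [h1 h2] := HB t t0T.
    by apply: HL => //; exact: IH.
  rewrite a00 b00 => N; rewrite /energy_sum big1 => [|k _].
    by rewrite !mulr_ge0// ?exprn_ge0// ?mulr_ge0.
  by rewrite !subrr !mulr0 expr0n addr0.
move=> t t0T.
suff E k : a t k - a' t k = 0 /\ b t k - b' t k = 0.
  by split; apply/funext => k; have [h1 h2] := E k; apply/eqP; rewrite -subr_eq0; apply/eqP.
apply: (bdE_eq0 (s := s) (a := fun k => a t k - a' t k) (b := fun k => b t k - b' t k)) => e e0.
have C : (4^-1 : R) ^+ j * (4 * B) * expR (kap * t) @[j --> \oo] --> (0 : R).
  rewrite -[X in _ --> X](mul0r (4 * B * expR (kap * t))).
  under eq_fun do rewrite -mulrA.
  apply: cvgM; last exact: cvg_cst.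
  by apply: cvg_expr; rewrite ger0_norm// invf_lt1//; lra.
have /cvgr0_norm_le/(_ _ e0)[j _ Hj] := C.
apply: bdE_le (H j t t0T) _; apply: le_trans (ler_norm _) (Hj _ _); exact: leqnn.
Qed.

(** Finitely many modes are continuous at time 0. *)
Lemma energy_sum_cvg0 (a b : R -> nat -> R) (f h : R -> nat -> R) K e : 0 < e ->
  (forall (t : R) k, is_derive t 1 (fun r => a r k) (f t k) /\
     is_derive t 1 (fun r => b r k) (h t k)) ->
  exists2 del, 0 < del & forall r, `|r| < del ->
    energy_sum s (fun k => a r k - a 0 k) (fun k => b r k - b 0 k) 0 K <= e.
Proof.
move=> e0 D.
pose F r := energy_sum s (fun k => a r k - a 0 k) (fun k => b r k - b 0 k) 0 K.
have DF (t : R) : is_derive t 1 F (\sum_(0 <= k < K)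
   (2 * (om k ^+ s.+1 * (a t k - a 0 k)) * (om k ^+ s.+1 * (f t k - 0)) +
    2 * (om k ^+ s * (b t k - b 0 k)) * (om k ^+ s * (h t k - 0)))).
  apply: isd_sum => k _; have [Da Db] := D t k.
  exact: (isdD (isd_sqr (isdZ _ (isdB Da (isd_cst _ t)))) (isd_sqr (isdZ _ (isdB Db (isd_cst _ t))))).
have F0 : F 0 = 0.
  by rewrite /F /energy_sum big1// => k _; rewrite !subrr !mulr0 expr0n addr0.
have cF : F r @[r --> 0] --> (0 : R) by rewrite -[X in _ --> X]F0; exact: isd_cvg (DF 0).
have /cvgr0_norm_le/(_ _ e0)[del d0 H] := cF.
exists del => // r rd; apply: le_trans (ler_norm _) (H r _).
by rewrite /= sub0r normrN.
Qed.

Lemma solves_shift (a b g : R -> nat -> R) h T' :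
  (forall (t : R) k, is_derive t 1 (fun r => a r k) (b t k) /\
     is_derive t 1 (fun r => b r k) (- om k ^+ 2 * a t k - g t k)) ->
  solves T' (fun t k => a (t + h) k) (fun t k => b (t + h) k) (fun t k => g (t + h) k).
Proof.
move=> D t _ k; have [Da Db] := D (t + h) k.
have S : is_derive t 1 (fun r : R => r + h) (1 + 0) by exact: (isdD (isd_id t) (isd_cst h t)).
split.
  by apply: (isd_eq (isd_comp (F := fun r => a r k) (G := fun r => r + h) Da S)); rewrite addr0 mulr1.
by apply: (isd_eq (isd_comp (F := fun r => b r k) (G := fun r => r + h) Db S)); rewrite addr0 mulr1.
Qed.

(** A solution inherits the time continuity of its forcing: by the energy
estimate it suffices to compare it with its own time translates, and the
initial mismatch of these is small because the tail of the energy is small at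
time 0 and stays small for a short time, while the finitely many remaining
modes are continuous. *)
Lemma ucont_of_forcing (a b g : R -> nat -> R) B0 C0 :
  (forall (t : R) k, is_derive t 1 (fun r => a r k) (b t k) /\
     is_derive t 1 (fun r => b r k) (- om k ^+ 2 * a t k - g t k)) ->
  bdE s (a 0) (b 0) B0 -> (forall t, 0 <= t <= T -> bd s (g t) C0) -> ucont1 g -> ucont a b.
Proof.
move=> D ab0 gC gu.
have C00 : 0 <= C0 by exact: bd_ge0 (gC 0 (introT andP (conj (lexx 0) (ltW T0)))).
have cT := isd_contT D.
have sol T' : solves T' a b g by move=> t _ k; exact: D.
have eT : 1 <= expR T by rewrite -expR0 ler_expR ltW.
have eT0 : 0 < expR T by exact: expR_gt0.
have init e : 0 < e -> exists2 del, 0 < del & forall h, 0 <= h <= T -> h < del ->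
    bdE s (fun k => a h k - a 0 k) (fun k => b h k - b 0 k) e.
  (* the tail at time 0 is at most eta and grows at most by the factor exp T *)
  move=> e0; pose eta := e / (8 * expR T).
  have eta0 : 0 < eta by rewrite divr_gt0// mulr_gt0.
  have [K HK] := bdE_tail ab0 eta0.
  have [d1 d10 H1] := energy_sum_cvg0 K (divr_gt0 e0 (ltr0Sn R 3)) D.
  pose d2 := eta / (C0 + 1); have d20 : 0 < d2 by rewrite divr_gt0// ltr_wpDl.
  exists (Num.min d1 d2); first by rewrite lt_min d10.
  move=> h /andP[h0 hT]; rewrite lt_min => /andP[hd1 hd2] N.
  have Dz (t : R) : is_derive t 1 (fun r => (eta + C0 * r) * expR r)
      (C0 * expR t + (eta + C0 * t) * expR t).
    apply: (isd_eq (isdM (isdD (isd_cst eta t) (isdZ C0 (isd_id t))) (is_derive_expR t))).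
    ring.
  have tail M : energy_sum s (a h) (b h) K M <= 2 * eta * expR T.
    apply: (@le_trans _ _ ((eta + C0 * h) * expR h)).
      apply: (@energy_le _ s a b g h K M (fun=> C0) (fun r => (eta + C0 * r) * expR r)
        (fun r => C0 * expR r + (eta + C0 * r) * expR r)) => //.
      - by move=> t /andP[t0 th]; apply: ssq_sum_le; apply: gC; rewrite (ltW t0) ltW// (lt_le_trans th).
      - move=> t /andP[t0 th]; rewrite addrC lerD2r ler_peMr// -expR0 ler_expR ltW//.
      - by rewrite mulr0 addr0 expR0 mulr1.
      - by rewrite h0 lexx.
    apply: ler_pM; rewrite ?expR_ge0 ?ler_expR//.
      by rewrite addr_ge0 ?(ltW eta0)// mulr_ge0.
    rewrite mulr2n mulrDl !mul1r lerD2l.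
    apply: (@le_trans _ _ (C0 * d2)); first by rewrite ler_wpM2l// ltW.
    by rewrite /d2 mulrCA ler_piMr ?(ltW eta0)// ler_pdivrMr ?ltr_wpDl// mul1r lerDl.
  have etaE : eta * expR T = e / 8 by rewrite /eta; field; rewrite gt_eqF.
  have etal : eta <= e / 8 by rewrite -etaE ler_peMr// ltW.
  have TL M : energy_sum s (fun k => a h k - a 0 k) (fun k => b h k - b 0 k) K M <= e / 2 + e / 4.
    apply: le_trans (energy_sumB _ _ _ _ _ _ _) _; have := tail M; have := HK M.
    rewrite -mulrA etaE; lra.
  have hn : `|h| < d1 by rewrite ger0_norm.
  apply: (@le_trans _ _ (energy_sum s (fun k => a h k - a 0 k) (fun k => b h k - b 0 k) 0 K +
     energy_sum s (fun k => a h k - a 0 k) (fun k => b h k - b 0 k) K N)).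
    case: (leqP K N) => KN; first by rewrite /energy_sum (big_cat_nat (leq0n K) KN).
    rewrite -[leLHS]addr0; apply: lerD; last exact: energy_sum_ge0.
    by rewrite /energy_sum (big_cat_nat (leq0n N) (ltnW KN))/= lerDl; exact: energy_sum_ge0.
  have := H1 h hn; have := TL N; lra.
suff main e : 0 < e -> exists2 del, 0 < del & forall t h, 0 <= h <= T -> 0 <= t <= T - h ->
    h < del -> bdE s (fun k => a (t + h) k - a t k) (fun k => b (t + h) k - b t k) e.
  move=> e e0; have [del d0 H] := main e e0; exists del => // t r t0T r0T.
  case: (lerP t r) => tr.
    have := H t (r - t); rewrite addrCA subrr addr0.
    move=> H' H2; have : bdE s (fun k => a r k - a t k) (fun k => b r k - b t k) e.
      apply: H'; [by lra|by lra|].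
      exact: H2.
    move/bdEN => H3 N; have := H3 N.
    rewrite (_ : (fun k => - (a r k - a t k)) = (fun k => a t k - a r k)); last first.
      by apply/funext => k; rewrite opprB.
    rewrite (_ : (fun k => - (b r k - b t k)) = (fun k => b t k - b r k))//.
    by apply/funext => k; rewrite opprB.
  have := H r (t - r); rewrite addrCA subrr addr0.
  move=> H' H2; apply: H'; [by lra|by lra|].
  exact: H2.
(* time translates are compared with the weight exp (2 t) *)
move=> e0; pose eta := e / expR (2 * T).
have eta0 : 0 < eta by rewrite divr_gt0// expR_gt0.
have [d1 d10 H1] := init _ eta0; have [d2 d20 H2] := gu _ eta0.
exists (Num.min d1 d2); first by rewrite lt_min d10.
move=> t h h0T t0; rewrite lt_min => /andP[hd1 hd2].
apply: (@bdE_le _ _ _ _ (eta * expR (2 * t))); last first.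
  rewrite /eta mulrAC ler_pdivrMr ?expR_gt0// ler_wpM2l ?(ltW e0)// ler_expR; lra.
apply: (@energy_exp _ s (fun t k => a (t + h) k - a t k) (fun t k => b (t + h) k - b t k)
   (fun t k => g (t + h) k - g t k) (T - h)) => //.
- by apply: solves_sub; [exact: solves_shift|exact: sol].
- apply: contT_sub; last exact: cT.
  move=> k; split.
    apply: (isd_within (f := fun r => b (r + h) k)) => r _.
    by apply: (isd_eq (isd_comp (F := fun r => a r k) (G := fun r => r + h) (D (r + h) k).1 (isdD (isd_id r) (isd_cst h r)))); rewrite addr0 mulr1.
  apply: (isd_within (f := fun r => - om k ^+ 2 * a (r + h) k - g (r + h) k)) => r _.
  by apply: (isd_eq (isd_comp (F := fun r => b r k) (G := fun r => r + h) (D (r + h) k).2 (isdD (isd_id r) (isd_cst h r)))); rewrite addr0 mulr1.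
- move=> r /andP[r0 rT]; apply: (@bd_le _ _ _ eta).
    apply: H2; [by lra|by lra|].
    by rewrite addrAC subrr add0r ger0_norm//; lra.
  rewrite (_ : 2 - 1 = 1 :> R) ?mul1r; last by ring.
  by rewrite ler_peMr ?(ltW eta0)// -expR0 ler_expR mulr_ge0// ltW.
- by rewrite add0r; apply: H1 => //; lra.
Qed.

Lemma sqr_le_norm (x e : R) : 0 < e -> x ^+ 2 <= e ^+ 2 -> `|x| <= e.
Proof. by move=> e0; rewrite -real_normK ?num_real// ler_sqr// nnegrE ltW. Qed.

Lemma quarter_cvg (M : R) : 4^-1 ^+ j * M @[j --> \oo] --> (0 : R).
Proof.
rewrite -[X in _ --> X](mul0r M); apply: cvgM; last exact: cvg_cst.
by apply: cvg_expr; rewrite ger0_norm// invf_lt1//; lra.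
Qed.

Lemma quarter_small (M e : R) : 0 < e -> exists j, 4^-1 ^+ j * M <= e.
Proof.
move=> e0; have /cvgr0_norm_le/(_ _ e0)[j _ H] := quarter_cvg M.
by exists j; apply: le_trans (ler_norm _) (H _ _); exact: leqnn.
Qed.

Lemma quarter_cauchy (u : nat -> R) M :
  (forall j p, (u (j + p)%N - u j) ^+ 2 <= 4^-1 ^+ j * M) -> exists l : R, u @ \oo --> l.
Proof.
move=> H; suff : cvgn u by move=> /cvg_ex.
apply/cauchy_cvgP/cauchy_ballP => e e0.
have e2 : 0 < e / 4 by rewrite divr_gt0.
have [j Hj] := quarter_small M (exprn_gt0 2 e2).
have W i : (j <= i)%N -> `|u i - u j| <= e / 4.
  by move=> ji; apply: sqr_le_norm => //; apply: le_trans (Hj); rewrite -(subnKC ji); exact: H.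
have N : \forall x \near u @ \oo, `|x - u j| <= e / 4 by exists j.
near=> x y => /=.
rewrite /ball/= (_ : x - y = (x - u j) - (y - u j)); last by ring.
apply: le_lt_trans (ler_normB _ _) _.
have h1 : `|x - u j| <= e / 4 by near: x.
have h2 : `|y - u j| <= e / 4 by near: y.
lra.
Unshelve. all: by end_near.
Qed.

Lemma forcing_ucont (a b : R -> nat -> R) B : lipschitz_on_bounded -> time_continuous ->
  (forall t, 0 <= t <= T -> bdE s (a t) (b t) B) -> ucont a b ->
  ucont1 (fun t => G (clamp T t) (a (clamp T t)) (b (clamp T t))).
Proof.
move=> GL GT ab U e e0; have [L L0 HL] := GL B.
have e4 : 0 < e / 4 by rewrite divr_gt0.
have e5 : 0 < e / (4 * (L + 1)) by rewrite divr_gt0// mulr_gt0// ltr_wpDl.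
have [d1 d10 H1] := GT B _ e4; have [d2 d20 H2] := U _ e5.
exists (Num.min d1 d2); first by rewrite lt_min d10.
move=> t r t0T r0T; rewrite lt_min => /andP[h1 h2]; rewrite !clamp_id//.
have K1 := HL t _ _ _ _ _ t0T (ab _ t0T) (ab _ r0T) (H2 _ _ t0T r0T h2).
have K2 := H1 _ _ _ _ t0T r0T h1 (ab _ r0T).
have K := bdD K1 K2.
rewrite (_ : (fun k => G t (a t) (b t) k - G r (a r) (b r) k) =
   fun k => G t (a t) (b t) k - G t (a r) (b r) k
     + (G t (a r) (b r) k - G r (a r) (b r) k)); last by apply/funext => k; ring.
apply: bd_le K _.
have : L * (e / (4 * (L + 1))) <= e / 4.
  rewrite mulrCA ler_wpM2l ?(ltW e0)// invfM mulrCA ler_piMr ?invr_ge0//.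
  by rewrite ler_pdivrMr ?ltr_wpDl// mul1r lerDl.
lra.
Qed.

Section existence.
Variables (a0 b0 : nat -> R) (B0 : R).
Hypothesis ab0 : bdE s a0 b0 B0.
Hypothesis GL : lipschitz_on_bounded.
Variable C : R.
Hypothesis C0 : 0 <= C.
Hypothesis GC : forall t a b B, 0 <= t <= T -> bdE s a b B -> bd s (G t a b) (C * B).
Hypothesis GT : time_continuous.

Let traj := ((R -> nat -> R) * (R -> nat -> R))%type.
Implicit Types U V W : traj.

Let gap U V t e := bdE s (fun k => U.1 t k - V.1 t k) (fun k => U.2 t k - V.2 t k) e.

Let gap_sym U V t e : gap U V t e -> gap V U t e.
Proof.
move=> /bdEN H N; have := H N.
rewrite (_ : (fun k => - (U.1 t k - V.1 t k)) = (fun k => V.1 t k - U.1 t k)); last first.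
  by apply/funext => k; rewrite opprB.
rewrite (_ : (fun k => - (U.2 t k - V.2 t k)) = (fun k => V.2 t k - U.2 t k))//.
by apply/funext => k; rewrite opprB.
Qed.

Let gap_tri U V W t x y : gap U V t x -> gap V W t y -> gap U W t (2 * x + 2 * y).
Proof.
move=> H1 H2; have H := bdED H1 H2; rewrite /gap.
rewrite (_ : (fun k => U.1 t k - W.1 t k) =
  (fun k => U.1 t k - V.1 t k + (V.1 t k - W.1 t k))); last by apply/funext => k; ring.
rewrite (_ : (fun k => U.2 t k - W.2 t k) =
  (fun k => U.2 t k - V.2 t k + (V.2 t k - W.2 t k)))//; by apply/funext => k; ring.
Qed.

(** The forcing along a trajectory, frozen outside [0, T]. *)
Let frc U t := G (clamp T t) (U.1 (clamp T t)) (U.2 (clamp T t)).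

(** The a priori bound that linear growth imposes on all iterates. *)
Let Bt t := B0 * expR ((1 + C) * t).

(** The class of trajectories preserved by a Picard step. *)
Let nice U := (forall t, 0 <= t <= T -> bdE s (U.1 t) (U.2 t) (Bt t)) /\ ucont U.1 U.2.

Let B00 : 0 <= B0. Proof. exact: bdE_ge0 ab0. Qed.

Let Bt_le t : 0 <= t <= T -> Bt t <= Bt T.
Proof.
move=> /andP[t0 tT]; rewrite /Bt ler_wpM2l// ler_expR ler_wpM2l//.
by rewrite addr_ge0.
Qed.

Let nice_bd U t : nice U -> 0 <= t <= T -> bdE s (U.1 t) (U.2 t) (Bt T).
Proof. by move=> [H _] t0T; apply: bdE_le (H _ t0T) (Bt_le t0T). Qed.

Let frc_ucont U : nice U -> ucont1 (frc U).
Proof. by move=> nU; apply: (@forcing_ucont U.1 U.2 (Bt T)) nU.2 => // t; exact: nice_bd. Qed.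

Let frc_bd U t : nice U -> 0 <= t <= T -> bd s (frc U t) (C * Bt t).
Proof. by move=> nU t0T; rewrite /frc clamp_id//; apply: GC => //; exact: nU.1. Qed.

(** Continuity of every single forcing term is what the explicit solution of
the modes requires. *)
Let frc_continuous U k : nice U -> continuous (fun t => frc U t k).
Proof.
move=> nU t; apply/cvgrPdist_le => e e0.
have [d d0 H] := frc_ucont nU (exprn_gt0 2 e0).
exists d => // r /= rd; apply: sqr_le_norm => //.
have clcl x : frc U x = frc U (clamp T x) by rewrite /frc (clamp_id (clamp_in T0 x)).
rewrite (clcl t) (clcl r).
have K := H (clamp T t) (clamp T r) (clamp_in T0 t) (clamp_in T0 r) (le_lt_trans (clamp_lip T t r) rd).
exact: (bd_coef k K).
Qed.

(** V is the solution of the linear problem whose forcing is computed from U.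
*)
Let follows U V := [/\ V.1 0 = a0, V.2 0 = b0 & forall (t : R) k,
    is_derive t 1 (fun r => V.1 r k) (V.2 t k) /\
    is_derive t 1 (fun r => V.2 r k) (- om k ^+ 2 * V.1 t k - frc U t k)].

Let follows_solves U V : follows U V -> solves T V.1 V.2 (frc U).
Proof. by move=> [_ _ D] t _ k; exact: D. Qed.

Let follows_contT U V : follows U V -> contT T V.1 V.2.
Proof. by move=> [_ _ D]; exact: isd_contT D T. Qed.

Let follows_nice U V : nice U -> follows U V -> nice V.
Proof.
move=> nU fV; have [Va Vb D] := fV; split.
  move=> t t0T; apply: (energy_exp (follows_solves fV) (follows_contT fV)) => //.
    move=> r /andP[r0 rT]; rewrite addrAC subrr add0r.
    by apply: frc_bd; rewrite ?(ltW r0) ?(ltW rT).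
  by rewrite Va Vb.
apply: (@ucont_of_forcing _ _ (frc U) B0 (C * Bt T)) => //.
- by rewrite Va Vb.
- move=> t t0T; apply: bd_le (frc_bd nU t0T) _.
  by rewrite ler_wpM2l// Bt_le.
- exact: frc_ucont.
Qed.

(** A Picard step divides the square distance by 4, up to the weight exp ((1 +
4 L) t). *)
Let step_gap U U' V V' L Q : nice U -> nice U' -> follows U V -> follows U' V' ->
  0 <= L -> (forall t a b c d D, 0 <= t <= T -> bdE s a b (Bt T) -> bdE s c d (Bt T) ->
    bdE s (fun k => a k - c k) (fun k => b k - d k) D ->
    bd s (fun k => G t a b k - G t c d k) (L * D)) ->
  0 <= Q -> (forall t, 0 <= t <= T -> gap U U' t (Q * expR ((1 + 4 * L) * t))) ->
  forall t, 0 <= t <= T -> gap V V' t (4^-1 * Q * expR ((1 + 4 * L) * t)).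
Proof.
move=> nU nU' fV fV' L0 HL Q0 H.
have [Va Vb _] := fV; have [Va' Vb' _] := fV'.
apply: (@energy_exp _ _ _ _ (fun t k => frc U t k - frc U' t k)).
- by apply: solves_sub; apply: follows_solves.
- by apply: contT_sub; apply: follows_contT; [exact: fV|exact: fV'].
- move=> t /andP[t0 tT]; have t0T : 0 <= t <= T by rewrite !ltW.
  rewrite kap_arith /frc !clamp_id//; apply: HL => //; try exact: nice_bd.
  exact: H.
- rewrite Va Vb Va' Vb' => N; rewrite /energy_sum big1 => [|k _]; first by rewrite mulr_ge0.
  by rewrite !subrr !mulr0 expr0n addr0.
Qed.

Let picard_step U : exists V, nice U -> follows U V.
Proof.
case: (pselect (nice U)) => nU; last by exists U.
have [V H] := modes_solve a0 b0 (fun k => @frc_continuous U k nU).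
by exists V.
Qed.

(** Iterates of the Picard step form a Cauchy sequence, uniformly on [0, T].
The limit lies in the invariant class, and one further step leads from it to a
solution: this step is continuous for the distance, so it does not move the
limit. *)
Theorem picard_exists : exists a b : R -> nat -> R, [/\ a 0 = a0 /\ b 0 = b0,
  (forall (t : R) k, is_derive t 1 (fun r => a r k) (b t k) /\
    is_derive t 1 (fun r => b r k)
      (- om k ^+ 2 * a t k - G (clamp T t) (a (clamp T t)) (b (clamp T t)) k)),
  exists Q, forall t, 0 <= t <= T -> bdE s (a t) (b t) Q & ucont a b].
Proof.
have [S HS] := choice picard_step.
pose U0 : traj := (fun=> a0, fun=> b0).
pose U j := iter j S U0.
have nU0 : nice U0.
  split=> [t /andP[t0 tT]|e e0].
    apply: bdE_le ab0 _; rewrite /Bt ler_peMr// -expR0 ler_expR mulr_ge0// addr_ge0//.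
  exists 1 => // t r _ _ _ N; rewrite /energy_sum big1 ?ltW// => k _.
  by rewrite !subrr !mulr0 expr0n addr0.
have nU j : nice (U j) by elim: j => [//|j IH]; exact: follows_nice (HS _ IH).
have fU j : follows (U j) (U j.+1) := HS _ (nU j).
have [L L0 HL] := GL (Bt T); pose kap := 1 + 4 * L.
have kap0 : 0 <= kap by rewrite addr_ge0// mulr_ge0.
have BT0 : 0 <= Bt T by rewrite mulr_ge0// expR_ge0.
have ek t : 0 <= t <= T -> 1 <= expR (kap * t).
  by move=> /andP[t0 _]; rewrite -expR0 ler_expR mulr_ge0.
have ekT t : 0 <= t <= T -> expR (kap * t) <= expR (kap * T).
  by move=> /andP[_ tT]; rewrite ler_expR ler_wpM2l.
have d1 j : forall t, 0 <= t <= T ->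
    gap (U j.+1) (U j) t (4^-1 ^+ j * (4 * Bt T) * expR (kap * t)).
  elim: j => [|j IH].
    move=> t t0T; rewrite expr0 mul1r.
    apply: bdE_le (bdEB (nice_bd (nU 1%N) t0T) (nice_bd (nU 0%N) t0T)) _.
    apply: (@le_trans _ _ (4 * Bt T)); first by lra.
    by rewrite ler_peMr ?mulr_ge0// ek.
  move=> t t0T; rewrite exprS -(mulrA 4^-1).
  apply: (step_gap (nU j.+1) (nU j) (fU j.+1) (fU j) L0 HL _ IH) => //.
  by rewrite !mulr_ge0// exprn_ge0.
pose M := 4 * (4 * Bt T * expR (kap * T)).
have M0 : 0 <= M by rewrite !mulr_ge0// expR_ge0.
have d2 j t : 0 <= t <= T -> gap (U j.+1) (U j) t (4^-1 ^+ j * (M / 4)).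
  move=> t0T; apply: bdE_le (d1 j t t0T) _.
  rewrite (_ : M / 4 = 4 * Bt T * expR (kap * T)); last by rewrite /M; field.
  by rewrite -mulrA ler_wpM2l ?exprn_ge0// ler_wpM2l ?mulr_ge0// ekT.
(* telescoping: 2 (M / 4) + 2 (M / 4) <= M *)
have d3 p : forall j t, 0 <= t <= T -> gap (U (j + p)%N) (U j) t (4^-1 ^+ j * M).
  elim: p => [|p IH] j t t0T.
    rewrite addn0 => N; rewrite /energy_sum big1 ?mulr_ge0 ?exprn_ge0// => k _.
    by rewrite !subrr !mulr0 expr0n addr0.
  rewrite addnS -addSn.
  apply: bdE_le (gap_tri (IH j.+1 t t0T) (d2 j t t0T)) _.
  rewrite exprS; have : 0 <= 4^-1 ^+ j * M by rewrite mulr_ge0// exprn_ge0.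
  lra.
have cva t k : 0 <= t <= T -> exists l : R, (U j).1 t k @[j --> \oo] --> l.
  move=> t0T; apply: (@quarter_cauchy _ M) => j p.
  exact: (bd_coef k (bdEl (d3 p j t t0T))).
have cvb t k : 0 <= t <= T -> exists l : R, (U j).2 t k @[j --> \oo] --> l.
  move=> t0T; apply: (@quarter_cauchy _ M) => j p.
  exact: (bd_coef k (bdEr (d3 p j t t0T))).
pose A : traj := (fun t k => lim ((U j).1 t k @[j --> \oo]), fun t k => lim ((U j).2 t k @[j --> \oo])).
have ca t k : 0 <= t <= T -> (U j).1 t k @[j --> \oo] --> A.1 t k.
  by move=> t0T; have [l Hl] := cva t k t0T; apply: (cvgP l).
have cb t k : 0 <= t <= T -> (U j).2 t k @[j --> \oo] --> A.2 t k.
  by move=> t0T; have [l Hl] := cvb t k t0T; apply: (cvgP l).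
have gA j t : 0 <= t <= T -> gap A (U j) t (4^-1 ^+ j * M).
  move=> t0T; apply: (@bdE_cvg _ s (fun p k => (U (j + p)%N).1 t k - (U j).1 t k)
    (fun p k => (U (j + p)%N).2 t k - (U j).2 t k)).
  - by move=> p; exact: d3.
  - move=> k; apply: cvgB; last exact: cvg_cst.
    under eq_fun do rewrite addnC.
    by have := ca t k t0T; rewrite -(cvg_shiftn j).
  - move=> k; apply: cvgB; last exact: cvg_cst.
    under eq_fun do rewrite addnC.
    by have := cb t k t0T; rewrite -(cvg_shiftn j).
have nA : nice A.
  split=> [t t0T|e e0].
    apply: (@bdE_cvg _ s (fun j => (U j).1 t) (fun j => (U j).2 t)).
    - by move=> j; exact: (nU j).1.
    - by move=> k; exact: ca.
    - by move=> k; exact: cb.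
  have e12 : 0 < e / 12 by rewrite divr_gt0.
  have [j Hj] := quarter_small M e12.
  have [d d0 H] := (nU j).2 _ e12.
  exists d => // t r t0T r0T tr.
  have K1 := bdE_le (gA j t t0T) Hj; have K2 := bdE_le (gA j r r0T) Hj.
  have K3 := H t r t0T r0T tr.
  have K4 := bdED (bdEB K1 K2) K3.
  apply: (@bdE_le _ _ _ _ (2 * (2 * (e / 12) + 2 * (e / 12)) + 2 * (e / 12))); last by lra.
  move=> N; have := K4 N; congr (energy_sum _ _ _ _ _ <= _); apply/funext => k; ring.
(* one more step from the limit; it stays at the limit on [0, T] *)
pose W := S A; have fW : follows A W := HS _ nA.
have AW t : 0 <= t <= T -> A.1 t = W.1 t /\ A.2 t = W.2 t.
  move=> t0T.
  suff E k : A.1 t k - W.1 t k = 0 /\ A.2 t k - W.2 t k = 0.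
    by split; apply/funext => k; have [h1 h2] := E k; apply/eqP; rewrite -subr_eq0; apply/eqP.
  apply: (bdE_eq0 (s := s) (a := fun k => A.1 t k - W.1 t k) (b := fun k => A.2 t k - W.2 t k)) => e e0.
  have [j Hj] := quarter_small (M * expR (kap * T)) (divr_gt0 e0 (ltr0Sn R 3)).
  have Mj0 : 0 <= 4^-1 ^+ j * M by rewrite mulr_ge0// exprn_ge0.
  have K1 : gap (U j.+1) W t (e / 4).
    apply: (@bdE_le _ _ _ _ (4^-1 * (4^-1 ^+ j * M) * expR (kap * t))); last first.
      apply: le_trans Hj; rewrite -mulrA [leRHS]mulrA.
      apply: (@le_trans _ _ (4^-1 ^+ j * M * expR (kap * t))).
        by rewrite ler_piMl ?mulr_ge0 ?expR_ge0// invf_le1//; lra.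
      by rewrite ler_wpM2l// ekT.
    apply: (step_gap (nU j) nA (fU j) fW L0 HL Mj0) => // r r0T.
    by apply: gap_sym; apply: bdE_le (gA j r r0T) _; rewrite ler_peMr// ek.
  have K2 : gap A (U j.+1) t (e / 4).
    apply: bdE_le (gA j.+1 t t0T) _; apply: le_trans Hj.
    rewrite exprS -mulrA [leRHS]mulrA.
    apply: (@le_trans _ _ (4^-1 ^+ j * M)).
      by rewrite ler_piMl// invf_le1//; lra.
    by rewrite ler_peMr// ek//; rewrite (ltW T0) lexx.
  by apply: bdE_le (gap_tri K2 K1) _; lra.
have nW := follows_nice nA fW; have [Wa Wb D] := fW.
exists W.1, W.2; split => //.
- move=> t k; have [D1 D2] := D t k; split => //.
  move: D2; rewrite /frc; have [-> ->] := AW _ (clamp_in T0 t); exact.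
- by exists (Bt T) => t t0T; exact: nice_bd nW t0T.
- exact: nW.2.
Qed.

End existence.

End Picard.

(** * Absolutely continuous functions and derivatives of limits *)

Section absolute_continuity.
Context (R : realType).
Local Notation leb := (@lebesgue_measure R).
Implicit Types (g h : R -> R) (T z d e : R).

(** A property that propagates across every point of [0, z], from the left of
the point to its right, holds at z. Consider the supremum of the points where
it holds. *)
Lemma interval_induction (S : R -> Prop) z : 0 <= z -> S 0 ->
  (forall t, 0 <= t <= z -> exists2 d, 0 < d & forall x y, 0 <= x -> x <= t -> t <= y -> y <= z ->
     y - x < d -> S x -> S y) -> S z.
Proof.
move=> z0 S0 H.
pose A := [set x | 0 <= x <= z /\ S x].
have A0 : A 0 by split; rewrite ?lexx.
have ubz : ubound A z by move=> x [/andP[]].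
have hs : has_sup A by split; [exists 0|exists z].
pose t := sup A.
have t0 : 0 <= t by apply: sup_upper_bound A0.
have tz : t <= z by apply: ge_sup; first exists 0.
have [|d d0 Hd] := H t; first by rewrite t0 tz.
have d2 : 0 < d / 2 by rewrite divr_gt0.
have [x [/andP[x0 xz] Sx] tx] := sup_adherent d2 hs; rewrite -/t in tx.
have xt : x <= t by apply: sup_upper_bound => //; split => //; rewrite x0.
pose y := Num.min z (t + d / 4).
have yz : y <= z by rewrite /y ge_min lexx.
have yt : t <= y by rewrite /y le_min tz lerDl ltW// divr_gt0.
have yd : y <= t + d / 4 by rewrite /y ge_min lexx orbT.
have Sy : S y by apply: (Hd x) => //; lra.
have yt' : y <= t by apply: sup_upper_bound => //; split => //; rewrite (le_trans t0 yt).
suff -> : z = y by [].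
apply/eqP; rewrite eq_le yz andbT leNgt; apply/negP => ylt.
move: ylt; rewrite /y; case: (leP z (t + d / 4)) => h; rewrite ?ltxx// => _.
by move: yt'; rewrite /y; case: (leP z (t + d / 4)) h => //; lra.
Qed.

(** Outer regularity of Lebesgue measure, with the two end points added to the
null set. *)
Lemma null_open_cover (P : R -> Prop) T d : 0 < d -> {ae leb, forall t, P t} ->
  exists U : set R, [/\ open U, U 0, U T, (forall t, ~ P t -> U t) & (leb U < d%:E)%E].
Proof.
move=> d0 [A [mA A0 sA]].
pose D := A `|` ([set 0] `|` [set T]).
have m01 (x : R) : measurable [set x] by exact: measurable_set1.
have mD : measurable D by apply: measurableU => //; apply: measurableU.
have D0 : leb D = 0%E.
  rewrite measureU0//; first exact: measurableU.
  by rewrite measureU0//; exact: lebesgue_measure_set1.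
have Doo : (leb D < +oo)%E by rewrite D0.
have [U [oU DU Ud]] := lebesgue_regularity_outer mD Doo d0.
exists U; split => //.
- by apply: DU; right; left.
- by apply: DU; right; right.
- by move=> t Pt; apply: DU; left; exact: sA.
- have mU : measurable U by exact: open_measurable.
  rewrite (_ : U = (U `\` D) `|` D); last by rewrite setUC setDUK.
  by rewrite measureU0//; exact: measurableD.
Qed.

(** A finite disjoint family of intervals inside U and to the left of z, as in
the definition of absolute continuity. *)
Definition subfam (U : set R) z N (x y : nat -> R) :=
  (forall i, (i < N)%N -> [/\ 0 <= x i, x i <= y i, y i <= z & `]x i, y i[ `<=` U]) /\
  trivIset `I_N (fun i => `]x i, y i[%classic).

Lemma subfam_length (U : set R) z N x y d : open U -> (leb U < d%:E)%E -> subfam U z N x y ->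
  \sum_(i < N) (y i - x i) < d.
Proof.
move=> oU Ud [H tI]; rewrite -lte_fin; apply: le_lt_trans Ud.
have mI (i : nat) : measurable (`]x i, y i[%classic : set R) by exact: measurable_itv.
have mB : measurable (\big[setU/set0]_(i < N) (`]x i, y i[%classic : set R)).
  by apply: bigsetU_measurable.
apply: (@le_trans _ _ (leb (\big[setU/set0]_(i < N) (`]x i, y i[%classic : set R)))); last first.
  apply: le_measure; rewrite ?inE//; first exact: open_measurable.
  rewrite -(bigcup_mkord N (fun i => `]x i, y i[%classic)) => t [i /= iN ti]; have [_ _ _] := H i iN; exact.
rewrite (@measure_semi_additive_ord_I _ _ _ leb (fun i => `]x i, y i[%classic : set R))//.
rewrite -sumEFin; apply: lee_sum => i _.
have [_ xy _ _] := H i (ltn_ord i).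
rewrite [leRHS](lebesgue_measure_itv `]x i, y i[) /= lte_fin.
move: xy; rewrite le_eqVlt => /predU1P[->|xy]; first by rewrite subrr ltxx.
by rewrite xy -EFinD.
Qed.

Lemma subfam_mono (U : set R) z z' N x y : z <= z' -> subfam U z N x y -> subfam U z' N x y.
Proof.
move=> zz [H tI]; split => // i iN; have [h1 h2 h3 h4] := H i iN.
by split => //; exact: le_trans h3 zz.
Qed.

Lemma subfam_rcons (U : set R) a b N x y : 0 <= a -> a <= b -> `]a, b[ `<=` U ->
  subfam U a N x y ->
  subfam U b N.+1 (fun i => if (i < N)%N then x i else a) (fun i => if (i < N)%N then y i else b).
Proof.
move=> a0 ab abU [H tI]; split.
  move=> i; rewrite ltnS => iN; case: ltnP => iN'; last by split.
  by have [h1 h2 h3 h4] := H i iN'; split => //; exact: le_trans h3 ab.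
move=> i j /=; rewrite !ltnS => iN jN [t].
case: (ltnP i N) => iN'; case: (ltnP j N) => jN'.
- by move=> tt; apply: tI => //; exists t.
- move=> [] /=; rewrite !in_itv/= => /andP[_ h1] /andP[h2 _].
  by have [_ _ h3 _] := H i iN'; have := lt_trans h2 (lt_le_trans h1 h3); rewrite ltxx.
- move=> [] /=; rewrite !in_itv/= => /andP[h2 _] /andP[_ h1].
  by have [_ _ h3 _] := H j jN'; have := lt_trans h2 (lt_le_trans h1 h3); rewrite ltxx.
- by move=> _; apply/eqP; rewrite eqn_leq (leq_trans iN jN') (leq_trans jN iN').
Qed.

(** Cover the exceptional null set by an open set U of small measure and move
from 0 to z: across points of U the increment of g is recorded by an interval
contained in U, and across the other points it is at most e times the length.
The recorded increments add up to less than e by absolute continuity. *)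
Lemma ac_zero_derivative g T : abs_continuous 0 T g ->
  {ae leb, forall t, 0 < t < T -> is_derive t 1 g 0} ->
  forall z, 0 <= z <= T -> g z = g 0.
Proof.
move=> ac ae z /andP[z0 zT].
apply/eqP; rewrite -subr_eq0 -normr_eq0; apply/eqP/le_eps_eq0; first exact: normr_ge0.
move=> e0' e0'0.
pose e := e0' / (1 + z); have e0 : 0 < e by rewrite divr_gt0// ltr_pwDl.
have [d d0 Hd] := ac e e0.
have [U [oU U0 UT HU Ud]] := null_open_cover T d0 ae.
have [N [x [y [fam le]]]] : exists N x y, subfam U z N x y /\
   `|g z - g 0| <= \sum_(i < N) `|g (y i) - g (x i)| + e * z.
  apply: (@interval_induction (fun z => exists N x y, subfam U z N x y /\
   `|g z - g 0| <= \sum_(i < N) `|g (y i) - g (x i)| + e * z)) => //.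
    exists 0%N, (fun=> 0), (fun=> 0); split; last by rewrite big_ord0 subrr normr0 mulr0 addr0.
    by split => // i j.
  move=> t /andP[t0 tz].
  have [Ut|nUt] := pselect (U t).
    have [d' /= d'0 Hd'] := oU t Ut.
    exists d' => // a b a0 at' tb bz bad [N [x [y [fam le]]]].
    have ab := le_trans at' tb.
    exists N.+1; eexists; eexists; split.
      apply: (@subfam_rcons U a b N x y) => // r /=; rewrite in_itv/= => /andP[ar rb].
      by apply: Hd'; rewrite /= ltr_norml; apply/andP; split; lra.
    rewrite big_ord_recr/= ltnn.
    under eq_bigr do rewrite ltn_ord.
    rewrite (_ : g b - g 0 = (g a - g 0) + (g b - g a)); last by ring.
    apply: le_trans (ler_normD _ _) _.
    have : e * a <= e * b by rewrite ler_wpM2l// ltW.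
    lra.
  have t0T : 0 < t < T.
    rewrite !lt_neqAle t0 (le_trans tz zT) !andbT; apply/andP; split; apply/eqP => E.
      by apply: nUt; rewrite -E.
    by apply: nUt; rewrite E.
  have Dg : is_derive t 1 g 0 by apply: contrapT => n; apply: nUt; apply: HU => /(_ t0T).
  have [d' d'0 Hd'] : exists2 d', 0 < d' & forall r, `|r - t| < d' -> `|g r - g t| <= e * `|r - t|.
    have [D1 D2] := Dg.
    have : (fun h : R => h^-1 *: (g (h *: (1 : R) + t) - g t)) @ 0^' --> (0 : R).
      by rewrite -[X in _ --> X]D2; exact: D1.
    move=> /cvgr0_norm_le/(_ _ e0)[d' /= d'0 H]; exists d' => // r rd.
    have [->|rt] := eqVneq r t; first by rewrite !subrr normr0 mulr0.
    have rt0 : r - t != 0 by rewrite subr_eq0.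
    have rd' : ball_ [eta Num.Def.normr] 0 d' (r - t) by rewrite /= sub0r normrN.
    have := H (r - t) rd' rt0.
    rewrite /= /GRing.scale/= mulr1 subrK normrM normfV ler_pdivrMl ?normr_gt0//.
    by rewrite mulrC.
  exists d' => // a b a0 at' tb bz bad [N [x [y [fam le]]]].
  have ab := le_trans at' tb.
  exists N, x, y; split; first exact: subfam_mono fam.
  rewrite (_ : g b - g 0 = (g a - g 0) + ((g b - g t) - (g a - g t))); last by ring.
  apply: le_trans (ler_normD _ _) _.
  have h := ler_normB (g b - g t) (g a - g t).
  have h1 : `|g b - g t| <= e * (b - t).
    by have := Hd' b; rewrite ger0_norm ?subr_ge0//; apply; lra.
  have h2 : `|g a - g t| <= e * (t - a).
    by have := Hd' a; rewrite ler0_norm ?subr_le0// opprB; apply; lra.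
  lra.
have S : \sum_(i < N) `|g (y i) - g (x i)| < e.
  apply: Hd; last exact: subfam_length Ud fam.
    by move=> i iN; have [h1 h2 h3 _] := fam.1 i iN; split => //; exact: le_trans h3 zT.
  exact: fam.2.
rewrite (_ : e0' = e + e * z); first by apply: le_trans le _; rewrite lerD2r ltW.
by rewrite /e; field; rewrite gt_eqF// ltr_pwDl.
Qed.

Lemma lipschitz_ac g T L : 0 <= L ->
  (forall x y, 0 <= x -> x <= y -> y <= T -> `|g y - g x| <= L * (y - x)) -> abs_continuous 0 T g.
Proof.
move=> L0 H e e0; exists (e / (L + 1)); first by rewrite divr_gt0// ltr_wpDl.
move=> N x y xy _ S; apply: (@le_lt_trans _ _ (L * \sum_(i < N) (y i - x i))).
  rewrite mulr_sumr; apply: ler_sum => i _.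
  by have [h1 h2 h3] := xy i (ltn_ord i); exact: H.
apply: (@le_lt_trans _ _ ((L + 1) * \sum_(i < N) (y i - x i))).
  rewrite ler_wpM2r ?lerDl// sumr_ge0// => i _.
  by have [h1 h2 h3] := xy i (ltn_ord i); rewrite subr_ge0.
by rewrite mulrC -ltr_pdivlMr// ltr_wpDl.
Qed.

Lemma abs_continuousB g h T : abs_continuous 0 T g -> abs_continuous 0 T h ->
  abs_continuous 0 T (fun t => g t - h t).
Proof.
move=> ag ah e e0; have e2 : 0 < e / 2 by rewrite divr_gt0.
have [d1 d10 H1] := ag _ e2; have [d2 d20 H2] := ah _ e2.
exists (Num.min d1 d2); first by rewrite lt_min d10.
move=> N x y xy tI; rewrite lt_min => /andP[S1 S2].
have K1 := H1 N x y xy tI S1; have K2 := H2 N x y xy tI S2.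
rewrite [e]splitr; apply: le_lt_trans (ltrD K1 K2).
rewrite -big_split; apply: ler_sum => i _ /=.
rewrite (_ : g (y i) - h (y i) - _ = (g (y i) - g (x i)) - (h (y i) - h (x i))); last by ring.
exact: ler_normB.
Qed.

Lemma isd_lipschitz (H h : R -> R) (T L : R) : (forall t : R, is_derive t 1 H (h t)) ->
  (forall t, 0 <= t <= T -> `|h t| <= L) ->
  forall x y, 0 <= x -> x <= y -> y <= T -> `|H y - H x| <= L * (y - x).
Proof.
move=> DH hL x y x0; rewrite le_eqVlt => /predU1P[->|xy] yT.
  by rewrite !subrr normr0 mulr0.
have [r [/andP[xr ry] ->]] := MVT_isd xy (fun r _ => DH r) (isd_within (f := h) (fun r _ => DH r)).
rewrite normrM (gtr0_norm (_ : 0 < y - x)) ?subr_gt0//.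
by rewrite ler_wpM2r ?subr_ge0 ?(ltW xy)// hL//; apply/andP; split; lra.
Qed.

Lemma continuous_bounded (h : R -> R) T : 0 <= T -> continuous h ->
  exists2 L, 0 <= L & forall t, 0 <= t <= T -> `|h t| <= L.
Proof.
move=> T0 ch.
have cw : {within `[0, T], continuous (fun t => `|h t|)}.
  by apply: continuous_subspaceT => t; apply: cvg_norm; exact: ch.
have [c _ Hc] := EVT_max T0 cw.
by exists `|h c| => // t t0T; apply: Hc; rewrite in_itv.
Qed.

(** For an absolutely continuous function, an almost everywhere derivative that
is continuous is the derivative everywhere: subtract a primitive and apply
[ac_zero_derivative]. *)
Lemma ac_derivative g h T : 0 <= T -> abs_continuous 0 T g -> continuous h ->
  {ae leb, forall t, 0 < t < T -> is_derive t 1 g (h t)} ->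
  (forall t, 0 < t < T -> is_derive t 1 g (h t)) /\ {within `[0, T], continuous g}.
Proof.
move=> T0 ag ch D.
have [H DH] := antiderivative ch.
have [L L0 hL] := continuous_bounded T0 ch.
have aH : abs_continuous 0 T H by exact: lipschitz_ac L0 (isd_lipschitz DH hL).
have E z : 0 <= z <= T -> g z - H z = g 0 - H 0.
  apply: (ac_zero_derivative (abs_continuousB ag aH)).
  have [A [mA A0 sA]] := D; exists A; split => //.
  apply: subset_trans sA => t /= n1 n2; apply: n1 => t0T.
  by apply: (isd_eq (isdB (n2 t0T) (DH t))); rewrite subrr.
have E' z : 0 <= z <= T -> H z + (g 0 - H 0) = g z by move=> /E <-; ring.
have DH' (t : R) : is_derive t 1 (fun z => H z + (g 0 - H 0)) (h t).
  by apply: (isd_eq (isdD (DH t) (isd_cst (g 0 - H 0) t))); rewrite addr0.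
split.
  move=> t /andP[t0 tT].
  apply: isd_near (DH' t); near=> z; apply: E'.
  by apply/andP; split; rewrite ltW//; near: z; [exact: lt_nbhsr|exact: lt_nbhsl].
have cG : {within `[0, T], continuous (fun z => H z + (g 0 - H 0))}.
  exact: (isd_within (f := h)).
apply: subspace_eq_continuous cG => z; rewrite inE/= in_itv/=; exact: E'.
Unshelve. all: by end_near. Qed.

End absolute_continuity.

Section limit_derivative.
Context (R : realType).

(** Pointwise limits of differentiable functions whose derivatives converge and
are equicontinuous at t may be differentiated at t: by the mean value theorem
the first order expansions hold uniformly in N. *)
Lemma limit_derivative (D_ d_ : nat -> R -> R) (D d : R -> R) (T : R) :
  (forall N t, 0 < t < T -> is_derive t 1 (D_ N) (d_ N t)) ->
  (forall t, 0 < t < T -> D_ N t @[N --> \oo] --> D t) ->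
  (forall t, 0 < t < T -> d_ N t @[N --> \oo] --> d t) ->
  (forall t e, 0 < t < T -> 0 < e -> exists2 del, 0 < del & forall N r, 0 < r < T -> `|r - t| < del ->
     `|d_ N r - d_ N t| <= e) ->
  forall t, 0 < t < T -> is_derive t 1 D (d t).
Proof.
move=> H cD cd eq t t0T; have /andP[t0 tT] := t0T.
apply: isd_eps => e e0.
have [del d0 Hd] := eq t e t0T e0.
exists (Num.min del (Num.min t (T - t))); first by rewrite !lt_min d0 t0 subr_gt0.
move=> h; rewrite !lt_min => /andP[h1 /andP[h2 h3]].
have th r : `|r - t| <= `|h| -> 0 < r < T.
  move=> rt; have := le_lt_trans rt h2; have := le_lt_trans rt h3; rewrite !ltr_norml => /andP[k1 k2] /andP[k3 k4].
  by apply/andP; split; lra.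
have th0 : 0 < t + h < T by apply: th; rewrite addrAC subrr add0r.
have cvN : `|D_ N (t + h) - D_ N t - d_ N t * h| @[N --> \oo] --> `|D (t + h) - D t - d t * h|.
  apply: cvg_norm; apply: cvgB; first by apply: cvgB; exact: cD.
  by apply: cvgM; [exact: cd|exact: cvg_cst].
rewrite -(cvg_lim (@Rhausdorff R) cvN); apply: limr_le; first by apply/cvg_ex; eexists; exact: cvN.
apply: nearW => N.
have key x y r : x < y -> (forall z, x <= z <= y -> `|z - t| <= `|h|) -> r = y - x ->
    `|D_ N y - D_ N x - d_ N t * r| <= e * `|r|.
  move=> xy Hz ->.
  have [z [/andP[xz zy] ->]] := MVT_isd xy (fun z Hx => H N z (th z (Hz z (ltac:(case/andP: Hx => *; rewrite !ltW//)))))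
    (isd_within (f := d_ N) (fun z Hx => H N z (th z (Hz z Hx)))).
  rewrite -mulrBl normrM ler_wpM2r//.
  have zt : `|z - t| <= `|h| by apply: Hz; rewrite !ltW.
  by apply: Hd; [exact: th|exact: le_lt_trans zt h1].
case: (ltgtP 0 h) => hs.
- apply: key; [lra| |by ring] => z /andP[z1 z2].
  by rewrite (gtr0_norm hs) ger0_norm; lra.
- have := key (t + h) t (- h); rewrite normrN.
  rewrite -[X in _ -> _ -> _ -> (X <= _)]normrN (_ : - (D_ N t - D_ N (t + h) - d_ N t * - h) = D_ N (t + h) - D_ N t - d_ N t * h); last by ring.
  apply; [lra| |by ring] => z /andP[z1 z2].
  by rewrite (ltr0_norm hs) ler0_norm; lra.
- by rewrite -hs addr0 subrr mulr0 subrr normr0 mulr0.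
Qed.

End limit_derivative.

(** * The damping term with a truncated coefficient *)

Section synthesis.
Context (R : realType).
Local Notation mu := (@muO R).
Implicit Types (g h p q : R -> R) (a b c d : nat -> R) (s : nat) (A B D E K : R).

Definition syn c : R -> R := xget 0 [set g | L2 g /\ cf g = c].

Lemma synP s c B : bd s c B -> L2 (syn c) /\ cf (syn c) = c.
Proof.
move=> /(bd_anti (leq0n s)) /syn_exists[g [[Lg _] gc]].
by rewrite /syn; case: xgetP => [x -> //|/(_ g)] H; case: H.
Qed.

Lemma syn_cf g : L2 g -> {ae mu, forall x, syn (cf g) x = g x}.
Proof. by move=> Lg; have [L1 E] := synP (cf_bessel Lg); apply: cf_inj. Qed.

Lemma syn_sup c B : bd 1 c B -> {ae mu, forall x, syn c x ^+ 2 <= B}.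
Proof. by move=> cB; have [L E] := synP cB; apply: sup_bound => //; rewrite E. Qed.

Lemma synB s a c B D : bd s a B -> bd s c D ->
  {ae mu, forall x, syn (fun k => a k - c k) x = syn a x - syn c x}.
Proof.
move=> aB cD; have [La Ea] := synP aB; have [Lc Ec] := synP cD.
have -> : (fun k => a k - c k) = cf (syn a - syn c).
  by apply/funext => k; rewrite cfB// Ea Ec.
by apply: syn_cf; exact: L2B.
Qed.

Lemma L2_ae g h : measurable_fun setT g -> L2 h -> {ae mu, forall x, g x = h x} -> L2 g.
Proof.
by move=> mg Lh gh; have [] := @le_ip0_ae R g h mg Lh; first by apply: aeOS gh => x ->.
Qed.

Definition mulcf p c := cf (fun x => p x * syn c x).

Lemma mulcf_ae s p q c B : measurable_fun setT p -> measurable_fun setT q -> bd s c B ->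
  L2 (fun x => q x * syn c x) -> {ae mu, forall x, p x = q x} -> mulcf p c = mulcf q c.
Proof.
move=> mp mq cB Lq pq; have [Lc _] := synP cB.
have E : {ae mu, forall x, p x * syn c x = q x * syn c x} by apply: aeOS pq => x ->.
apply: (cf_ae _ _ E) => //; apply: (L2_ae _ _ E) => //.
by apply: measurable_funM => //; exact: L2_meas.
Qed.

Lemma mulcf_sub s p b d B D : measurable_fun setT p -> bd s b B -> bd s d D ->
  L2 (fun x => p x * syn b x) -> L2 (fun x => p x * syn d x) ->
  mulcf p (fun k => b k - d k) = fun k => mulcf p b k - mulcf p d k.
Proof.
move=> mp bB dD Lb Ld; have [Ls _] := synP (bdB bB dD).
have E : {ae mu, forall x, p x * syn (fun k => b k - d k) x =
    ((fun x => p x * syn b x) - (fun x => p x * syn d x)) x}.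
  by apply: aeOS (synB bB dD) => x /= ->; rewrite mulrBr.
transitivity (cf ((fun x => p x * syn b x) - (fun x => p x * syn d x))).
  apply: (cf_ae _ _ E); last exact: L2B.
  apply: (L2_ae _ _ E); last exact: L2B.
  by apply: measurable_funM => //; exact: L2_meas.
by apply/funext => k; rewrite cfB.
Qed.

Lemma mulcf_L2 p b K B : measurable_fun setT p -> {ae mu, forall x, p x ^+ 2 <= K} -> 0 <= K ->
  bd 0 b B -> L2 (fun x => p x * syn b x) /\
  ip0 (fun x => p x * syn b x) (fun x => p x * syn b x) <= K * B.
Proof.
move=> mp pK K0 bB; have [Lb Eb] := synP bB.
have [L1 L2] := L2_aebound mp Lb pK; split => //; apply: le_trans L2 _.
by rewrite ler_wpM2l// parseval_le// Eb.
Qed.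

Lemma mulcf_bd p b K B : measurable_fun setT p -> {ae mu, forall x, p x ^+ 2 <= K} -> 0 <= K ->
  bd 0 b B -> bd 0 (mulcf p b) (K * B).
Proof.
move=> mp pK K0 bB; have [L1 L2] := mulcf_L2 mp pK K0 bB.
exact: bd_le (cf_bessel L1) L2.
Qed.

(** p b - q d = p (b - d) + (p - q) d. *)
Lemma mulcf_diff p q b d K E B D : measurable_fun setT p -> measurable_fun setT q ->
  {ae mu, forall x, p x ^+ 2 <= K} -> {ae mu, forall x, q x ^+ 2 <= K} ->
  {ae mu, forall x, (p x - q x) ^+ 2 <= E} -> 0 <= K -> 0 <= E ->
  bd 0 b B -> bd 0 d B -> bd 0 (fun k => b k - d k) D ->
  bd 0 (fun k => mulcf p b k - mulcf q d k) (2 * (K * D) + 2 * (E * B)).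
Proof.
move=> mp mq pK qK pqE K0 E0 bB dB bD.
have [Lpb _] := mulcf_L2 mp pK K0 bB; have [Lpd _] := mulcf_L2 mp pK K0 dB.
have [Lqd _] := mulcf_L2 mq qK K0 dB.
have mpq : measurable_fun setT (fun x => p x - q x) by exact: measurable_funB.
have H1 := mulcf_bd mp pK K0 bD; have H2 := mulcf_bd mpq pqE E0 dB.
have := bdD H1 H2; rewrite (mulcf_sub mp bB dB Lpb Lpd).
congr (bd _ _ _); apply/funext => k.
rewrite (_ : mulcf (fun x => p x - q x) d k = mulcf p d k - mulcf q d k); first by ring.
rewrite /mulcf -cfB//; congr (cf _ k); apply/funext => x /=; by rewrite mulrBl.
Qed.

End synthesis.

Section clipping.
Context (R : realType).
Implicit Types (x y M : R).

Definition clip M x : R := Num.max (- M) (Num.min M x).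

Lemma clip_abs M x : 0 <= M -> `|clip M x| <= M.
Proof.
move=> M0; rewrite /clip ler_norml; apply/andP; split; first by rewrite le_max lexx.
by rewrite ge_max ge_min lexx andbT; lra.
Qed.

Lemma clip_id M x : `|x| <= M -> clip M x = x.
Proof. by rewrite ler_norml => /andP[h1 h2]; rewrite /clip min_r// max_r. Qed.

Lemma clip_lip M x y : 0 <= M -> `|clip M x - clip M y| <= `|x - y|.
Proof.
rewrite /clip /Num.max /Num.min => M0.
have := ler_norm (x - y); have := ler_norm (- (x - y)); rewrite normrN => n1 n2.
set u := if M < x then M else x; set v := if M < y then M else y.
have uE : u = if M < x then M else x by [].
have vE : v = if M < y then M else y by [].
clearbody u v; move: uE vE.
case: (ltP M x) => h1; case: (ltP M y) => h2; move=> uE vE;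
  case: (ltP (-M) u) => h3; case: (ltP (-M) v) => h4;
  rewrite ler_norml; apply/andP; split; lra.
Qed.

Lemma pow_lip M n : 0 <= M -> exists2 L, 0 <= L & forall x y, `|x| <= M -> `|y| <= M ->
  `|x ^+ n - y ^+ n| <= L * `|x - y|.
Proof.
move=> M0; elim: n => [|n [L L0 IH]].
  by exists 0 => // x y _ _; rewrite !expr0 subrr normr0 mul0r.
exists (M * L + M ^+ n); first by rewrite addr_ge0 ?mulr_ge0 ?exprn_ge0.
move=> x y xM yM; rewrite !exprS (_ : _ - _ = x * (x ^+ n - y ^+ n) + (x - y) * y ^+ n); last by ring.
apply: le_trans (ler_normD _ _) _; rewrite !normrM mulrDl; apply: lerD.
  by rewrite -mulrA ler_pM// IH.
by rewrite mulrC ler_wpM2r// normrX lerXn2r// nnegrE.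
Qed.

Definition trunc_power (alpha : R) m M x := alpha * clip M x ^+ (2 * m).

Lemma trunc_power_ge0 alpha m M x : 0 <= alpha -> 0 <= trunc_power alpha m M x.
Proof. by move=> a0; rewrite /trunc_power exprM mulr_ge0// exprn_ge0// sqr_ge0. Qed.

Lemma trunc_power_bd alpha m M x : 0 <= M -> trunc_power alpha m M x ^+ 2 <= (alpha * M ^+ (2 * m)) ^+ 2.
Proof.
move=> M0; rewrite /trunc_power !exprMn ler_wpM2l ?sqr_ge0//.
rewrite ler_sqr ?nnegrE ?(exprn_ge0 _ M0)//; last by rewrite exprM exprn_ge0// sqr_ge0.
rewrite -[leLHS]ger0_norm; last by rewrite exprM exprn_ge0// sqr_ge0.
by rewrite normrX lerXn2r ?nnegrE// clip_abs.
Qed.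

Lemma trunc_power_lip alpha m M : 0 <= M -> exists2 L, 0 <= L & forall x y,
  (trunc_power alpha m M x - trunc_power alpha m M y) ^+ 2 <= L * (x - y) ^+ 2.
Proof.
move=> M0; have [L L0 H] := pow_lip (2 * m) M0.
exists ((alpha * L) ^+ 2); first exact: sqr_ge0.
move=> x y; rewrite /trunc_power -mulrBr exprMn (_ : (alpha * L) ^+ 2 * (x - y) ^+ 2 = alpha ^+ 2 * (L * (x - y)) ^+ 2); last by ring.
apply: (ler_wpM2l (sqr_ge0 _)).
rewrite -[leLHS]real_normK ?num_real// -[leRHS]real_normK ?num_real//.
rewrite ler_sqr ?nnegrE// normrM (ger0_norm L0).
apply: le_trans (H _ _ (clip_abs _ M0) (clip_abs _ M0)) _.
by rewrite ler_wpM2l// clip_lip.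
Qed.

Lemma trunc_power_id alpha m M x : `|x| <= M -> trunc_power alpha m M x = alpha * x ^+ (2 * m).
Proof. by move=> xM; rewrite /trunc_power clip_id. Qed.

Lemma measurable_trunc_power alpha m M (g : R -> R) : measurable_fun setT g ->
  measurable_fun setT (fun x => trunc_power alpha m M (g x)).
Proof.
move=> mg; apply: measurable_funM; first exact: measurable_cst.
apply: measurable_funX; apply: measurable_maxr; first exact: measurable_cst.
by apply: measurable_minr => //; exact: measurable_cst.
Qed.

End clipping.

Section truncated_problem.
Context (R : realType).
Local Notation mu := (@muO R).
Variables (alpha : R) (m : nat) (M T : R).
Hypotheses (alpha0 : 0 <= alpha) (M0 : 0 <= M) (T0 : 0 < T).
Implicit Types (a b c d : nat -> R) (B D t : R) (k N : nat).

Definition trunc_damping (t : R) a b := mulcf (fun x => trunc_power alpha m M (syn a x)) b.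

Let K := (alpha * M ^+ (2 * m)) ^+ 2.

Let K0 : 0 <= K. Proof. exact: sqr_ge0. Qed.

Let mpw a s B : bd s a B -> measurable_fun setT (fun x => trunc_power alpha m M (syn a x)).
Proof. by move=> /synP[L _]; apply: measurable_trunc_power; exact: L2_meas. Qed.

Let pwK a : {ae mu, forall x, trunc_power alpha m M (syn a x) ^+ 2 <= K}.
Proof. by apply: aeOT => x; exact: trunc_power_bd. Qed.

Lemma trunc_damping_growth : linear_growth 0 T trunc_damping.
Proof.
exists K => // t a b B _ H.
by apply: mulcf_bd (bdEr H) => //; exact: mpw (bdEl H).
Qed.

Lemma trunc_damping_time : time_continuous 0 T trunc_damping.
Proof.
move=> B e e0; exists 1 => // t r a b _ _ _ _; apply: (bd_le _ (ltW e0)).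
by rewrite /trunc_damping; under [X in bd _ X _]eq_fun do rewrite subrr; exact: bd0.
Qed.

(** The distance of two states in the domain of A^{1/2} bounds the maximum of
their difference, by [sup_bound]; so the coefficients differ uniformly. *)
Lemma trunc_damping_lip : lipschitz_on_bounded 0 T trunc_damping.
Proof.
move=> B; have [L L0 HL] := trunc_power_lip alpha m M0.
case: (pselect (0 <= B)) => B0; last by exists 0 => // t a b c d D _ /bdE_ge0.
exists (2 * K + 2 * (L * B)); first by apply: addr_ge0; apply: mulr_ge0 => //; exact: mulr_ge0.
move=> t a b c d D _ ab cd abcd.
have D0 := bdE_ge0 abcd.
rewrite (_ : (2 * K + 2 * (L * B)) * D = 2 * (K * D) + 2 * (L * D * B)); last by ring.
apply: mulcf_diff (bdEr ab) (bdEr cd) (bdEr abcd) => //.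
- exact: mpw (bdEl ab).
- exact: mpw (bdEl cd).
- apply: aeOS2 (syn_sup (bdEl abcd)) (synB (bdEl ab) (bdEl cd)) => x h1 h2.
  by apply: le_trans (HL _ _) _; rewrite ler_wpM2l// -h2.
- by rewrite mulr_ge0.
Qed.

(** Cauchy-Schwarz for a difference of pairings, with bounds independent of the
number of modes; it is the source of all equicontinuity statements. *)
Lemma pairing_diff (x y x' y' : nat -> R) B B' D D' N : ssq x B -> ssq y' B' ->
  ssq (fun k => x k - x' k) D -> ssq (fun k => y k - y' k) D' ->
  `|\sum_(k < N) x k * y k - \sum_(k < N) x' k * y' k| <= Num.sqrt (B * D') + Num.sqrt (D * B').
Proof.
move=> xB yB' xD yD'.
rewrite -sumrB (_ : \sum_(k < N) _ = \sum_(0 <= k < N) x k * (y k - y' k) + \sum_(0 <= k < N) (x k - x' k) * y' k); last first.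
  by rewrite !big_mkord -big_split; apply: eq_bigr => k _ /=; ring.
have W u A : u ^+ 2 <= A -> `|u| <= Num.sqrt A.
  by move=> H; rewrite -sqrtr_sqr ler_wsqrtr.
by apply: le_trans (ler_normD _ _) _; apply: lerD; apply: W; exact: ssq_CS.
Qed.

Section energy_decay.
Variables (a b : R -> nat -> R) (Q B0 : R).
Let g t := trunc_damping (clamp T t) (a (clamp T t)) (b (clamp T t)).
Hypothesis D : forall (t : R) k, is_derive t 1 (fun r => a r k) (b t k) /\
    is_derive t 1 (fun r => b r k) (- om k ^+ 2 * a t k - g t k).
Hypothesis abQ : forall t, 0 <= t <= T -> bdE 0 (a t) (b t) Q.
Hypothesis abu : ucont 0 T a b.
Hypothesis ab0 : bdE 0 (a 0) (b 0) B0.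

Let S N t := energy_sum 0 (a t) (b t) 0 N.
Let dS N t := - (2 * \sum_(0 <= k < N) (om k ^+ 0 * b t k) * (om k ^+ 0 * g t k)).

Let DS N (t : R) : is_derive t 1 (S N) (dS N t).
Proof.
apply: (@isd_eq _ _ _ (\sum_(0 <= k < N) (2 * (om k ^+ 1 * a t k) * (om k ^+ 1 * b t k) +
   2 * (om k ^+ 0 * b t k) * (om k ^+ 0 * (- om k ^+ 2 * a t k - g t k))))).
  apply: isd_sum => k _; have [Da Db] := D t k.
  exact: (isdD (isd_sqr (isdZ _ Da)) (isd_sqr (isdZ _ Db))).
rewrite /dS -mulrN -sumrN mulr_sumr; apply: eq_bigr => k _; rewrite expr1 expr0; ring.
Qed.

Let gQ t : 0 <= t <= T -> bd 0 (g t) (K * Q).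
Proof.
move=> t0T; rewrite /g clamp_id//; apply: mulcf_bd (bdEr (abQ t0T)) => //.
exact: mpw (bdEl (abQ t0T)).
Qed.

Let Q0 : 0 <= Q. Proof. exact: (bdE_ge0 (abQ (introT andP (conj (lexx 0) (ltW T0))))). Qed.

Let C := Q + K * Q.

Let dS_le N t : 0 <= t <= T -> dS N t <= C.
Proof.
move=> t0T; have h1 := bdEr (abQ t0T) N; have h2 := gQ t0T N.
rewrite /dS /C big_mkord; apply: le_trans (lerD h1 h2).
rewrite -big_split mulr_sumr -sumrN; apply: ler_sum => k _ /=.
have := sqr_ge0 (om k ^+ 0 * b t k + om k ^+ 0 * g t k); lra.
Qed.

(** Partial energies grow at most linearly, uniformly in the number of modes.
*)
Let S_lip N r t : 0 <= r -> r <= t -> t <= T -> S N t <= S N r + C * (t - r).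
Proof.
move=> r0 rt tT.
have Dz (x : R) : is_derive x 1 (fun x => C * x - S N x) (C * 1 - dS N x).
  exact: (isdB (isdZ C (isd_id x)) (DS N x)).
have := @le_of_deriv R _ _ r t rt (fun x _ => Dz x) (isd_within (f := fun x => C * 1 - dS N x) (fun x _ => Dz x)).
have H x : r < x < t -> 0 <= C * 1 - dS N x.
  move=> /andP[rx xt]; rewrite mulr1 subr_ge0; apply: dS_le; apply/andP; split; lra.
by move=> /(_ H); lra.
Qed.

Let S_mono t : nondecreasing_seq (fun N => S N t).
Proof.
apply/nondecreasing_seqP => N; rewrite /S /energy_sum big_nat_recr//= lerDl.
by rewrite addr_ge0 ?sqr_ge0.
Qed.

Let E t := lim (S N t @[N --> \oo]).

Let S_cvg t : 0 <= t <= T -> S N t @[N --> \oo] --> E t.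
Proof.
move=> t0T; apply: nondecreasing_is_cvgn; first exact: S_mono.
by exists Q => _ [N _ <-]; exact: abQ.
Qed.

Let S_le_E N t : 0 <= t <= T -> S N t <= E t.
Proof. by move=> t0T; apply: nondecreasing_cvgn_le; [exact: S_mono|exact/cvgP/S_cvg]. Qed.

Let E_le t B : 0 <= t <= T -> (forall N, S N t <= B) -> E t <= B.
Proof. by move=> t0T H; apply: limr_le; [exact/cvgP/S_cvg|exact: nearW]. Qed.

Let p t x := trunc_power alpha m M (syn (a t) x).

Let dE t := - (2 * ip0 (syn (b t)) (fun x => p t x * syn (b t) x)).

Let dE_le0 t : dE t <= 0.
Proof.
rewrite /dE oppr_le0 mulr_ge0//; apply: Rintegral_ge0 => x _.
by rewrite mulrCA -expr2 mulr_ge0 ?sqr_ge0// trunc_power_ge0.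
Qed.

Let dS_cvg t : 0 <= t <= T -> dS N t @[N --> \oo] --> dE t.
Proof.
move=> t0T; have [Lb Eb] := synP (bdEr (abQ t0T)).
have [Lp _] := mulcf_L2 (mpw (bdEl (abQ t0T))) (pwK _) K0 (bdEr (abQ t0T)).
rewrite /dS /dE; apply: cvgN; apply: cvgM; first exact: cvg_cst.
have := parseval Lb Lp; rewrite Eb.
apply: cvg_trans; apply: near_eq_cvg; apply: nearW => N; rewrite big_mkord.
by apply: eq_bigr => k _; rewrite !expr0 !mul1r /g clamp_id.
Qed.

Let gu : ucont1 0 T g.
Proof. by apply: (forcing_ucont (s := 0) (B := Q)) => //; [exact: trunc_damping_lip|exact: trunc_damping_time]. Qed.

Let dS_equi t e : 0 < t < T -> 0 < e -> exists2 del, 0 < del & forall N r, 0 < r < T ->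
  `|r - t| < del -> `|dS N r - dS N t| <= e.
Proof.
move=> /andP[t0 tT] e0.
pose B := Q + K * Q + 1; have KQ0 : 0 <= K * Q by exact: mulr_ge0.
have B1 : 0 < B by apply: ltr_wpDl => //; exact: addr_ge0.
have eta0 : 0 < (e / 4) ^+ 2 / B by rewrite divr_gt0// exprn_gt0// divr_gt0.
have [d1 d10 H1] := abu eta0; have [d2 d20 H2] := gu eta0.
exists (Num.min d1 d2); first by rewrite lt_min d10.
move=> N r /andP[r0 rT]; rewrite lt_min => /andP[h1 h2].
have t0T : 0 <= t <= T by rewrite !ltW.
have r0T : 0 <= r <= T by rewrite !ltW.
have K1 := bdEr (H1 _ _ r0T t0T h1); have K2 := H2 _ _ r0T t0T h2.
rewrite /bd in K1 K2.
rewrite (_ : (fun k => _) = (fun k => om k ^+ 0 * b r k - om k ^+ 0 * b t k)) in K1; last first.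
  by apply/funext => k; rewrite mulrBr.
rewrite (_ : (fun k => _) = (fun k => om k ^+ 0 * g r k - om k ^+ 0 * g t k)) in K2; last first.
  by apply/funext => k; rewrite mulrBr.
have bB t' : 0 <= t' <= T -> bd 0 (b t') B.
  move=> Ht; apply: bd_le (bdEr (abQ Ht)) _; rewrite /B -addrA lerDl; exact: addr_ge0.
have gB t' : 0 <= t' <= T -> bd 0 (g t') B.
  move=> Ht; apply: bd_le (gQ Ht) _; rewrite /B addrAC lerDr; exact: addr_ge0.
have := pairing_diff N (bB _ r0T) (gB _ t0T) K1 K2.
have -> : B * ((e / 4) ^+ 2 / B) = (e / 4) ^+ 2 by field; rewrite gt_eqF.
have -> : (e / 4) ^+ 2 / B * B = (e / 4) ^+ 2 by field; rewrite gt_eqF.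
rewrite sqrtr_sqr (@ger0_norm _ (e / 4)); last by rewrite divr_ge0// ltW.
move=> H.
have -> : dS N r - dS N t = - (2 * (\sum_(k < N) om k ^+ 0 * b r k * (om k ^+ 0 * g r k) -
  \sum_(k < N) om k ^+ 0 * b t k * (om k ^+ 0 * g t k))).
  rewrite /dS !big_mkord; ring.
by rewrite normrN normrM ger0_norm//; lra.
Qed.

(** The derivative of the total energy is - 2 (p u_t, u_t) with p >= 0. The
energy is the increasing limit of its partial sums; their derivatives are
equicontinuous, so [limit_derivative] applies at interior times. A bound on
these derivatives that is uniform in the number of modes gives the continuity
at the two end points. *)
Lemma energy_decay : forall t, 0 <= t <= T -> bdE 0 (a t) (b t) B0.
Proof.
have DE t : 0 < t < T -> is_derive t 1 E (dE t).
  move=> t0T; apply: (@limit_derivative R S dS E dE T (fun N r _ => DS N r)) => //.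
  - by move=> r /andP[r0 rT]; apply: S_cvg; rewrite !ltW.
  - by move=> r /andP[r0 rT]; apply: dS_cvg; rewrite !ltW.
have C0 : 0 <= C by apply: addr_ge0 => //; exact: mulr_ge0.
have EE r t : 0 < r -> r <= t -> t < T -> E t <= E r.
  move=> r0 rt tT.
  have DN x : r <= x <= t -> is_derive x 1 (fun x => - E x) (- dE x).
    by move=> /andP[rx xt]; apply: isdN; apply: DE; rewrite (lt_le_trans r0 rx) (le_lt_trans xt tT).
  have DN' x : r < x < t -> is_derive x 1 (fun x => - E x) (- dE x).
    by move=> /andP[rx xt]; apply: DN; rewrite !ltW.
  have := @le_of_deriv R _ _ r t rt DN' (isd_within (f := fun x => - dE x) DN).
  by rewrite lerN2; apply=> x _; rewrite oppr_ge0.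
have Er r : 0 <= r <= T -> E r <= B0 + C * r.
  move=> /andP[r0 rT]; apply: E_le => [|N]; first by rewrite r0.
  have := S_lip N (lexx 0) r0 rT; rewrite subr0; have := ab0 N; rewrite -/(S N 0); lra.
(* initial times r -> 0, since the equation only holds at interior times *)
have small x y : 0 < y -> (forall r, 0 < r -> r < y -> x <= B0 + C * r) -> x <= B0.
  move=> y0 H; apply/ler_addgt0Pr => e e0.
  pose r := Num.min (y / 2) (e / (C + 1)).
  have r0 : 0 < r by rewrite lt_min !divr_gt0// ltr_wpDl.
  have ry : r < y by rewrite gt_min; apply/orP; left; lra.
  apply: le_trans (H r r0 ry) _; rewrite lerD2l.
  have re : r <= e / (C + 1) by rewrite ge_min lexx orbT.
  apply: le_trans (ler_wpM2l C0 re) _.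
  by rewrite mulrCA ler_piMr ?(ltW e0)// ler_pdivrMr ?ltr_wpDl// mul1r lerDl.
have inside t N : 0 < t -> t < T -> S N t <= B0.
  move=> t0 tT; apply: (small _ t t0) => r r0 rt.
  apply: le_trans (S_le_E N _) _; first by rewrite !ltW.
  apply: le_trans (EE r t r0 (ltW rt) tT) _; apply: Er; rewrite !ltW//; exact: lt_trans tT.
move=> t /andP[t0 tT] N; rewrite -/(S N t).
move: t0; rewrite le_eqVlt => /predU1P[<-|t0]; first exact: ab0.
move: tT; rewrite le_eqVlt => /predU1P[->|tT]; last exact: inside.
apply: (small _ T T0) => r r0 rT.
have rT0 : 0 < T - r by rewrite subr_gt0.
have h : T - r < T by rewrite ltrBlDr ltrDl.
have := S_lip N (ltW rT0) (ltW h) (lexx T); have := inside (T - r) N rT0 h.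
rewrite opprB addrCA subrr addr0; lra.
Qed.

End energy_decay.

End truncated_problem.

(** * Solutions in coefficients at every regularity level *)

Section power_products.
Context (R : realType).
Local Notation mu := (@muO R).
Implicit Types (u v w : R -> R) (s m : nat) (A B D E : R).

(** Iterate [triple_product]: u^{2m+2} w = u (u (u^{2m} w)). *)
Lemma pow_product s m : (0 < s)%N -> exists2 C : R, 0 <= C & forall u w A D,
  L2 u -> L2 w -> bd s (cf u) A -> bd s (cf w) D ->
  L2 (fun x => u x ^+ (2 * m) * w x) /\
  bd s (cf (fun x => u x ^+ (2 * m) * w x)) (C * (A ^+ (2 * m) * D)).
Proof.
move=> s0; have [C3 C30 H3] := triple_product R s0.
elim: m => [|m [C C0 IH]].
  exists 1 => // u w A D Lu Lw uA wD.
  rewrite (_ : (fun x => _) = w); last by apply/funext => x; rewrite expr0 mul1r.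
  by rewrite expr0 !mul1r.
exists (C3 * C); first exact: mulr_ge0.
move=> u w A D Lu Lw uA wD; have [L H] := IH u w A D Lu Lw uA wD.
have [L' H'] := H3 _ _ _ _ _ _ Lu Lu L uA uA H.
rewrite (_ : (fun x => _) = (fun x => u x * (u x * (u x ^+ (2 * m) * w x)))); last first.
  by apply/funext => x; rewrite mulnS !exprS !mulrA.
split => //; apply: (bd_le H'); rewrite mulnS !exprS.
by rewrite le_eqVlt; apply/orP; left; apply/eqP; ring.
Qed.

(** Replace the factors of u^{2m} by those of v^{2m} two at a time; every term
is again a nested product of three factors. *)
Lemma pow_product_diff s m A : (0 < s)%N -> exists2 C : R, 0 <= C & forall u v w E D,
  L2 u -> L2 v -> L2 w -> bd s (cf u) A -> bd s (cf v) A -> bd s (cf (u - v)) E ->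
  bd s (cf w) D ->
  L2 (fun x => u x ^+ (2 * m) * w x - v x ^+ (2 * m) * w x) /\
  bd s (cf (fun x => u x ^+ (2 * m) * w x - v x ^+ (2 * m) * w x)) (C * (E * D)).
Proof.
move=> s0; have [C3 C30 H3] := triple_product R s0.
case: (pselect (0 <= A)) => A0; last first.
  by exists 0 => // u v w E D _ _ _ /bd_ge0.
elim: m => [|m [C C0 IH]].
  exists 0 => // u v w E D Lu Lv Lw uA vA uv wD.
  rewrite (_ : (fun x => _) = 0); last by apply/funext => x; rewrite !expr0 subrr.
  rewrite (_ : cf 0 = fun=> 0); last by apply/funext => k; exact: cf0.
  by rewrite mul0r; split; [exact: L20|exact: bd0].
have [C1 C10 H1] := pow_product m s0.
pose q : R := A ^+ (2 * m).
have q0 : 0 <= q by exact: exprn_ge0.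
exists (2 * (C3 * (A * (A * C))) + 2 * (2 * (C3 * (A * (C1 * q))) + 2 * (C3 * (A * (C1 * q))))).
  by rewrite ?(addr_ge0, mulr_ge0).
move=> u v w E D Lu Lv Lw uA vA uv wD.
have Luv := L2B Lu Lv.
have [L H] := IH u v w E D Lu Lv Lw uA vA uv wD.
have [Lz Hz] := H1 _ _ _ _ Lv Lw vA wD.
have [K1 K1'] := H3 _ _ _ _ _ _ Lu Lu L uA uA H.
have [K2 K2'] := H3 _ _ _ _ _ _ Lu Luv Lz uA uv Hz.
have [K3 K3'] := H3 _ _ _ _ _ _ Luv Lv Lz uv vA Hz.
pose f1 x := u x * (u x * (u x ^+ (2 * m) * w x - v x ^+ (2 * m) * w x)).
pose f2 x := u x * ((u - v) x * (v x ^+ (2 * m) * w x)).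
pose f3 x := (u - v) x * (v x * (v x ^+ (2 * m) * w x)).
have -> : (fun x => u x ^+ (2 * m.+1) * w x - v x ^+ (2 * m.+1) * w x) = f1 + (f2 + f3).
  apply/funext => x; rewrite mulnS !exprS /f1 /f2 /f3 !fctE; ring.
split; first by apply: L2D => //; exact: L2D.
have -> : cf (f1 + (f2 + f3)) = fun k => cf f1 k + (cf f2 k + cf f3 k).
  by apply/funext => k; rewrite cfD ?cfD//; exact: L2D.
apply: (bd_le (bdD K1' (bdD K2' K3'))).
by rewrite le_eqVlt; apply/orP; left; apply/eqP; rewrite -/q; ring.
Qed.

End power_products.

Section existence_all_levels.
Context (R : realType).
Local Notation mu := (@muO R).
Variables (alpha : R) (m : nat) (T : R).
Hypotheses (alpha0 : 0 <= alpha) (T0 : 0 < T).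
Implicit Types (a b c d : nat -> R) (B D t : R) (k N n : nat).

(** The coefficients of alpha u^{2m} u_t, where u has coefficients a and u_t
has coefficients b. *)
Definition damping a b := mulcf (fun x => alpha * syn a x ^+ (2 * m)) b.

(** A solution of the damped system with values and continuity at level n. The
forcing is frozen outside [0, T], so that the differential equations make sense
on the whole line. *)
Definition damped_sol n (a b : R -> nat -> R) := [/\
  (forall t k, is_derive t 1 (fun r => a r k) (b t k) /\
    is_derive t 1 (fun r => b r k) (- om k ^+ 2 * a t k - damping (a (clamp T t)) (b (clamp T t)) k)),
  exists Q, forall t, 0 <= t <= T -> bdE n (a t) (b t) Q & ucont n T a b].

Lemma measurable_damping_factor (u : R -> R) : measurable_fun setT u ->
  measurable_fun setT (fun x => alpha * u x ^+ (2 * m)).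
Proof.
by move=> mg; apply: measurable_funM; [exact: measurable_cst|exact: measurable_funX].
Qed.

Lemma damping_trunc (t : R) a b (M B : R) : 0 < M -> bd 1 a B -> B <= M ^+ 2 -> bd 0 b B ->
  L2 (fun x => alpha * syn a x ^+ (2 * m) * syn b x) /\ damping a b = trunc_damping alpha m M t a b.
Proof.
move=> M0 aB BM bB; have [La _] := synP aB; have [Lb _] := synP bB.
have E : {ae mu, forall x, alpha * syn a x ^+ (2 * m) = trunc_power alpha m M (syn a x)}.
  apply: aeOS (syn_sup aB) => x h; rewrite trunc_power_id//.
  by apply: sqr_le_norm => //; exact: le_trans BM.
have mp : measurable_fun setT (fun x => trunc_power alpha m M (syn a x)).
  by apply: measurable_trunc_power; exact: L2_meas.
have mf : measurable_fun setT (fun x => alpha * syn a x ^+ (2 * m)) by apply: measurable_damping_factor; exact: L2_meas.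
have [Lp _] := mulcf_L2 mp (aeOT (fun x => trunc_power_bd alpha m (syn a x) (ltW M0))) (sqr_ge0 _) bB.
split; last exact: mulcf_ae bB Lp E.
apply: (L2_ae _ Lp); first by apply: measurable_funM => //; exact: L2_meas.
by apply: aeOS E => x ->.
Qed.

(** The height M of truncation is chosen above the initial energy; by
[energy_decay] the solution of the truncated problem never reaches it. *)
Lemma existence_0 a0 b0 B0 : bdE 0 a0 b0 B0 ->
  exists a b : R -> nat -> R, [/\ a 0 = a0, b 0 = b0 & damped_sol 0 a b].
Proof.
move=> ab0; have B00 := bdE_ge0 ab0; pose M := B0 + 1.
have M0 : 0 < M by rewrite ltr_wpDl.
have MB : B0 <= M ^+ 2 by rewrite /M; nra.
have GL := trunc_damping_lip alpha m T (ltW M0); have [C C0 GC] := trunc_damping_growth alpha m T (ltW M0).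
have GT := trunc_damping_time alpha m M T.
have [a [b [[a00 b00] D [Q HQ] abu]]] := picard_exists T0 ab0 GL C0 GC GT.
exists a, b; split => //.
have dec t : 0 <= t <= T -> bdE 0 (a t) (b t) B0.
  by apply: (energy_decay alpha0 (ltW M0) T0 D HQ abu); rewrite a00 b00.
split => //; last by exists B0.
move=> t k; have [D1 D2] := D t k; split => //.
have H := dec _ (clamp_in T0 t).
by have [_ ->] := damping_trunc (clamp T t) M0 (bdEl H) MB (bdEr H).
Qed.

Section persistence.
Variables (n : nat) (a b : R -> nat -> R) (Q : R).
Hypothesis D : forall t k, is_derive t 1 (fun r => a r k) (b t k) /\
    is_derive t 1 (fun r => b r k) (- om k ^+ 2 * a t k - damping (a (clamp T t)) (b (clamp T t)) k).
Hypothesis abQ : forall t, 0 <= t <= T -> bdE n (a t) (b t) Q.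
Hypothesis abu : ucont n T a b.

Let Q0 : 0 <= Q. Proof. exact: (bdE_ge0 (abQ (introT andP (conj (lexx 0) (ltW T0))))). Qed.

(** The damping seen as a linear operator of the velocity, with a coefficient
given by the known solution. *)
Let Glin t (a' b' : nat -> R) := mulcf (fun x => alpha * syn (a t) x ^+ (2 * m)) b'.

Let aQ t : 0 <= t <= T -> bd n.+1 (a t) Q. Proof. by move=> /abQ/bdEl. Qed.

Let mw t : 0 <= t <= T -> measurable_fun setT (fun x => alpha * syn (a t) x ^+ (2 * m)).
Proof. by move=> /aQ/synP[L _]; apply: measurable_damping_factor; exact: L2_meas. Qed.

Let Glin_bd : exists2 C, 0 <= C & forall t b' B, 0 <= t <= T -> bd n.+1 b' B ->
  L2 (fun x => alpha * syn (a t) x ^+ (2 * m) * syn b' x) /\ bd n.+1 (Glin t b' b') (C * B).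
Proof.
have [C C0 H] := pow_product R m (ltn0Sn n).
exists (alpha ^+ 2 * (C * Q ^+ (2 * m))); first by rewrite !mulr_ge0 ?sqr_ge0// exprn_ge0.
move=> t b' B t0T bB; have [La Ea] := synP (aQ t0T); have [Lb Eb] := synP bB.
have := H _ _ Q B La Lb; rewrite Ea Eb => /(_ (aQ t0T) bB)[L HL].
rewrite /Glin /mulcf (_ : (fun x => _) = alpha *: (fun x => syn (a t) x ^+ (2 * m) * syn b' x)); last first.
  by apply/funext => x; rewrite -mulrA.
split; first exact: L2Z.
have := bdZ alpha HL; rewrite (_ : alpha ^+ 2 * _ * B = alpha ^+ 2 * (C * (Q ^+ (2 * m) * B))); last by ring.
by congr (bd _ _ _); apply/funext => k; rewrite cfZ.
Qed.

Let Glin_growth : linear_growth n.+1 T Glin.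
Proof.
have [C C0 H] := Glin_bd; exists C => // t a' b' B t0T ab.
by have [_] := H t b' B t0T (bdEr ab).
Qed.

Let Glin_lip : lipschitz_on_bounded n.+1 T Glin.
Proof.
move=> B; have [C C0 H] := Glin_bd; exists C => // t a1 b1 a2 b2 E t0T H1 H2 H12.
have [L1 _] := H t b1 B t0T (bdEr H1); have [L2 _] := H t b2 B t0T (bdEr H2).
rewrite -(mulcf_sub (mw t0T) (bdEr H1) (bdEr H2) L1 L2).
by have [_] := H t _ E t0T (bdEr H12).
Qed.

Let Glin_time : time_continuous n.+1 T Glin.
Proof.
move=> B e e0; have [C C0 H] := pow_product_diff m Q (ltn0Sn n).
(* B may be negative, in which case no (a', b') is concerned *)
pose c := alpha ^+ 2 * C * `|B| + 1.
have c0 : 0 < c by rewrite ltr_wpDl// !mulr_ge0// sqr_ge0.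
have [d d0 Hd] := abu (divr_gt0 e0 c0).
exists d => // t r a' b' t0T r0T tr ab.
have [La Ea] := synP (aQ t0T); have [Lr Er] := synP (aQ r0T); have [Lb Eb] := synP (bdEr ab).
have K1 := bdEl (Hd t r t0T r0T tr).
have := H _ _ _ (e / c) B La Lr Lb; rewrite Ea Er Eb (_ : cf (syn (a t) - syn (a r)) = fun k => a t k - a r k); last first.
  by apply/funext => k; rewrite cfB// Ea Er.
move=> /(_ (aQ t0T) (aQ r0T) K1 (bdEr ab))[L HL].
have [C' _ H'] := Glin_bd; have [Lt _] := H' t b' B t0T (bdEr ab); have [Lr' _] := H' r b' B r0T (bdEr ab).
have := bdZ alpha HL; rewrite (_ : (fun k => _) = fun k => Glin t a' b' k - Glin r a' b' k); last first.
  apply/funext => k; rewrite -cfZ// /Glin /mulcf -cfB//; congr (cf _ k); apply/funext => x.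
  by rewrite !fctE/= /GRing.scale/=; ring.
move=> HH; apply: (bd_le HH).
rewrite (_ : _ * _ = e / c * (alpha ^+ 2 * C * B)); last by ring.
rewrite mulrAC ler_pdivrMr// ler_wpM2l ?(ltW e0)// /c.
apply: (@le_trans _ _ (alpha ^+ 2 * C * `|B|)); last by rewrite lerDl.
by rewrite ler_wpM2l ?ler_norm// mulr_ge0// sqr_ge0.
Qed.

(** At level 0 a bound on the maximum of the coefficient suffices; this is
where the new solution is compared with the known one. *)
Let Glin_lip0 : lipschitz_on_bounded 0 T Glin.
Proof.
pose K := alpha ^+ 2 * Q ^+ (2 * m).
have K0 : 0 <= K by rewrite mulr_ge0 ?sqr_ge0 ?exprn_ge0.
move=> B; exists (2 * K); first exact: mulr_ge0.
move=> t a1 b1 a2 b2 E t0T H1 H2 H12.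
have pK : {ae mu, forall x, (alpha * syn (a t) x ^+ (2 * m)) ^+ 2 <= K}.
  apply: aeOS (syn_sup (bd_anti (ltn0Sn n) (aQ t0T))) => x h.
  rewrite exprMn -exprM mulnC exprM ler_wpM2l ?sqr_ge0// lerXn2r ?nnegrE ?sqr_ge0//.
have := mulcf_diff (mw t0T) (mw t0T) pK pK (aeOT (fun x => _)) K0 (lexx 0) (bdEr H1) (bdEr H2) (bdEr H12).
rewrite mul0r mulr0 addr0 mulrA; apply.
by move=> x; rewrite subrr expr0n.
Qed.

(** With u known at level n, its damping coefficient multiplies the domain of
A^{(n+1)/2} continuously. The linear problem is thus solvable at level n + 1,
and uniqueness at level 0 identifies its solution with u. *)
Lemma persistence B0 : bdE n.+1 (a 0) (b 0) B0 ->
  exists a' b' : R -> nat -> R, [/\ a' 0 = a 0, b' 0 = b 0 & damped_sol n.+1 a' b'].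
Proof.
move=> ab0; have [C C0 GC] := Glin_growth.
have [a' [b' [[a00 b00] D' [Q' HQ'] abu']]] := picard_exists T0 ab0 Glin_lip C0 GC Glin_time.
exists a', b'; split => //.
have E : forall t, 0 <= t <= T -> a t = a' t /\ b t = b' t.
  apply: (picard_unique (s := 0) (B := Num.max Q Q') T0 Glin_lip0) => //.
  - move=> t t0T k; have [D1 D2] := D t k; split => //.
    by move: D2; rewrite clamp_id//; case/andP: t0T => *; rewrite !ltW.
  - move=> t t0T k; have [D1 D2] := D' t k; split => //.
    by move: D2; rewrite clamp_id//; case/andP: t0T => *; rewrite !ltW.
  - exact: isd_contT D T.
  - exact: isd_contT D' T.
  - move=> t t0T; split.
      by apply: bdE_le (bdE_anti (leq0n n) (abQ t0T)) _; rewrite le_max lexx.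
    by apply: bdE_le (bdE_anti (leq0n n.+1) (HQ' t t0T)) _; rewrite le_max lexx orbT.
split => //; last by exists Q'.
move=> t k; have [D1 D2] := D' t k; split => //.
by move: D2; rewrite /Glin /damping; have [-> _] := E _ (clamp_in T0 t).
Qed.

End persistence.

Theorem existence_every_level n a0 b0 B0 : bdE n a0 b0 B0 ->
  exists a b : R -> nat -> R, [/\ a 0 = a0, b 0 = b0 & damped_sol n a b].
Proof.
elim: n B0 => [|n IH] B0 ab0; first exact: existence_0 ab0.
have [a [b [a00 b00 [D [Q HQ] abu]]]] := IH B0 (bdE_anti (leqnSn n) ab0).
by rewrite -a00 -b00 in ab0 *; exact: persistence D HQ abu B0 ab0.
Qed.

End existence_all_levels.

(** * Differentiability in time *)

Section time_classes.
Context (R : realType).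
Variable T : R.
Hypothesis T0 : 0 < T.
Implicit Types (c d : R -> nat -> R) (s j k N : nat) (t r e B D : R).

(** Continuity in time with values in the domain of A^{s/2}, for coefficient
sequences. *)
Definition contcf s c := forall t, 0 <= t <= T -> (exists B, bd s (c t) B) /\
  forall e, 0 < e -> exists2 del, 0 < del & forall r, 0 <= r <= T -> `|r - t| < del ->
    bd s (fun k => c r k - c t k) e.

(** The derivative in time in the norm of the domain of A^{s/2}, as a first
order expansion. *)
Definition dercf s c d := forall t e, 0 <= t <= T -> 0 < e ->
  exists2 del, 0 < del & forall r, 0 <= r <= T -> `|r - t| < del ->
    bd s (fun k => c r k - c t k - (r - t) * d t k) (e * (r - t) ^+ 2).

(** Trajectories of class C^j with values in the domain of A^{s/2}; derivatives
are unique by [dercf_uniq], so they need not be named. *)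
Fixpoint Ckcf s j c : Prop := match j with
  | 0 => contcf s c
  | j'.+1 => contcf s c /\ exists2 d, dercf s c d & Ckcf s j' d
  end.

Lemma Ckcf_contcf s j c : Ckcf s j c -> contcf s c.
Proof. by case: j => [//|j] []. Qed.

Lemma Ckcf_pred s j c : Ckcf s j.+1 c -> Ckcf s j c.
Proof.
elim: j c => [|j IH] c [H1 [d cd Hd]]; first exact: H1.
by split => //; exists d => //; exact: IH.
Qed.

Lemma dercf_ext s c c' d d' : (forall t, 0 <= t <= T -> c t = c' t) ->
  (forall t, 0 <= t <= T -> d t = d' t) -> dercf s c d -> dercf s c' d'.
Proof.
move=> cc dd H t e t0T e0; have [del d0 Hd] := H t e t0T e0; exists del => // r r0T rt.
by have := Hd r r0T rt; rewrite (cc _ t0T) (cc _ r0T) (dd _ t0T).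
Qed.

Lemma dercf_anti s s' c d : (s' <= s)%N -> dercf s c d -> dercf s' c d.
Proof.
move=> ss H t e t0T e0; have [del d0 Hd] := H t e t0T e0; exists del => // r r0T rt.
exact: bd_anti ss (Hd r r0T rt).
Qed.

Lemma contcf_ext s c c' : (forall t, 0 <= t <= T -> c t = c' t) -> contcf s c -> contcf s c'.
Proof.
move=> cc H t t0T; have [[B HB] H2] := H t t0T; split; first by exists B; rewrite -cc.
move=> e e0; have [del d0 Hd] := H2 e e0; exists del => // r r0T rt.
by rewrite -(cc _ t0T) -(cc _ r0T); exact: Hd.
Qed.

Lemma Ckcf_ext s j c c' : (forall t, 0 <= t <= T -> c t = c' t) -> Ckcf s j c -> Ckcf s j c'.
Proof.
case: j => [|j] cc; first exact: contcf_ext.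
move=> [H1 [d Hd Kd]]; split; first exact: contcf_ext H1.
by exists d => //; exact: dercf_ext Hd.
Qed.

(** Points of [0, T] are limits of other points of [0, T], which makes
one-sided derivatives at the ends unique. *)
Lemma near_distinct t del : 0 <= t <= T -> 0 < del ->
  exists r, [/\ 0 <= r <= T, `|r - t| < del & r != t].
Proof.
move=> /andP[t0 tT] d0; pose h := Num.min (del / 2) (T / 2).
have h0 : 0 < h by rewrite lt_min !divr_gt0.
have h1 : h <= del / 2 by rewrite ge_min lexx.
have h2 : h <= T / 2 by rewrite ge_min lexx orbT.
case: (lerP t (T / 2)) => tT2.
  exists (t + h); split.
  - by apply/andP; split; lra.
  - by rewrite addrAC subrr add0r gtr0_norm//; lra.
  - by rewrite -subr_eq0 addrAC subrr add0r gt_eqF.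
exists (t - h); split.
- by apply/andP; split; lra.
- by rewrite addrAC subrr add0r normrN gtr0_norm//; lra.
- by rewrite -subr_eq0 addrAC subrr add0r oppr_eq0 gt_eqF.
Qed.

Lemma dercf_uniq s c d d' : dercf s c d -> dercf s c d' -> forall t, 0 <= t <= T -> d t = d' t.
Proof.
move=> H H' t t0T; apply/funext => k; apply/eqP; rewrite -subr_eq0; apply/eqP; move: k.
apply: (@bd_eq0 R s) => e e0; have e4 : 0 < e / 4 by rewrite divr_gt0.
have [d1 d10 H1] := H t _ t0T e4; have [d2 d20 H2] := H' t _ t0T e4.
have d12 : 0 < Num.min d1 d2 by rewrite lt_min d10.
have [r [r0T rd rt]] := near_distinct t0T d12; move: rd; rewrite lt_min => /andP[rd1 rd2].
have rt0 : r - t != 0 by rewrite subr_eq0.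
have := bdB (bdZ (r - t)^-1 (H2 r r0T rd2)) (bdZ (r - t)^-1 (H1 r r0T rd1)).
rewrite !exprVn (_ : 2 * _ + 2 * _ = e); last by field.
rewrite (_ : (fun k => _) = fun k => d t k - d' t k)//.
by apply/funext => k; field.
Qed.

(** Bounded linear maps of coefficient sequences commute with norm derivatives.
*)
Lemma Ckcf_lin s s' j (L : (nat -> R) -> nat -> R) (K : R) c : 0 <= K ->
  (forall (x y : nat -> R) k, L (fun k => x k - y k) k = L x k - L y k) ->
  (forall (z : R) (x : nat -> R) k, L (fun k => z * x k) k = z * L x k) ->
  (forall x B, bd s x B -> bd s' (L x) (K * B)) ->
  Ckcf s j c -> Ckcf s' j (fun t => L (c t)).
Proof.
move=> K0 LB LZ LK.
have small e : 0 < e -> exists2 e', 0 < e' & forall x y, bd s x (e' * y) -> 0 <= y -> bd s' (L x) (e * y).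
  move=> e0; exists (e / (K + 1)); first by rewrite divr_gt0// ltr_wpDl.
  move=> x y H y0; apply: (bd_le (LK _ _ H)); rewrite mulrA ler_wpM2r//.
  by rewrite mulrCA ler_piMr ?(ltW e0)// ler_pdivrMr ?ltr_wpDl// mul1r lerDl.
have HC c' : contcf s c' -> contcf s' (fun t => L (c' t)).
  move=> H t t0T; have [[B HB] H2] := H t t0T; split; first by exists (K * B); exact: LK.
  move=> e e0; have [e' e'0 He'] := small e e0; have [del d0 Hd] := H2 _ e'0.
  exists del => // r r0T rt.
  rewrite (_ : (fun k => _) = L (fun k => c' r k - c' t k)); last by apply/funext => k; rewrite LB.
  rewrite -(mulr1 e); apply: He' => //; rewrite mulr1; exact: Hd.
elim: j c => [|j IH] c; first exact: HC.
move=> [H1 [d Hd Kd]]; split; first exact: HC.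
exists (fun t => L (d t)); last exact: IH.
move=> t e t0T e0; have [e' e'0 He'] := small e e0; have [del d0 H] := Hd t _ t0T e'0.
exists del => // r r0T rt.
rewrite (_ : (fun k => _) = L (fun k => c r k - c t k - (r - t) * d t k)).
  by apply: He'; [exact: H|exact: sqr_ge0].
by apply/funext => k; rewrite !LB LZ.
Qed.

Lemma Ckcf_anti s s' j c : (s' <= s)%N -> Ckcf s j c -> Ckcf s' j c.
Proof.
move=> ss; apply: (@Ckcf_lin s s' j id 1) => // x B H.
by rewrite mul1r; exact: bd_anti H.
Qed.

Lemma Ckcf_scale s j (z : R) c : Ckcf s j c -> Ckcf s j (fun t k => z * c t k).
Proof.
apply: (@Ckcf_lin s s j (fun x k => z * x k) (z ^+ 2)); first exact: sqr_ge0.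
- by move=> x y k; rewrite mulrBr.
- by move=> w x k; rewrite mulrCA.
- by move=> x B; exact: bdZ.
Qed.

Lemma Ckcf_om2 s j c : Ckcf s.+2 j c -> Ckcf s j (fun t k => om k ^+ 2 * c t k).
Proof.
apply: (@Ckcf_lin s.+2 s j (fun x k => om k ^+ 2 * x k) 1) => //.
- by move=> x y k; rewrite mulrBr.
- by move=> w x k; rewrite mulrCA.
- move=> x B; rewrite mul1r; move=> H; apply: (ssq_dom H) => k.
  by rewrite mulrA -exprD addn2.
Qed.

Lemma contcf_add s c c' : contcf s c -> contcf s c' -> contcf s (fun t k => c t k + c' t k).
Proof.
move=> H H' t t0T; have [[B HB] H2] := H t t0T; have [[B' HB'] H2'] := H' t t0T.
split; first by exists (2 * B + 2 * B'); exact: bdD.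
move=> e e0; have e4 : 0 < e / 4 by rewrite divr_gt0.
have [d1 d10 K1] := H2 _ e4; have [d2 d20 K2] := H2' _ e4.
exists (Num.min d1 d2); first by rewrite lt_min d10.
move=> r r0T; rewrite lt_min => /andP[r1 r2].
have := bdD (K1 r r0T r1) (K2 r r0T r2); rewrite (_ : 2 * _ + 2 * _ = e); last by field.
by congr (bd _ _ _); apply/funext => k; ring.
Qed.

Lemma dercf_add s c c' d d' : dercf s c d -> dercf s c' d' ->
  dercf s (fun t k => c t k + c' t k) (fun t k => d t k + d' t k).
Proof.
move=> H H' t e t0T e0; have e4 : 0 < e / 4 by rewrite divr_gt0.
have [d1 d10 K1] := H _ _ t0T e4; have [d2 d20 K2] := H' _ _ t0T e4.
exists (Num.min d1 d2); first by rewrite lt_min d10.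
move=> r r0T; rewrite lt_min => /andP[r1 r2].
have := bdD (K1 r r0T r1) (K2 r r0T r2); rewrite (_ : 2 * _ + 2 * _ = e * (r - t) ^+ 2); last by field.
by congr (bd _ _ _); apply/funext => k; ring.
Qed.

Lemma Ckcf_add s j c c' : Ckcf s j c -> Ckcf s j c' -> Ckcf s j (fun t k => c t k + c' t k).
Proof.
elim: j c c' => [|j IH] c c'; first exact: contcf_add.
move=> [H1 [d Hd Kd]] [H1' [d' Hd' Kd']]; split; first exact: contcf_add.
by exists (fun t k => d t k + d' t k); [exact: dercf_add|exact: IH].
Qed.

(** A modewise derivative that is continuous in norm is the derivative in norm.
Pair the remainder y of the first order expansion at t with the trajectory: the
increment of the scalar function so obtained is the square norm S of y, and by
the mean value theorem and Cauchy-Schwarz S^2 <= (r - t)^2 e S. *)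
Lemma dercf_of_derive s c d : (forall t k, 0 <= t <= T -> is_derive t 1 (fun r => c r k) (d t k)) ->
  contcf s d -> dercf s c d.
Proof.
move=> D Hd t e t0T e0; have [_ H] := Hd t t0T; have [del d0 Hdel] := H e e0.
exists del => // r r0T rt N.
pose y k := c r k - c t k - (r - t) * d t k.
(* phi r - phi t is the square norm of the first N terms of y *)
pose phi x := \sum_(0 <= k < N) (om k ^+ s) ^+ 2 * y k * (c x k - d t k * x).
pose dphi x := \sum_(0 <= k < N) (om k ^+ s) ^+ 2 * y k * (d x k - d t k * 1).
have Dphi x : 0 <= x <= T -> is_derive x 1 phi (dphi x).
  move=> x0T; apply: isd_sum => k _; apply: isdZ.
  exact: (isdB (D x k x0T) (isdZ (d t k) (isd_id x))).
pose S := \sum_(k < N) (om k ^+ s * y k) ^+ 2.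
have S0 : 0 <= S by apply: sumr_ge0 => k _; exact: sqr_ge0.
have E : phi r - phi t = S.
  rewrite /phi /S -sumrB big_mkord; apply: eq_bigr => k _; rewrite /y; ring.
have key x : 0 <= x <= T -> `|x - t| <= `|r - t| -> dphi x ^+ 2 <= e * S.
  move=> x0T xt; have := Hdel x x0T (le_lt_trans xt rt).
  move=> K; have SS : ssq (fun k => if (k < N)%N then om k ^+ s * y k else 0) S.
    move=> M; apply: (@le_trans _ _ (\sum_(k < maxn N M) (if (k < N)%N then om k ^+ s * y k else 0) ^+ 2)).
      rewrite -!(big_mkord xpredT (fun k => (if (k < N)%N then om k ^+ s * y k else 0) ^+ 2)).
      rewrite [leRHS](big_cat_nat (leq0n M) (leq_maxr N M)) /= lerDl sumr_ge0// => k _; exact: sqr_ge0.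
    rewrite -(big_mkord xpredT (fun k => (if (k < N)%N then om k ^+ s * y k else 0) ^+ 2)).
    rewrite (big_cat_nat (leq0n N) (leq_maxl N M))/= [X in _ + X]big1_seq ?addr0; last first.
      by move=> k; rewrite mem_index_iota => /andP[_ /andP[Nk _]]; rewrite ltnNge Nk expr0n.
    by rewrite big_mkord /S; apply: ler_sum => k _; rewrite ltn_ord.
  have := ssq_CS 0 N K SS; rewrite (_ : \sum_(0 <= k < N) _ = dphi x)// /dphi !big_mkord.
  by apply: eq_bigr => k _; rewrite ltn_ord; ring.
suff : S ^+ 2 <= (r - t) ^+ 2 * (e * S).
  move=> h; rewrite -/S.
  move: S0; rewrite le_eqVlt => /predU1P[<-|S0]; first by rewrite mulr_ge0 ?sqr_ge0// ltW.
  by rewrite -(ler_pM2r S0) -expr2 (le_trans h)// mulrCA mulrA.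
have MV x z : x < z -> 0 <= x <= T -> 0 <= z <= T -> (forall w, x < w < z -> `|w - t| <= `|r - t|) ->
    (phi z - phi x) ^+ 2 <= (z - x) ^+ 2 * (e * S).
  move=> xz /andP[x0 xT] /andP[z0 zT] Hw.
  have DI w : x <= w <= z -> is_derive w 1 phi (dphi w).
    by move=> /andP[w1 w2]; apply: Dphi; rewrite (le_trans x0 w1) (le_trans w2 zT).
  have DJ w : x < w < z -> is_derive w 1 phi (dphi w).
    by move=> /andP[w1 w2]; apply: DI; rewrite !ltW.
  have [w [/andP[xw wz] ->]] := MVT_isd xz DJ (isd_within (f := dphi) DI).
  rewrite exprMn mulrC ler_wpM2l ?sqr_ge0//; apply: key.
    by apply/andP; split; lra.
  by apply: Hw; rewrite xw.
rewrite -[X in X ^+ 2 <= _]E; case: (ltgtP t r) => tr.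
- apply: MV => // w /andP[w1 w2]; rewrite !ger0_norm; lra.
- rewrite -[X in X ^+ 2 <= _]opprB -[X in _ <= X ^+ 2 * _]opprB !sqrrN.
  apply: MV => // w /andP[w1 w2]; rewrite !ler0_norm; lra.
- by rewrite tr !subrr !expr0n mul0r.
Qed.

Section products.
Variable s : nat.
Hypothesis s0 : (0 < s)%N.
Implicit Types (f g h : R -> R) (u v w : R -> R -> R) (A : R).

(** The function f belongs to the domain of A^{s/2}, with square norm at most
A. *)
Definition in_ball f A := L2 f /\ bd s (cf f) A.

Lemma in_ball_ge0 f A : in_ball f A -> 0 <= A. Proof. by move=> [_ /bd_ge0]. Qed.

Lemma in_ball_le f A B : in_ball f A -> A <= B -> in_ball f B.
Proof. by move=> [L H] AB; split => //; exact: bd_le AB. Qed.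

Lemma in_ballD f g A B : in_ball f A -> in_ball g B -> in_ball (f + g) (2 * A + 2 * B).
Proof.
move=> [Lf Hf] [Lg Hg]; split; first exact: L2D.
by rewrite (_ : cf (f + g) = fun k => cf f k + cf g k); [exact: bdD|apply/funext => k; rewrite cfD].
Qed.

Lemma in_ballZ (z : R) f A : in_ball f A -> in_ball (z *: f) (z ^+ 2 * A).
Proof.
move=> [Lf Hf]; split; first exact: L2Z.
by rewrite (_ : cf (z *: f) = fun k => z * cf f k); [exact: bdZ|apply/funext => k; rewrite cfZ].
Qed.

(** Triple products, in the nesting of [triple_product]. *)
Definition mul3 f g h := fun x => f x * (g x * h x).

(** The same classes for trajectories of functions, where the product rule is
an identity between functions. *)
Definition contfun u := forall t, 0 <= t <= T -> (exists B, in_ball (u t) B) /\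
  forall e, 0 < e -> exists2 del, 0 < del & forall r, 0 <= r <= T -> `|r - t| < del -> in_ball (u r - u t) e.

Definition derfun u v := forall t e, 0 <= t <= T -> 0 < e -> exists2 del, 0 < del &
  forall r, 0 <= r <= T -> `|r - t| < del -> in_ball (u r - u t - (r - t) *: v t) (e * (r - t) ^+ 2).

Definition L2T u := forall t, 0 <= t <= T -> L2 (u t).

Lemma contfunP u : L2T u -> contfun u <-> contcf s (fun t => cf (u t)).
Proof.
move=> Lu; split=> H t t0T; have [[B HB] H2] := H t t0T; split.
- by exists B; exact: HB.2.
- move=> e e0; have [del d0 Hd] := H2 e e0; exists del => // r r0T rt.
  have [_ K] := Hd r r0T rt; move: K; congr (bd _ _ _); apply/funext => k.
  by rewrite cfB//; exact: Lu.
- by exists B; split => //; exact: Lu.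
- move=> e e0; have [del d0 Hd] := H2 e e0; exists del => // r r0T rt.
  split; first by apply: L2B; exact: Lu.
  have := Hd r r0T rt; congr (bd _ _ _); apply/funext => k.
  by rewrite cfB//; exact: Lu.
Qed.

Lemma derfunP u v : L2T u -> L2T v -> derfun u v <-> dercf s (fun t => cf (u t)) (fun t => cf (v t)).
Proof.
move=> Lu Lv; split=> H t e t0T e0; have [del d0 Hd] := H t e t0T e0; exists del => // r r0T rt.
- have [_ K] := Hd r r0T rt; move: K; congr (bd _ _ _); apply/funext => k.
  by rewrite !cfB ?cfZ//; [exact: Lv|exact: Lu|exact: Lu|apply: L2B; exact: Lu|apply: L2Z; exact: Lv].
- split; first by apply: L2B; [apply: L2B; exact: Lu|apply: L2Z; exact: Lv].
  have := Hd r r0T rt; congr (bd _ _ _); apply/funext => k.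
  by rewrite !cfB ?cfZ//; [exact: Lv|exact: Lu|exact: Lu|apply: L2B; exact: Lu|apply: L2Z; exact: Lv].
Qed.

Lemma contfun_near u t : contfun u -> 0 <= t <= T -> exists2 del, 0 < del & exists2 A, 0 <= A &
  in_ball (u t) A /\ forall r, 0 <= r <= T -> `|r - t| < del -> in_ball (u r) A.
Proof.
move=> Hu t0T; have [[B HB] H2] := Hu t t0T; have [del d0 Hd] := H2 1 ltr01.
have B0 := in_ball_ge0 HB; exists del => //; exists (2 * 1 + 2 * B); first by lra.
split; first by apply: (in_ball_le HB); lra.
move=> r r0T rt; have := in_ballD (Hd r r0T rt) HB.
by rewrite (_ : _ + u t = u r)// subrK.
Qed.

Section with_constant.
Variable C3 : R.
Hypothesis C30 : 0 <= C3.
Hypothesis HC3 : forall f g h A B D, in_ball f A -> in_ball g B -> in_ball h D -> in_ball (mul3 f g h) (C3 * (A * (B * D))).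

(** The norm of the trilinear product when two factors have square norm at most
A; 1 is added to make it positive. *)
Let kc A := C3 * (A * A) + 1.

Let kc_gt0 A : 0 < kc A. Proof. by rewrite ltr_wpDl// mulr_ge0// -expr2 sqr_ge0. Qed.

Let tri1 f g h x A : in_ball f x -> in_ball g A -> in_ball h A -> in_ball (mul3 f g h) (x * kc A).
Proof.
move=> fx gA hA; apply: (in_ball_le (HC3 fx gA hA)); have := in_ball_ge0 fx; rewrite /kc => x0.
by rewrite mulrDr mulr1 mulrCA lerDl.
Qed.

Let tri2 f g h x A : in_ball f A -> in_ball g x -> in_ball h A -> in_ball (mul3 f g h) (x * kc A).
Proof.
move=> fx gA hA; have := tri1 gA fx hA.
by rewrite (_ : mul3 g f h = mul3 f g h)//; apply/funext => z; rewrite /mul3 mulrCA.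
Qed.

Let tri3 f g h x A : in_ball f A -> in_ball g A -> in_ball h x -> in_ball (mul3 f g h) (x * kc A).
Proof.
move=> fx gA hA; have := tri1 hA fx gA.
by rewrite (_ : mul3 h f g = mul3 f g h)//; apply/funext => z; rewrite /mul3; ring.
Qed.

(** Telescope the increment of the product into three terms with one small
factor. *)
Lemma contfun_mul3 u v w : contfun u -> contfun v -> contfun w -> contfun (fun t => mul3 (u t) (v t) (w t)).
Proof.
move=> Hu Hv Hw t t0T.
have [_ _ [A1 A10 [ut _]]] := contfun_near Hu t0T.
have [d2 d20 [A2 A20 [vt vr]]] := contfun_near Hv t0T.
have [d3 d30 [A3 A30 [wt wr]]] := contfun_near Hw t0T.
split; first by exists (C3 * (A1 * (A2 * A3))); exact: HC3.
move=> e e0; pose A := A1 + A2 + A3.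
have L1 : A1 <= A by rewrite /A; lra.
have L2 : A2 <= A by rewrite /A; lra.
have L3 : A3 <= A by rewrite /A; lra.
(* the three terms are combined by nested doublings, with total weight 10 *)
pose e' := e / (10 * kc A).
have e'0 : 0 < e' by rewrite divr_gt0// mulr_gt0.
have [_ Ku] := Hu t t0T; have [_ Kv] := Hv t t0T; have [_ Kw] := Hw t t0T.
have [d4 d40 K4] := Ku _ e'0; have [d5 d50 K5] := Kv _ e'0; have [d6 d60 K6] := Kw _ e'0.
exists (Num.min (Num.min d2 d3) (Num.min d4 (Num.min d5 d6))).
  by rewrite !lt_min d20 d30 d40 d50 d60.
move=> r r0T; rewrite !lt_min => /andP[/andP[r2 r3] /andP[r4 /andP[r5 r6]]].
have W1 := tri1 (K4 r r0T r4) (in_ball_le (vr r r0T r2) L2) (in_ball_le (wr r r0T r3) L3).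
have W2 := tri2 (in_ball_le ut L1) (K5 r r0T r5) (in_ball_le (wr r r0T r3) L3).
have W3 := tri3 (in_ball_le ut L1) (in_ball_le vt L2) (K6 r r0T r6).
have W := in_ballD (in_ballD W1 W2) W3.
rewrite (_ : mul3 (u r) (v r) (w r) - mul3 (u t) (v t) (w t) =
  mul3 (u r - u t) (v r) (w r) + mul3 (u t) (v r - v t) (w r) + mul3 (u t) (v t) (w r - w t)); last first.
  by apply/funext => x; rewrite /mul3 !fctE; ring.
apply: (in_ball_le W); rewrite (_ : e' * kc A = e / 10); last by rewrite /e'; field; rewrite gt_eqF.
lra.
Qed.

(** The product rule. Replacing the increment of each factor by its first order
expansion leaves six terms, each with one factor that is small relative to (r -
t). *)
Lemma derfun_mul3 u v w du dv dw : contfun u -> contfun v -> contfun w -> L2T du -> L2T dv -> L2T dw ->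
  contfun du -> contfun dv -> contfun dw ->
  derfun u du -> derfun v dv -> derfun w dw ->
  derfun (fun t => mul3 (u t) (v t) (w t))
     (fun t => mul3 (du t) (v t) (w t) + mul3 (u t) (dv t) (w t) + mul3 (u t) (v t) (dw t)).
Proof.
move=> Hu Hv Hw Ldu Ldv Ldw Hdu Hdv Hdw Du Dv Dw t e t0T e0.
have [_ _ [A1 A10 [ut _]]] := contfun_near Hu t0T.
have [d2 d20 [A2 A20 [vt vr]]] := contfun_near Hv t0T.
have [d3 d30 [A3 A30 [wt wr]]] := contfun_near Hw t0T.
have [_ _ [A4 A40 [dut _]]] := contfun_near Hdu t0T.
have [_ _ [A5 A50 [dvt _]]] := contfun_near Hdv t0T.
pose A := A1 + A2 + A3 + A4 + A5.
have L1 : A1 <= A by rewrite /A; lra.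
have L2 : A2 <= A by rewrite /A; lra.
have L3 : A3 <= A by rewrite /A; lra.
have L4 : A4 <= A by rewrite /A; lra.
have L5 : A5 <= A by rewrite /A; lra.
(* the six terms are combined by nested doublings, with total weight 40 *)
pose e' := e / (40 * kc A).
have e'0 : 0 < e' by rewrite divr_gt0// mulr_gt0.
have [_ Kv] := Hv t t0T; have [_ Kw] := Hw t t0T.
have [d5 d50 K5] := Kv _ e'0; have [d6 d60 K6] := Kw _ e'0.
have [d7 d70 K7] := Du _ _ t0T e'0; have [d8 d80 K8] := Dv _ _ t0T e'0.
have [d9 d90 K9] := Dw _ _ t0T e'0.
exists (Num.min (Num.min d2 (Num.min d3 d5)) (Num.min (Num.min d6 d7) (Num.min d8 d9))).
  by rewrite !lt_min d20 d30 d50 d60 d70 d80 d90.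
move=> r r0T; rewrite !lt_min => /andP[/andP[r2 /andP[r3 r5]] /andP[/andP[r6 r7] /andP[r8 r9]]].
have vr' := in_ball_le (vr r r0T r2) L2; have wr' := in_ball_le (wr r r0T r3) L3.
have W1 := tri1 (K7 r r0T r7) vr' wr'.
have W2 := in_ballZ (r - t) (tri2 (in_ball_le dut L4) (K5 r r0T r5) wr').
have W3 := in_ballZ (r - t) (tri3 (in_ball_le dut L4) (in_ball_le vt L2) (K6 r r0T r6)).
have W4 := tri2 (in_ball_le ut L1) (K8 r r0T r8) wr'.
have W5 := in_ballZ (r - t) (tri3 (in_ball_le ut L1) (in_ball_le dvt L5) (K6 r r0T r6)).
have W6 := tri3 (in_ball_le ut L1) (in_ball_le vt L2) (K9 r r0T r9).
have W := in_ballD (in_ballD (in_ballD W1 W2) (in_ballD W3 W4)) (in_ballD W5 W6).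
rewrite (_ : mul3 (u r) (v r) (w r) - mul3 (u t) (v t) (w t) - _ =
  (mul3 (u r - u t - (r - t) *: du t) (v r) (w r) +
   (r - t) *: mul3 (du t) (v r - v t) (w r)) +
  ((r - t) *: mul3 (du t) (v t) (w r - w t) +
   mul3 (u t) (v r - v t - (r - t) *: dv t) (w r)) +
  ((r - t) *: mul3 (u t) (dv t) (w r - w t) +
   mul3 (u t) (v t) (w r - w t - (r - t) *: dw t))); last first.
  by apply/funext => x; rewrite /mul3 !fctE /GRing.scale/=; ring.
apply: (in_ball_le W); rewrite (_ : e' * (r - t) ^+ 2 * kc A = e / 40 * (r - t) ^+ 2); last first.
  by rewrite /e'; field; rewrite gt_eqF.
rewrite (_ : (r - t) ^+ 2 * (e' * kc A) = e / 40 * (r - t) ^+ 2); last first.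
  by rewrite /e'; field; rewrite gt_eqF.
by rewrite le_eqVlt; apply/orP; left; apply/eqP; field.
Qed.

Lemma mul3_L2T u v w : contfun u -> contfun v -> contfun w -> L2T (fun t => mul3 (u t) (v t) (w t)).
Proof. by move=> Hu Hv Hw t t0T; have [[B []]] := contfun_mul3 Hu Hv Hw t0T. Qed.

Lemma contfun_L2T u : contfun u -> L2T u.
Proof. by move=> Hu t t0T; have [[B []]] := Hu t t0T. Qed.

Lemma contfunD u v : contfun u -> contfun v -> contfun (fun t => u t + v t).
Proof.
move=> Hu Hv; have Lu := contfun_L2T Hu; have Lv := contfun_L2T Hv.
apply/contfunP; first by move=> t t0T; apply: L2D; [exact: Lu|exact: Lv].
apply: (@contcf_ext s (fun t k => cf (u t) k + cf (v t) k)).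
  by move=> t t0T; apply/funext => k; rewrite cfD//; [exact: Lu|exact: Lv].
by apply: contcf_add; apply/contfunP.
Qed.

Lemma syn_contfun d : contcf s d -> contfun (fun t => syn (d t)).
Proof.
move=> H; have Ld t : 0 <= t <= T -> L2 (syn (d t)) /\ cf (syn (d t)) = d t.
  by move=> t0T; have [[B HB] _] := H t t0T; exact: synP HB.
apply/contfunP; first by move=> t /Ld[].
by apply: contcf_ext H => t /Ld[_ ->].
Qed.

Lemma Ckcf_mul3 j u v w : L2T u -> L2T v -> L2T w ->
  Ckcf s j (fun t => cf (u t)) -> Ckcf s j (fun t => cf (v t)) -> Ckcf s j (fun t => cf (w t)) ->
  Ckcf s j (fun t => cf (mul3 (u t) (v t) (w t))).
Proof.
elim: j u v w => [|j IH] u v w Lu Lv Lw.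
  move=> /(contfunP Lu) Hu /(contfunP Lv) Hv /(contfunP Lw) Hw.
  by apply/contfunP; [exact: mul3_L2T|exact: contfun_mul3].
move=> Ku Kv Kw.
have [/(contfunP Lu) Hu [du Du Kdu]] := Ku.
have [/(contfunP Lv) Hv [dv Dv Kdv]] := Kv.
have [/(contfunP Lw) Hw [dw Dw Kdw]] := Kw.
have Hdu := syn_contfun (Ckcf_contcf Kdu); have Hdv := syn_contfun (Ckcf_contcf Kdv); have Hdw := syn_contfun (Ckcf_contcf Kdw).
have E d t : Ckcf s j d -> 0 <= t <= T -> d t = cf (syn (d t)).
  by move=> /Ckcf_contcf Hd t0T; have [[B HB] _] := Hd t t0T; have [_ ->] := synP HB.
have Du' : derfun u (fun t => syn (du t)).
  by apply/derfunP => //; [exact: contfun_L2T|apply: dercf_ext Du => // t; exact: E].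
have Dv' : derfun v (fun t => syn (dv t)).
  by apply/derfunP => //; [exact: contfun_L2T|apply: dercf_ext Dv => // t; exact: E].
have Dw' : derfun w (fun t => syn (dw t)).
  by apply/derfunP => //; [exact: contfun_L2T|apply: dercf_ext Dw => // t; exact: E].
have D := derfun_mul3 Hu Hv Hw (contfun_L2T Hdu) (contfun_L2T Hdv) (contfun_L2T Hdw) Hdu Hdv Hdw Du' Dv' Dw'.
have L1 := mul3_L2T Hdu Hv Hw; have L2 := mul3_L2T Hu Hdv Hw; have L3 := mul3_L2T Hu Hv Hdw.
split; first by apply/contfunP; [exact: mul3_L2T|exact: contfun_mul3].
exists (fun t => cf (mul3 (syn (du t)) (v t) (w t) + mul3 (u t) (syn (dv t)) (w t) + mul3 (u t) (v t) (syn (dw t)))).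
  apply/derfunP => //; first exact: mul3_L2T.
  by move=> t t0T; apply: L2D; [apply: L2D; [exact: L1|exact: L2]|exact: L3].
apply: (@Ckcf_ext s j (fun t k => cf (mul3 (syn (du t)) (v t) (w t)) k + cf (mul3 (u t) (syn (dv t)) (w t)) k
   + cf (mul3 (u t) (v t) (syn (dw t))) k)).
  by move=> t t0T; apply/funext => k; rewrite !cfD//; [exact: L1|exact: L2|apply: L2D; [exact: L1|exact: L2]|exact: L3].
apply: Ckcf_add; first apply: Ckcf_add.
- by apply: IH => //; [exact: contfun_L2T|apply: (Ckcf_ext _ Kdu) => t; exact: E|exact: Ckcf_pred|exact: Ckcf_pred].
- by apply: IH => //; [exact: contfun_L2T|exact: Ckcf_pred|apply: (Ckcf_ext _ Kdv) => t; exact: E|exact: Ckcf_pred].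
- by apply: IH => //; [exact: contfun_L2T|exact: Ckcf_pred|exact: Ckcf_pred|apply: (Ckcf_ext _ Kdw) => t; exact: E].
Qed.

(** Odd powers are triple products: u^{2i+3} = u (u u^{2i+1}). *)
Lemma odd_power i j u du : L2T u -> L2T du -> Ckcf s j (fun t => cf (u t)) ->
  derfun u du -> contfun u -> contfun du ->
  [/\ Ckcf s j (fun t => cf (u t ^+ (2 * i).+1)), L2T (fun t => u t ^+ (2 * i).+1),
     contfun (fun t => (2 * i).+1%:R *: (u t ^+ (2 * i) * du t)) &
     derfun (fun t => u t ^+ (2 * i).+1) (fun t => (2 * i).+1%:R *: (u t ^+ (2 * i) * du t))].
Proof.
move=> Lu Ldu Ku Du Hu Hdu.
elim: i => [|i [K L C D]].
  have E0 : (fun t => (2 * 0).+1%:R *: (u t ^+ (2 * 0) * du t)) = du.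
    apply/funext => t; apply/funext => x.
    by rewrite !fctE /GRing.scale/= expr0 !mul1r.
  by split => //; rewrite E0.
have E t : u t ^+ (2 * i.+1).+1 = mul3 (u t) (u t) (u t ^+ (2 * i).+1).
  by apply/funext => x; rewrite /mul3 !fctE mulnS !exprS.
have H : contfun (fun t => u t ^+ (2 * i).+1) by apply/contfunP => //; exact: Ckcf_contcf K.
have E2 t : (2 * i.+1).+1%:R *: (u t ^+ (2 * i.+1) * du t) =
    mul3 (du t) (u t) (u t ^+ (2 * i).+1) + mul3 (u t) (du t) (u t ^+ (2 * i).+1) +
    mul3 (u t) (u t) ((2 * i).+1%:R *: (u t ^+ (2 * i) * du t)).
  apply/funext => x; rewrite /mul3 !fctE /GRing.scale/= mulnS !exprS -natr1 !natrD -natr1; ring.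
split.
- by under [X in Ckcf _ _ X]eq_fun do rewrite E; exact: Ckcf_mul3.
- by under [X in L2T X]eq_fun do rewrite E; exact: mul3_L2T.
- under [X in contfun X]eq_fun do rewrite E2.
  by apply: contfunD; [apply: contfunD|]; exact: contfun_mul3.
- rewrite (funext E) (funext E2).
  by apply: derfun_mul3 => //; exact: contfun_L2T.
Qed.

End with_constant.

(** u^{2i} u_t is the time derivative of u^{2i+1} divided by 2i + 1; so it is
of class C^j when u is of class C^{j+1}. *)
Lemma Ckcf_even_power_mul i j u du : L2T u -> L2T du -> Ckcf s j.+1 (fun t => cf (u t)) ->
  dercf s (fun t => cf (u t)) (fun t => cf (du t)) -> contcf s (fun t => cf (du t)) ->
  L2T (fun t => u t ^+ (2 * i) * du t) /\ Ckcf s j (fun t => cf (u t ^+ (2 * i) * du t)).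
Proof.
move=> Lu Ldu Ku Du Cdu; have [C C0 HC] := triple_product R s0.
have HC' f g h A B D : in_ball f A -> in_ball g B -> in_ball h D -> in_ball (mul3 f g h) (C * (A * (B * D))).
  by move=> [L1 H1] [L2 H2] [L3 H3]; exact: HC.
have Cu := Ckcf_contcf Ku.
move: Cu Cdu Du => /(contfunP Lu) Cu /(contfunP Ldu) Cdu /(derfunP Lu Ldu) Du.
have [[_ [d Dd Kd]] Lp CQ Dp] := odd_power C0 HC' i Lu Ldu Ku Du Cu Cdu.
have LQ := contfun_L2T CQ.
have E t : 0 <= t <= T -> d t = cf ((2 * i).+1%:R *: (u t ^+ (2 * i) * du t)).
  by move=> t0T; exact: (dercf_uniq Dd ((derfunP Lp LQ).1 Dp)).
have EQ t : (2 * i).+1%:R^-1 *: ((2 * i).+1%:R *: (u t ^+ (2 * i) * du t)) = u t ^+ (2 * i) * du t.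
  by rewrite scalerA mulVf ?scale1r// pnatr_eq0.
split; first by move=> t t0T; rewrite -EQ; apply: L2Z; exact: LQ.
have := Ckcf_scale ((2 * i).+1%:R^-1) Kd; apply: Ckcf_ext => t t0T; apply/funext => k.
by rewrite E// -cfZ ?EQ//; exact: LQ.
Qed.

End products.

End time_classes.

Section regularity_in_time.
Context (R : realType).
Variables (alpha T : R) (m n : nat).
Hypothesis T0 : 0 < T.
Variables (a b : R -> nat -> R).
Hypothesis sol : damped_sol alpha m T n a b.

Let ucont_contcf : contcf T n.+1 a /\ contcf T n b.
Proof.
have [_ [Q HQ] U] := sol; split=> t t0T; split.
- by exists Q; exact: bdEl (HQ t t0T).
- move=> e e0; have [d d0 H] := U e e0; exists d => // r r0T rt; exact: bdEl (H _ _ r0T t0T rt).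
- by exists Q; exact: bdEr (HQ t t0T).
- move=> e e0; have [d d0 H] := U e e0; exists d => // r r0T rt; exact: bdEr (H _ _ r0T t0T rt).
Qed.

Lemma dercf_ab : dercf T n a b.
Proof.
have [D _ _] := sol; have [_ Cb] := ucont_contcf.
by apply: dercf_of_derive Cb => t k _; have [] := D t k.
Qed.

Let g t := damping alpha m (a t) (b t).

Let LE : forall t, 0 <= t <= T -> [/\ L2 (syn (a t)), cf (syn (a t)) = a t, L2 (syn (b t)) & cf (syn (b t)) = b t].
Proof.
have [_ [Q HQ] _] := sol; move=> t t0T.
have [L1 E1] := synP (bdEl (HQ t t0T)); by have [L2 E2] := synP (bdEr (HQ t t0T)); split.
Qed.

(** The damping term is of class C^j in the domain of A^{s/2} when u is of
class C^{j+1} there, for s >= 1. *)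
Let Ckcf_g s j : (0 < s <= n)%N -> Ckcf T s j.+1 a -> Ckcf T s j g.
Proof.
move=> /andP[s0 sn] Ka; have [_ Cb] := ucont_contcf.
have Cb' : contcf T s b by exact: (@Ckcf_anti _ _ n s 0 b sn Cb).
have [] := @Ckcf_even_power_mul _ T T0 s s0 m j (fun t => syn (a t)) (fun t => syn (b t)).
- by move=> t /LE[].
- by move=> t /LE[].
- by apply: (Ckcf_ext _ Ka) => t /LE[_ ->].
- by apply: (dercf_ext _ _ (dercf_anti sn dercf_ab)) => t /LE[_ Ea _ Eb]; rewrite ?Ea ?Eb.
- by apply: (contcf_ext _ Cb') => t /LE[_ _ _ ->].
move=> L K; apply: (Ckcf_ext _ (Ckcf_scale alpha K)) => t t0T; apply/funext => k.
rewrite -cfZ; last exact: L.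
congr (cf _ k); apply/funext => x; by rewrite !fctE /GRing.scale/= mulrA.
Qed.

(** The acceleration. *)
Let h t k := - om k ^+ 2 * a t k - g t k.

(** The part A u costs two levels in space; the damping costs one level in
space and one time derivative. *)
Let Ckcf_h i : (i.+2 <= n.+1)%N -> Ckcf T (n.+1 - i) i a -> Ckcf T (n.+1 - i.+1) i.+1 a ->
  Ckcf T (n.+1 - i.+2) i h.
Proof.
move=> i2 K1 K2.
have E1 : (n.+1 - i = (n.+1 - i.+2).+2)%N by lia.
have E2 : (n.+1 - i.+2 <= n.+1 - i.+1)%N by lia.
have E3 : (0 < n.+1 - i.+1 <= n)%N by lia.
rewrite E1 in K1.
have := Ckcf_add (Ckcf_scale (-1) (Ckcf_om2 K1)) (Ckcf_scale (-1) (Ckcf_anti E2 (Ckcf_g E3 K2))).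
by apply: Ckcf_ext => t t0T; apply/funext => k; rewrite /h; ring.
Qed.

(** Induction on j: two time derivatives are traded for the acceleration, whose
regularity is given by the two preceding cases. *)
Theorem Ckcf_solution j : (j <= n.+1)%N -> Ckcf T (n.+1 - j) j a.
Proof.
have [Ca Cb] := ucont_contcf.
elim/ltn_ind: j => -[|[|j]] IH jn.
- by rewrite subn0.
- rewrite subn1/=; split; first exact: (@Ckcf_anti _ T n.+1 n 0 a (leqnSn n) Ca).
  by exists b => //; exact: dercf_ab.
have P0 : Ckcf T (n.+1 - 0) 0 a by apply: IH.
have P1 : Ckcf T (n.+1 - 1) 1 a by apply: IH => //; lia.
have Hh0 : contcf T (n.+1 - 2) h by apply: (@Ckcf_h 0) => //; lia.
have Db : dercf T (n.+1 - 2) b h.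
  apply: dercf_of_derive Hh0 => t k t0T; have [D _ _] := sol; have [_] := D t k.
  by rewrite clamp_id.
have Hh : Ckcf T (n.+1 - j.+2) j h by apply: Ckcf_h => //; apply: IH; lia.
split; first exact: (@Ckcf_anti _ T n.+1 (n.+1 - j.+2) 0 a (leq_subr _ _) Ca).
have sn : (n.+1 - j.+2 <= n)%N by lia.
exists b; first exact: dercf_anti sn dercf_ab.
split; first exact: (@Ckcf_anti _ T n _ 0 b sn Cb).
by exists h => //; apply: dercf_anti Db; lia.
Qed.

End regularity_in_time.

(** * Function spaces described by sine coefficients *)

Section levels.
Context (R : realType).
Implicit Types (X : fspace R) (g h : R -> R) (s j k N : nat) (B : R).

(** The norm and the carrier of X are those of the domain of A^{s/2}, read on
sine coefficients. *)
Definition level X s := [/\ forall g, X g <-> L2 g /\ exists B, bd s (cf g) B,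
  forall g B, X g -> 0 <= B -> fnorm X g <= Num.sqrt B <-> bd s (cf g) B &
  forall g, 0 <= fnorm X g].

Lemma sqrt_leP (x B : R) : 0 <= x -> 0 <= B -> Num.sqrt x <= Num.sqrt B <-> x <= B.
Proof. by move=> x0 B0; rewrite ler_sqrt. Qed.

Lemma level_L2 : level L2 0.
Proof.
split.
- by move=> g; split=> [Lg|[]//]; split => //; exists (ip0 g g); exact: cf_bessel.
- move=> g B Lg B0; rewrite /= /norm0 sqrt_leP ?ip0_ge0//; split=> H.
    exact: bd_le (cf_bessel Lg) H.
  exact: parseval_le.
- by move=> g; exact: sqrtr_ge0.
Qed.

Lemma level_H10 : level H10 1.
Proof.
have HL (g : R -> R) : H10 g -> L2 g by move=> [[]].
split.
- move=> g; split=> [Hg|[Lg [B HB]]]; last by have [] := bd_H10 Lg HB.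
  by split; [exact: HL|exists (ip1 g g); exact: H10_bd].
- move=> g B Hg B0; rewrite /= sqrt_leP//; last exact: ip0_ge0.
  split=> H; first exact: bd_le (H10_bd Hg) H.
  by have [] := bd_H10 (HL _ Hg) H.
- by move=> g; exact: sqrtr_ge0.
Qed.

Lemma coef_cf g k : coef g k.+1 = cf g k.
Proof. by []. Qed.

(** With index shift and r = s / 2, the terms of the series defining the norm
are the squares of omega_k^s c_k. *)
Lemma DA_term s g k : lambda R k.+1 `^ (2 * (s%:R / 2)) * coef g k.+1 ^+ 2 = (om k ^+ s * cf g k) ^+ 2.
Proof.
rewrite coef_cf exprMn (_ : 2 * (s%:R / 2) = s%:R); last by field.
rewrite (_ : lambda R k.+1 = om k ^+ 2); last by rewrite omE exprMn.
by rewrite powR_mulrn ?sqr_ge0// -!exprM mulnC.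
Qed.

Let term s g k : \bar R := (lambda R k `^ (2 * (s%:R / 2)) * coef g k ^+ 2)%:E.

Let term_ge0 s g k : (0 <= term s g k)%E.
Proof. by rewrite lee_fin mulr_ge0 ?powR_ge0// sqr_ge0. Qed.

Let term_sum s g N : (\sum_(1 <= k < N.+1) term s g k)%E = (\sum_(k < N) (om k ^+ s * cf g k) ^+ 2)%:E.
Proof.
rewrite big_add1 /= big_mkord -sumEFin; apply: eq_bigr => k _; by rewrite /term DA_term.
Qed.

Let DA_ub s g B : bd s (cf g) B -> (\sum_(1 <= k <oo) term s g k <= B%:E)%E.
Proof.
move=> H; apply: lime_le; first by apply: is_cvg_nneseries => k _ _; exact: term_ge0.
apply: nearW => -[|N]; first by rewrite big_geq// lee_fin; exact: bd_ge0 H.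
by rewrite term_sum lee_fin; exact: H.
Qed.

Let DA_lb s g : (\sum_(1 <= k <oo) term s g k < +oo)%E ->
  bd s (cf g) (fine (\sum_(1 <= k <oo) term s g k)%E).
Proof.
move=> fin N; have S0 : (0 <= \sum_(1 <= k <oo) term s g k)%E by apply: nneseries_ge0 => k _ _.
rewrite -lee_fin fineK; last by rewrite ge0_fin_numE.
by rewrite -term_sum; apply: nneseries_lim_ge => k _ _; exact: term_ge0.
Qed.

(** A form of completeness, by [cf_expands]. *)
Lemma DA_expansion g : L2 g ->
  (fun N => norm0 (g - \sum_(1 <= k < N) coef g k *: E k)) @ \oo --> (0 : R).
Proof.
move=> Lg; apply/cvgr0Pnorm_le => e e0.
have [N0 HN] := expands_psum_small (cf_ssq Lg) (cf_expands Lg) (exprn_gt0 2 e0).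
exists N0.+1 => // -[//|N] /= NN; rewrite /norm0 ger0_norm ?sqrtr_ge0//.
rewrite (_ : \sum_(1 <= k < N.+1) _ = psum sinm (cf g) N); last by rewrite big_add1 big_mkord.
rewrite -(ger0_norm (ltW e0)) -sqrtr_sqr ler_sqrt ?sqr_ge0//; exact: HN.
Qed.

Lemma level_DA s : level (DA (s%:R / 2)) s.
Proof.
split.
- move=> g; split=> [[Lg _ fin]|[Lg [B HB]]].
    by split => //; eexists; exact: DA_lb fin.
  by split => //; [exact: DA_expansion|exact: le_lt_trans (DA_ub HB) (ltry _)].
- move=> g B [Lg _ fin] B0; rewrite /= sqrt_leP//; last first.
    by apply: fine_ge0; apply: nneseries_ge0 => k _ _; exact: term_ge0.
  split=> H; first exact: bd_le (DA_lb fin) H.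
  rewrite -lee_fin fineK; first exact: DA_ub.
  by rewrite ge0_fin_numE//; apply: nneseries_ge0 => k _ _; exact: term_ge0.
- by move=> g; exact: sqrtr_ge0.
Qed.

End levels.

Section transfer.
Context (R : realType).
Variable T : R.
Hypothesis T0 : 0 < T.
Variables (X : fspace R) (s : nat).
Hypothesis lX : level X s.
Implicit Types (z : R -> R -> R) (w : R -> R) (t r e : R) (j : nat).

Let XP g : X g <-> L2 g /\ exists B, bd s (cf g) B. Proof. by case: lX. Qed.
Let XN g B : X g -> 0 <= B -> fnorm X g <= Num.sqrt B <-> bd s (cf g) B. Proof. by case: lX => _ H _; exact: H. Qed.
Let X0 g : 0 <= fnorm X g. Proof. by case: lX. Qed.

Lemma level_L2w g : X g -> L2 g. Proof. by move=> /XP[]. Qed.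

Lemma level_sub g h : X g -> X h -> X (g - h).
Proof.
move=> /XP[Lg [B HB]] /XP[Lh [D HD]]; apply/XP; split; first exact: L2B.
exists (2 * B + 2 * D); have := bdB HB HD; congr (bd _ _ _).
by apply/funext => k; rewrite cfB.
Qed.

Lemma level_scale (c : R) g : X g -> X (c *: g).
Proof.
move=> /XP[Lg [B HB]]; apply/XP; split; first exact: L2Z.
exists (c ^+ 2 * B); have := bdZ c HB; congr (bd _ _ _).
by apply/funext => k; rewrite cfZ.
Qed.

Lemma C0_level z : C0 X T z <-> (forall t, 0 <= t <= T -> L2 (z t)) /\ contcf T s (fun t => cf (z t)).
Proof.
split=> [H|[Lz H]].
  have Hz t : 0 <= t <= T -> X (z t) by move=> t0T; have [|] := H t; rewrite ?in_itv.
  split=> [t /Hz/level_L2w//|t t0T]; split; first by have [_] := (XP _).1 (Hz t t0T).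
  move=> e e0; have [|_] := H t; first by rewrite in_itv.
  have e1 : 0 < Num.sqrt e by rewrite sqrtr_gt0.
  move=> /cvgr0_norm_le/(_ _ e1)[del /= d0 Hd]; exists del => // r r0T rt.
  have := Hd r; rewrite /= in_itv/= distrC => /(_ rt r0T); rewrite ger0_norm//.
  move=> /(XN (level_sub (Hz r r0T) (Hz t t0T)) (ltW e0)); congr (bd _ _ _).
  by apply/funext => k; rewrite cfB//; apply: level_L2w; exact: Hz.
have Hz t : 0 <= t <= T -> X (z t).
  by move=> t0T; apply/XP; split; [exact: Lz|have [] := H t t0T].
move=> t; rewrite in_itv/= => t0T; split; first exact: Hz.
apply/cvgr0Pnorm_le => e e0; have [_ H2] := H t t0T.
have [del d0 Hd] := H2 _ (exprn_gt0 2 e0); exists del => // r /= rt; rewrite in_itv/= => r0T.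
rewrite ger0_norm// -(ger0_norm (ltW e0)) -sqrtr_sqr.
apply/(XN (level_sub (Hz r r0T) (Hz t t0T)) (sqr_ge0 e)).
rewrite distrC in rt; have := Hd r r0T rt; congr (bd _ _ _).
by apply/funext => k; rewrite cfB//; exact: Lz.
Qed.

(** The quotient form of the norm derivative and the first order expansion
agree after multiplication by r - t. *)
Lemma is_tderivP z t w : (forall r, 0 <= r <= T -> X (z r)) -> 0 <= t <= T -> X w ->
  is_tderiv X T z t w <-> forall e, 0 < e -> exists2 del, 0 < del & forall r, 0 <= r <= T ->
    `|r - t| < del -> bd s (fun k => cf (z r) k - cf (z t) k - (r - t) * cf w k) (e * (r - t) ^+ 2).
Proof.
move=> Hz t0T Xw.
have Xq r : 0 <= r <= T -> X ((r - t)^-1 *: (z r - z t) - w).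
  by move=> r0T; apply: level_sub => //; apply: level_scale; apply: level_sub; exact: Hz.
have E r k : 0 <= r <= T -> r != t -> cf (z r) k - cf (z t) k - (r - t) * cf w k =
    (r - t) * cf ((r - t)^-1 *: (z r - z t) - w) k.
  move=> r0T rt; have rt0 : r - t != 0 by rewrite subr_eq0.
  have L1 := level_L2w (Hz r r0T); have L2 := level_L2w (Hz t t0T); have L3 := level_L2w Xw.
  by rewrite cfB ?cfZ ?cfB//; [field|exact: L2B|apply: L2Z; exact: L2B].
split=> [[_ H]|H].
  move=> e e0; have e1 : 0 < Num.sqrt e by rewrite sqrtr_gt0.
  move: H => /cvgr0_norm_le/(_ _ e1)[del /= d0 Hd]; exists del => // r r0T rt.
  have [->|nrt] := eqVneq r t.
    by move=> N; rewrite subrr expr0n mulr0 big1// => k _; rewrite !subrr mul0r subrr mulr0 expr0n.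
  have := Hd r; rewrite /= in_itv/= distrC => /(_ rt nrt r0T); rewrite ger0_norm//.
  move=> /(XN (Xq r r0T) (ltW e0)) K; have := bdZ (r - t) K; rewrite mulrC.
  by congr (bd _ _ _); apply/funext => k; rewrite E.
split => //; apply/cvgr0Pnorm_le => e e0.
have [del d0 Hd] := H _ (exprn_gt0 2 e0); exists del => // r /= rt nrt; rewrite in_itv/= => r0T.
have rt0 : r - t != 0 by rewrite subr_eq0.
rewrite ger0_norm// -(ger0_norm (ltW e0)) -sqrtr_sqr.
apply/(XN (Xq r r0T) (sqr_ge0 e)).
rewrite distrC in rt; have := bdZ (r - t)^-1 (Hd r r0T rt).
rewrite (_ : (r - t)^-1 ^+ 2 * _ = e ^+ 2); last by field.
by congr (bd _ _ _); apply/funext => k; rewrite E// mulKf.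
Qed.

(** The selected derivative is a derivative; uniqueness holds only up to
equality of coefficients, that is, almost everywhere. *)
Lemma tderiv_dercf z : (forall t, 0 <= t <= T -> X (z t)) ->
  (forall t, 0 <= t <= T -> exists w, is_tderiv X T z t w) ->
  (forall t, 0 <= t <= T -> X (tderiv X T z t)) /\
  dercf T s (fun t => cf (z t)) (fun t => cf (tderiv X T z t)).
Proof.
move=> Hz Hw; have P t : 0 <= t <= T -> is_tderiv X T z t (tderiv X T z t).
  by move=> t0T; have [w Hw'] := Hw t t0T; exact: (@xgetPex _ 0 [set w | is_tderiv X T z t w] (ex_intro _ w Hw')).
split=> [t /P[]//|t e t0T e0].
by have [Xw _] := P t t0T; exact: ((is_tderivP Hz t0T Xw).1 (P t t0T)).
Qed.

Lemma dercf_tderiv z d : (forall t, 0 <= t <= T -> X (z t)) -> dercf T s (fun t => cf (z t)) d ->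
  (forall t, 0 <= t <= T -> exists B, bd s (d t) B) ->
  (forall t, 0 <= t <= T -> exists w, is_tderiv X T z t w) /\
  (forall t, 0 <= t <= T -> X (tderiv X T z t) /\ cf (tderiv X T z t) = d t).
Proof.
move=> Hz D dB; have ex t : 0 <= t <= T -> exists w, is_tderiv X T z t w.
  move=> t0T; have [B HB] := dB t t0T; have [Ls Es] := synP HB.
  exists (syn (d t)); apply/is_tderivP => //; first by apply/XP; split => //; exists B; rewrite Es.
  by rewrite Es => e e0; exact: D.
have [H1 H2] := tderiv_dercf Hz ex; split => // t t0T; split; first exact: H1.
exact: (dercf_uniq T0 H2 D).
Qed.

(** The selected time derivative has the coefficients of any norm derivative,
so regularity of coefficients can be pushed through the recursion on j. *)
Theorem Cj_Ckcf j z : (forall t, 0 <= t <= T -> L2 (z t)) -> Ckcf T s j (fun t => cf (z t)) -> Cj X T j z.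
Proof.
elim: j z => [|j IH] z Lz; first by move=> H; apply/C0_level.
move=> [H1 [d Dd Kd]].
have Hz t : 0 <= t <= T -> X (z t).
  by move=> t0T; apply/XP; split; [exact: Lz|have [] := H1 t t0T].
have [ex Ed] := dercf_tderiv Hz Dd (fun t t0T => (Ckcf_contcf Kd t0T).1).
split; first by apply/C0_level.
  by move=> t; rewrite in_itv; exact: ex.
apply: IH; first by move=> t /Ed[/level_L2w].
by apply: (Ckcf_ext _ Kd) => t /Ed[_ ->].
Qed.

End transfer.

(** * Uniqueness of weak solutions *)

Section trajectories.
Context (R : realType).
Variable T : R.
Hypothesis T0 : 0 < T.
Implicit Types (c d : R -> nat -> R) (s k : nat) (t e : R).

(** By [interval_induction]: the trajectory is bounded near every time. *)
Lemma contcf_bounded s c : contcf T s c -> exists B, forall t, 0 <= t <= T -> bd s (c t) B.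
Proof.
move=> H.
apply: (@interval_induction R (fun z => exists B, forall t, 0 <= t <= z -> bd s (c t) B) T (ltW T0)).
  have [|[B HB] _] := H 0; first by rewrite lexx ltW.
  by exists B => t t0; have -> : t = 0 by apply/eqP; rewrite eq_le andbC.
move=> t t0T; have [[B HB] H2] := H t t0T; have [del d0 Hd] := H2 1 ltr01.
exists del => // x y x0 xt ty yT yx [B' HB'].
exists (Num.max B' (2 * 1 + 2 * B)) => r /andP[r0 ry].
case: (lerP r x) => rx.
  by apply: (bd_le (HB' r _)); rewrite ?r0// le_max lexx.
have rt : `|r - t| < del by rewrite ltr_norml; apply/andP; split; lra.
have r0T : 0 <= r <= T by rewrite r0 (le_trans ry yT).
have K := bdD (Hd r r0T rt) HB; apply: (@bd_le _ _ _ (2 * 1 + 2 * B)); last by rewrite le_max lexx orbT.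
by move: K; congr (bd _ _ _); apply/funext => k; rewrite subrK.
Qed.

Lemma contcf_clamp_continuous s c k : contcf T s c -> continuous (fun r => c (clamp T r) k).
Proof.
move=> H t; apply/cvgrPdist_le => e e0.
have [_ H2] := H _ (clamp_in T0 t); have [del d0 Hd] := H2 _ (exprn_gt0 2 e0).
exists del => // r /= rt; apply: sqr_le_norm => //.
have rt' : `|clamp T r - clamp T t| < del by apply: le_lt_trans (clamp_lip T r t) _; rewrite distrC.
by rewrite -sqrrN opprB; exact: (bd_coef k (Hd _ (clamp_in T0 r) rt')).
Qed.

Lemma continuous_within_clamp (h : R -> R) : continuous (fun r => h (clamp T r)) ->
  {within `[0, T], continuous h}.
Proof.
move=> ch; have cw : {within `[0, T], continuous (fun r => h (clamp T r))} by exact: continuous_subspaceT.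
apply: subspace_eq_continuous cw => z; rewrite inE/= in_itv/= => z0T.
exact: (congr1 h (clamp_id z0T)).
Qed.

Lemma dercf_derive s c d t k : dercf T s c d -> 0 < t < T -> is_derive t 1 (fun r => c r k) (d t k).
Proof.
move=> H /andP[t0 tT]; apply: isd_eps => e e0.
have [|del d0 Hd] := H t _ _ (exprn_gt0 2 e0); first by rewrite !ltW.
exists (Num.min del (Num.min t (T - t))); first by rewrite !lt_min d0 t0 subr_gt0.
move=> h; rewrite !lt_min => /andP[h1 /andP[h2 h3]].
move: (h2) (h3); rewrite !ltr_norml => /andP[k1 k2] /andP[k3 k4].
have th : 0 <= t + h <= T by apply/andP; split; lra.
have hE : t + h - t = h by rewrite addrAC subrr add0r.
have := Hd (t + h) th; rewrite hE => /(_ h1)/(bd_coef k) K.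
rewrite -(ger0_norm (ltW e0)) -normrM -ler_sqr ?nnegrE//.
by rewrite !real_normK ?num_real// exprMn (mulrC (d t k)).
Qed.

(** The truncated damping is continuous along norm continuous trajectories, as
it is Lipschitz on bounded sets. *)
Lemma trunc_damping_contcf alpha m M c d : 0 <= M -> contcf T 1 c -> contcf T 0 d ->
  contcf T 0 (fun t => trunc_damping alpha m M t (c t) (d t)).
Proof.
move=> M0 Hc Hd; have [B1 HB1] := contcf_bounded Hc; have [B2 HB2] := contcf_bounded Hd.
have cd t : 0 <= t <= T -> bdE 0 (c t) (d t) (B1 + B2).
  by move=> t0T; apply: bdE_intro; [exact: HB1|exact: HB2].
have [L L0 HL] := trunc_damping_lip alpha m T M0 (B1 + B2).
have [K K0 HK] := trunc_damping_growth alpha m T M0.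
move=> t t0T; split; first by exists (K * (B1 + B2)); apply: HK => //; exact: cd.
move=> e e0; pose e' := e / (2 * (L + 1)).
have e'0 : 0 < e' by rewrite divr_gt0// mulr_gt0// ltr_wpDl.
have [_ H1] := Hc t t0T; have [_ H2] := Hd t t0T.
have [d1 d10 K1] := H1 _ e'0; have [d2 d20 K2] := H2 _ e'0.
exists (Num.min d1 d2); first by rewrite lt_min d10.
move=> r r0T; rewrite lt_min => /andP[r1 r2].
apply: (bd_le (HL r _ _ _ _ _ r0T (cd r r0T) (cd t t0T) (bdE_intro (K1 r r0T r1) (K2 r r0T r2)))).
have -> : e = (L + 1) * (e' + e') by rewrite /e'; field; rewrite gt_eqF// ltr_wpDl.
by rewrite ler_wpM2r ?lerDl// addr_ge0// ltW.
Qed.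

End trajectories.

Section eigenfunction_tests.
Context (R : realType).
Implicit Types (g : R -> R) (k : nat).

Lemma cf_sinm k j : cf (sinm k) j = ((k == j)%:R : R).
Proof. exact: ip0_sinm. Qed.

Lemma H10_sinm k : H10 (@sinm R k).
Proof.
have [|//] := @bd_H10 R (sinm k) ((om k) ^+ 2) (L2_sinm R k).
move=> N; apply: (@le_trans _ _ (\sum_(j < N) (if (j : nat) == k then om k ^+ 2 else 0))).
  apply: ler_sum => j _; rewrite cf_sinm eq_sym; case: eqP => [->|_]; first by rewrite mulr1 expr1.
  by rewrite mulr0 expr0n.
rewrite -(big_mkord xpredT (fun j => if j == k then om k ^+ 2 else 0)) -big_mkcond/=.
case: (ltnP k N) => kN; last first.
  rewrite big1_seq ?sqr_ge0// => j; rewrite mem_index_iota => /andP[/eqP -> /andP[_]].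
  by rewrite ltnNge kN.
by rewrite big_nat1_eq kN.
Qed.

(** An eigenfunction tested against g in the inner product of H^1_0 gives the
eigenvalue times a coefficient. *)
Lemma ip1_sinm g k : H10 g -> ip1 g (sinm k) = om k ^+ 2 * cf g k.
Proof.
move=> Hg; have L := ip1_lim Hg (H10_sinm k).
rewrite -(cvg_lim (@Rhausdorff R) L); apply: cvg_lim; first exact: Rhausdorff.
apply: cvg_near_cst; exists k.+1 => // N /= kN.
rewrite (bigD1 (Ordinal kN))//= cf_sinm eqxx big1 ?addr0; first by rewrite mulr1; ring.
move=> j jk; rewrite cf_sinm (_ : (k == j) = false) ?mulr0//.
by apply: contra_neqF jk => /eqP E; apply/val_inj.
Qed.

End eigenfunction_tests.

Section weak_uniqueness.
Context (R : realType).
Local Notation leb := (@lebesgue_measure R).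
Local Notation mu := (@muO R).
Variables (alpha T : R) (m : nat).
Hypotheses (alpha0 : 0 <= alpha) (T0 : 0 < T).
Variables (u0 u1 : R -> R).
Hypotheses (Lu0 : L2 u0) (Lu1 : L2 u1).
Implicit Types (v : R -> R -> R) (t r : R) (k : nat).

Let f (x : R) : R := alpha * x ^+ (2 * m).

Section coefficients_of_weak.
Variable v : R -> R -> R.
Hypothesis weak : weak_solution f u0 u1 T v.

Let dv := tderiv L2 T v.
Let a t := cf (v t).
Let b t := cf (dv t).

(** What the definition of a weak solution says about sine coefficients, apart
from the equation. *)
Lemma weak_facts : [/\ forall t, 0 <= t <= T -> L2 (v t) /\ L2 (dv t),
  contcf T 1 a, contcf T 0 b, dercf T 0 a b & a 0 = cf u0 /\ b 0 = cf u1].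
Proof.
have [[[C0v ex C0dv] C1v] ini _ _] := weak.
have [L1 _] := (C0_level T (@level_L2 R) v).1 C0v.
have [L2' C2] := (C0_level T (@level_L2 R) dv).1 C0dv.
have [_ C3] := (C0_level T (@level_H10 R) v).1 C1v.
have [|_ D] := tderiv_dercf (@level_L2 R) L1.
  by move=> t t0T; apply: ex; rewrite in_itv.
have z0T : 0 <= (0 : R) <= T by rewrite lexx ltW.
split => //; first by move=> t t0T; split; [exact: L1|exact: L2'].
split; apply: cf_ae => //; [exact: L1|by apply: aeOS ini => x []|exact: L2'|by apply: aeOS ini => x []].
Qed.

Let bound : exists Q, forall t, 0 <= t <= T -> bdE 0 (a t) (b t) Q.
Proof.
have [_ Ca Cb _ _] := weak_facts.
have [B1 H1] := contcf_bounded T0 Ca; have [B2 H2] := contcf_bounded T0 Cb.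
by exists (B1 + B2) => t t0T; apply: bdE_intro; [exact: H1|exact: H2].
Qed.

(** Under the bound on the maximum of v the damping term is square integrable,
and its coefficients are those of the damped system. *)
Let cf_damping t : 0 <= t <= T -> L2 (fun x => f (v t x) * dv t x) /\
  cf (fun x => f (v t x) * dv t x) = damping alpha m (a t) (b t).
Proof.
move=> t0T; have [Q HQ] := bound; have HQt := HQ t t0T; have Q0 := bdE_ge0 HQt.
have M0 : 0 < Q + 1 by rewrite ltr_wpDl.
have MQ : Q <= (Q + 1) ^+ 2 by nra.
have [Lp _] := damping_trunc alpha m 0 M0 (bdEl HQt) MQ (bdEr HQt).
have [LL _ _ _ _] := weak_facts; have [Lv Ldv] := LL t t0T.
have E : {ae mu, forall x, f (v t x) * dv t x = alpha * syn (a t) x ^+ (2 * m) * syn (b t) x}.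
  by apply: aeOS2 (syn_cf Lv) (syn_cf Ldv) => x; rewrite /f /a /b => -> ->.
have Lf : L2 (fun x => f (v t x) * dv t x).
  apply: (L2_ae _ Lp E); apply: measurable_funM; last exact: L2_meas.
  by apply: measurable_damping_factor; exact: L2_meas.
by split => //; exact: cf_ae E.
Qed.

(** Testing with the k-th eigenfunction gives the equation of the k-th mode for
almost every t; the right-hand side is continuous, so [ac_derivative] gives it
for every t. *)
Lemma weak_solves M : 0 < M -> (forall t, 0 <= t <= T -> bdE 0 (a t) (b t) (M ^+ 2)) ->
  solves T a b (fun t => trunc_damping alpha m M t (a t) (b t)) /\ contT T a b.
Proof.
move=> M0 HM; have [LL Ca Cb Dab _] := weak_facts.
have [[_ C1v] _ ac eqn] := weak.
have [_ Hv] : True /\ forall t, 0 <= t <= T -> H10 (v t).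
  by split => // t t0T; have [|] := C1v t; rewrite ?in_itv.
have Ca0 : contcf T 0 a by exact: (@Ckcf_anti _ T 1 0 0 a (leq0n 1) Ca).
have CG := trunc_damping_contcf T0 alpha m (ltW M0) Ca Cb.
have key k : (forall t, 0 < t < T -> is_derive t 1 (fun r => b r k)
      (- om k ^+ 2 * a t k - trunc_damping alpha m M t (a t) (b t) k)) /\
    {within `[0, T], continuous (fun r => b r k)}.
  pose h r := - om k ^+ 2 * a (clamp T r) k - trunc_damping alpha m M (clamp T r) (a (clamp T r)) (b (clamp T r)) k.
  have ch : continuous h.
    have ca := @contcf_clamp_continuous R T T0 1 a k Ca; have cg := @contcf_clamp_continuous R T T0 0 _ k CG.
    move=> r; apply: cvgB; last exact: cg.
    by apply: cvgM; [exact: cvg_cst|exact: ca].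
  have [|H1 H2] := ac_derivative (ltW T0) (ac _ (H10_sinm R k)) ch.
    have [A [mA A0 sA]] := eqn _ (H10_sinm R k); exists A; split => //.
    apply: subset_trans sA => t /= n1 n2; apply: n1 => t0T.
    have [|dt eqt] := n2; first by rewrite in_itv.
    have t0T' : 0 <= t <= T by case/andP: t0T => *; rewrite !ltW.
    apply: (isd_eq (derivable_isd dt)).
    have [_ Ef] := cf_damping t0T'; have HMt := HM t t0T'.
    have [_ EG] := damping_trunc alpha m t M0 (bdEl HMt) (lexx _) (bdEr HMt).
    move: eqt; rewrite ip1_sinm; last exact: Hv.
    rewrite -/(cf (fun x => f (v t x) * dv t x) k) Ef EG.
    rewrite /h clamp_id// /a => eqt.
    by rewrite mulNr; move: eqt; move: (derive1 _ _) (om k ^+ 2 * _) (trunc_damping _ _ _ _ _ _ _) => x y z; lra.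
  split; last exact: H2.
  move=> t t0T; have E : h t = - om k ^+ 2 * a t k - trunc_damping alpha m M t (a t) (b t) k.
    by rewrite /h clamp_id//; case/andP: t0T => *; rewrite !ltW.
  by rewrite -E; exact: H1.
split=> [t t0T k|k].
  split; last exact: (key k).1.
  exact: dercf_derive Dab t0T.
split; last exact: (key k).2.
exact: (continuous_within_clamp (@contcf_clamp_continuous R T T0 1 a k Ca)).
Qed.

Lemma weak_bounded : exists Q, forall t, 0 <= t <= T -> bdE 0 (a t) (b t) Q.
Proof. exact: bound. Qed.

End coefficients_of_weak.

(** The height of truncation is chosen above the bounds of both solutions on
[0, T]; then both solve the same Lipschitz system. *)
Lemma weak_unique (a b : R -> nat -> R) v : a 0 = cf u0 -> b 0 = cf u1 ->
  damped_sol alpha m T 0 a b -> weak_solution f u0 u1 T v ->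
  forall t, 0 <= t <= T -> cf (v t) = a t.
Proof.
move=> a0 b0 [D [Q HQ] _] weak.
have [Q' HQ'] := weak_bounded weak; have [_ _ _ _ [v0 dv0]] := weak_facts weak.
have z0T : 0 <= (0 : R) <= T by rewrite lexx ltW.
have Q0 := bdE_ge0 (HQ 0 z0T); have Q'0 := bdE_ge0 (HQ' 0 z0T).
pose M := Q + Q' + 1.
have M0 : 0 < M by rewrite ltr_wpDl// addr_ge0.
have QM : Q <= M ^+ 2 by rewrite /M; nra.
have QM' : Q' <= M ^+ 2 by rewrite /M; nra.
have [|sv cv] := weak_solves weak M0.
  by move=> t t0T; exact: bdE_le (HQ' t t0T) QM'.
have lip := trunc_damping_lip alpha m T (ltW M0).
have sa : solves T a b (fun t => trunc_damping alpha m M t (a t) (b t)).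
  move=> t /andP[t1 t2] k; have t0T : 0 <= t <= T by rewrite !ltW.
  have [D1 D2] := D t k; split => //; move: D2; rewrite clamp_id//.
  by have [_ ->] := damping_trunc alpha m t M0 (bdEl (HQ t t0T)) QM (bdEr (HQ t t0T)).
move=> t t0T.
have [] := picard_unique (s := 0) (B := M ^+ 2) T0 lip sv sa cv (isd_contT D T) _ _ _ t0T.
- by rewrite v0.
- by rewrite dv0.
- by move=> r r0T; split; [exact: bdE_le (HQ' r r0T) QM'|exact: bdE_le (HQ r r0T) QM].
- by [].
Qed.

End weak_uniqueness.

(** * Existence of weak solutions and the theorem *)

Section weak_existence.
Context (R : realType).
Local Notation mu := (@muO R).
Variables (alpha T : R) (m : nat).
Hypotheses (alpha0 : 0 <= alpha) (T0 : 0 < T).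
Variables (a b : R -> nat -> R).
Hypothesis sol : damped_sol alpha m T 0 a b.
Implicit Types (t r e : R) (k N : nat).

Let f (x : R) : R := alpha * x ^+ (2 * m).
Let u t := syn (a t).
Let du := tderiv L2 T u.

Let bound : exists2 Q, 0 <= Q & forall t, 0 <= t <= T -> bdE 0 (a t) (b t) Q.
Proof.
have [_ [Q HQ] _] := sol; exists Q => //.
exact: (bdE_ge0 (HQ 0 (introT andP (conj (lexx 0) (ltW T0))))).
Qed.

Let u_facts t : 0 <= t <= T -> [/\ L2 (u t), cf (u t) = a t, L2 (du t) & cf (du t) = b t].
Proof.
move=> t0T; have [Q Q0 HQ] := bound.
have Lu r : 0 <= r <= T -> L2 (u r) /\ cf (u r) = a r by move=> /HQ/bdEl/synP.
have [] := @dercf_tderiv R T T0 L2 0 (@level_L2 R) u b.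
- by move=> r /Lu[].
- by apply: (dercf_ext _ _ (dercf_ab sol)) => // r /Lu[_ ->].
- by move=> r r0T; exists Q; exact: bdEr (HQ r r0T).
by move=> _ /(_ t t0T)[L E]; have [L1 E1] := Lu t t0T; split.
Qed.

Let g t := damping alpha m (a t) (b t).

Let g_facts : [/\ forall t, 0 <= t <= T -> L2 (fun x => f (u t x) * du t x) /\
   cf (fun x => f (u t x) * du t x) = g t,
   exists2 B, 0 <= B & forall t, 0 <= t <= T -> bd 0 (g t) B & ucont1 0 T g].
Proof.
have [Q Q0 HQ] := bound.
have M0 : 0 < Q + 1 by rewrite ltr_wpDl.
have MQ : Q <= (Q + 1) ^+ 2 by nra.
have GT t (t0T : 0 <= t <= T) := damping_trunc alpha m t M0 (bdEl (HQ t t0T)) MQ (bdEr (HQ t t0T)).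
split.
- move=> t t0T; have [Lu Eu Ld Ed] := u_facts t0T; have [Lp _] := GT t t0T.
  have E : {ae mu, forall x, f (u t x) * du t x = alpha * syn (a t) x ^+ (2 * m) * syn (b t) x}.
    by apply: aeOS (syn_cf Ld) => x; rewrite Ed => ->.
  have Lf : L2 (fun x => f (u t x) * du t x).
    apply: (L2_ae _ Lp E); apply: measurable_funM; last exact: L2_meas.
    by apply: measurable_damping_factor; exact: L2_meas.
  by split => //; exact: cf_ae E.
- have [K K0 HK] := trunc_damping_growth alpha m T (ltW M0).
  exists (K * Q); first exact: mulr_ge0.
  by move=> t t0T; have [_ E] := GT t t0T; rewrite /g E; apply: HK => //; exact: HQ.
- have [_ _ U] := sol.
  have H := forcing_ucont (trunc_damping_lip alpha m T (ltW M0)) (trunc_damping_time alpha m (Q + 1) T) HQ U.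
  move=> e e0; have [d d0 Hd] := H e e0; exists d => // t r t0T r0T tr.
  have := Hd t r t0T r0T tr; rewrite !clamp_id//.
  by have [_ <-] := GT t t0T; have [_ <-] := GT r r0T.
Qed.

Section test_function.
Variable phi : R -> R.
Hypothesis Hphi : H10 phi.

Let p k := cf phi k.
Let P := ip1 phi phi + 1.
Let P0 : 0 < P. Proof. by rewrite ltr_wpDl// ip0_ge0. Qed.
Let Lphi : L2 phi. Proof. by case: Hphi => -[]. Qed.
Let bdp : bd 1 p P. Proof. by apply: (bd_le (H10_bd Hphi)); rewrite lerDl. Qed.
Let bdp0 : bd 0 p P. Proof. exact: bd_anti bdp. Qed.

Let D_ N t := \sum_(k < N) b t k * p k.
Let d_ N t := \sum_(k < N) (- om k ^+ 2 * a t k - g t k) * p k.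
Let d t := - ip1 (u t) phi - ip0 (fun x => f (u t x) * du t x) phi.

Let DD N t : 0 <= t <= T -> is_derive t 1 (D_ N) (d_ N t).
Proof.
move=> t0T; apply: isd_sum => k _; have [D _ _] := sol; have [_ Db] := D t k.
rewrite clamp_id// in Db.
apply: (isd_eq (isdM Db (isd_cst (p k) t))); rewrite /g; ring.
Qed.

Let D_cvg t : 0 <= t <= T -> D_ N t @[N --> \oo] --> ip0 (du t) phi.
Proof.
by move=> t0T; have [_ _ Ld Ed] := u_facts t0T; have := parseval Ld Lphi; rewrite Ed.
Qed.

Let d1 N t := \sum_(k < N) (om k ^+ 1 * a t k) * (om k ^+ 1 * p k).
Let d2 N t := \sum_(k < N) (om k ^+ 0 * g t k) * (om k ^+ 0 * p k).

(** The eigenvalue is shared between the solution and the test function, which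
is what phi in H^1_0 allows. *)
Let d_split N t : d_ N t = - d1 N t - d2 N t.
Proof.
rewrite /d_ /d1 /d2 -!sumrN -big_split; apply: eq_bigr => k _ /=.
rewrite expr1 !expr0; ring.
Qed.

Let d_cvg t : 0 <= t <= T -> d_ N t @[N --> \oo] --> d t.
Proof.
move=> t0T; have [Lu Eu Ld Ed] := u_facts t0T.
have [Q _ HQ] := bound; have [Hg _ _] := g_facts; have [Lf Ef] := Hg t t0T.
have Hu : H10 (u t).
  by have [] := @bd_H10 R (u t) Q Lu; rewrite ?Eu//; exact: bdEl (HQ t t0T).
under eq_fun do rewrite d_split; apply: cvgB.
  apply: cvgN; have := ip1_lim Hu Hphi; rewrite Eu.
  by apply: cvg_trans; apply: near_eq_cvg; apply: nearW => N; apply: eq_bigr => k _; rewrite expr1.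
have := parseval Lf Lphi; rewrite Ef.
by apply: cvg_trans; apply: near_eq_cvg; apply: nearW => N; apply: eq_bigr => k _; rewrite expr0 !mul1r.
Qed.

(** By [pairing_diff], since the solution and the damping are uniformly
continuous in time. *)
Let d_equi t e : 0 < t < T -> 0 < e -> exists2 del, 0 < del & forall N r, 0 < r < T ->
  `|r - t| < del -> `|d_ N r - d_ N t| <= e.
Proof.
move=> /andP[t0 tT] e0; have [Q Q0 HQ] := bound; have [_ [B B0 HB] gu] := g_facts; have [_ _ U] := sol.
have eta0 : 0 < (e / 2) ^+ 2 / P by rewrite divr_gt0// exprn_gt0// divr_gt0.
have [e1 e10 H1] := U _ eta0; have [e2 e20 H2] := gu _ eta0.
exists (Num.min e1 e2); first by rewrite lt_min e10.
move=> N r /andP[r0 rT]; rewrite lt_min => /andP[h1 h2].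
have t0T : 0 <= t <= T by rewrite !ltW.
have r0T : 0 <= r <= T by rewrite !ltW.
have K1 := bdEl (H1 _ _ r0T t0T h1); have K2 := H2 _ _ r0T t0T h2.
rewrite /bd in K1 K2.
rewrite (_ : (fun k => _) = (fun k => om k ^+ 1 * a r k - om k ^+ 1 * a t k)) in K1; last first.
  by apply/funext => k; rewrite mulrBr.
rewrite (_ : (fun k => _) = (fun k => om k ^+ 0 * g r k - om k ^+ 0 * g t k)) in K2; last first.
  by apply/funext => k; rewrite mulrBr.
have Z s : ssq (fun k => om k ^+ s * p k - om k ^+ s * p k) 0.
  by under eq_fun do rewrite subrr; exact: ssq0.
have J1 := pairing_diff N (bdEl (HQ r r0T)) bdp K1 (Z 1%N).
have J2 := pairing_diff N (HB r r0T) bdp0 K2 (Z 0%N).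
move: J1 J2; rewrite !mulr0 sqrtr0 !add0r -/(d1 N r) -/(d1 N t) -/(d2 N r) -/(d2 N t).
have -> : (e / 2) ^+ 2 / P * P = (e / 2) ^+ 2 by field; rewrite gt_eqF.
rewrite sqrtr_sqr (@ger0_norm _ (e / 2)); last by rewrite divr_ge0// ltW.
move=> J1 J2; have -> : d_ N r - d_ N t = - (d1 N r - d1 N t) - (d2 N r - d2 N t).
  by rewrite !d_split; ring.
apply: le_trans (ler_normB _ _) _; rewrite normrN; lra.
Qed.

Let d_bounded : exists2 C, 0 <= C & forall N t, 0 <= t <= T -> `|d_ N t| <= C.
Proof.
have [Q Q0 HQ] := bound; have [_ [B B0 HB] _] := g_facts.
exists (Num.sqrt (Q * P) + Num.sqrt (B * P)); first by rewrite addr_ge0.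
have W (x A : R) : x ^+ 2 <= A -> `|x| <= Num.sqrt A by move=> H; rewrite -sqrtr_sqr ler_wsqrtr.
move=> N t t0T; rewrite d_split; apply: le_trans (ler_normB _ _) _; rewrite normrN.
have h1 := ssq_CS 0 N (bdEl (HQ t t0T)) bdp; have h2 := ssq_CS 0 N (HB t t0T) bdp0.
by apply: lerD; apply: W; rewrite /d1 /d2 -[X in X ^+ 2](big_mkord xpredT (fun k => (om k ^+ _ * _ k) * (om k ^+ _ * p k))).
Qed.

(** The partial sums have derivatives bounded uniformly in t and N, so the
limit is Lipschitz. *)
Lemma pairing_ac : abs_continuous 0 T (fun t => ip0 (du t) phi).
Proof.
have [C C0 HC] := d_bounded; apply: (lipschitz_ac C0) => x y x0 xy yT.
have x0T : 0 <= x <= T by rewrite x0 (le_trans xy yT).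
have y0T : 0 <= y <= T by rewrite yT (le_trans x0 xy).
have cv : `|D_ N y - D_ N x| @[N --> \oo] --> `|ip0 (du y) phi - ip0 (du x) phi|.
  by apply: cvg_norm; apply: cvgB; exact: D_cvg.
rewrite -(cvg_lim (@Rhausdorff R) cv); apply: limr_le; first by apply/cvg_ex; eexists; exact: cv.
apply: nearW => N; move: xy; rewrite le_eqVlt => /predU1P[->|xy]; first by rewrite !subrr normr0 mulr0.
have DI w : x <= w <= y -> is_derive w 1 (D_ N) (d_ N w).
  by move=> /andP[w1 w2]; apply: DD; rewrite (le_trans x0 w1) (le_trans w2 yT).
have DJ w : x < w < y -> is_derive w 1 (D_ N) (d_ N w).
  by move=> /andP[w1 w2]; apply: DI; rewrite !ltW.
have [w [/andP[w1 w2] ->]] := MVT_isd xy DJ (isd_within (f := d_ N) DI).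
rewrite normrM (@gtr0_norm _ (y - x)) ?subr_gt0// ler_wpM2r ?subr_ge0 ?(ltW xy)//.
by apply: HC; rewrite (le_trans x0 (ltW w1)) (le_trans (ltW w2) yT).
Qed.

(** The weak equation holds at every interior time: differentiate the partial
sums mode by mode and pass to the limit. *)
Lemma pairing_equation t : 0 < t < T -> derivable (fun s => ip0 (du s) phi) t 1 /\
  derive1 (fun s => ip0 (du s) phi) t + ip1 (u t) phi + ip0 (fun x => f (u t x) * du t x) phi = 0.
Proof.
have I (r : R) : 0 < r < T -> 0 <= r <= T by move=> /andP[r0 rT]; rewrite !ltW.
move=> t0T.
have H : is_derive t 1 (fun s => ip0 (du s) phi) (d t).
  by apply: (limit_derivative (fun N r r0T => DD N (I r r0T)) (fun r r0T => D_cvg (I r r0T))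
    (fun r r0T => d_cvg (I r r0T)) d_equi t0T).
split; first exact: isd_derivable H.
by rewrite (isd_val H) /d; ring.
Qed.

End test_function.

Lemma weak_existence (u0 u1 : R -> R) : L2 u0 -> L2 u1 -> a 0 = cf u0 -> b 0 = cf u1 ->
  weak_solution f u0 u1 T u.
Proof.
move=> Lu0 Lu1 a0 b0.
have Lu t : 0 <= t <= T -> L2 (u t) by move=> /u_facts[].
have Eu t : 0 <= t <= T -> a t = cf (u t) by move=> /u_facts[].
have z0T : 0 <= (0 : R) <= T by rewrite lexx ltW.
split.
- split.
    by apply: (Cj_Ckcf T0 (@level_L2 R) Lu); apply: (Ckcf_ext Eu (Ckcf_solution T0 sol (leqnn 1))).
  by apply: (Cj_Ckcf T0 (@level_H10 R) Lu); apply: (Ckcf_ext Eu (Ckcf_solution T0 sol (leq0n 1))).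
- have [L1 E1 L2' E2] := u_facts z0T.
  have H1 : {ae mu, forall x, u 0 x = u0 x} by apply: cf_inj => //; rewrite E1.
  have H2 : {ae mu, forall x, du 0 x = u1 x} by apply: cf_inj => //; rewrite E2.
  by apply: aeOS2 H1 H2 => x; split.
- by move=> phi Hphi; exact: pairing_ac.
- by move=> phi Hphi; apply: aeW => t; rewrite in_itv; exact: pairing_equation.
Qed.

End weak_existence.

Theorem theorem3p1 (R : realType) (alpha : R) (m n : nat) (u0 u1 : R -> R)
    (halpha : 0 < alpha) (hm : (0 < m)%N) (hdata : Hdata n u0 u1)
    (T : R) (hT : 0 < T) :
  let f := fun s : R => alpha * s ^+ (2 * m) in
  exists u : R -> R -> R,
    [/\ weak_solution f u0 u1 T u,
        forall v : R -> R -> R, weak_solution f u0 u1 T v ->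
          forall t, t \in `[0, T] -> {ae @muO R, forall x, v t x = u t x},
        regular n T u,
        S_space T n u &
        forall j, (j <= n)%N -> Cj (DA ((n.+1 - j)%:R / 2)) T j u].
Proof.
move=> f; have [D0 D1] := hdata.
have lev s := level_DA R s.
have [Lu0 [B0 HB0]] := ((let: And3 P _ _ := lev n.+1 in P) u0).1 D0.
have [Lu1 [B1 HB1]] := ((let: And3 P _ _ := lev n in P) u1).1 D1.
have [a [b [a0 b0 sol]]] := existence_every_level m (ltW halpha) hT (bdE_intro HB0 HB1).
have [D [Q HQ] U] := sol.
have sol0 : damped_sol alpha m T 0 a b.
  split => //; first by exists Q => t t0T; exact: bdE_anti (leq0n n) (HQ t t0T).
  by move=> e e0; have [d d0 H] := U e e0; exists d => // t r t0T r0T tr; exact: bdE_anti (leq0n n) (H _ _ t0T r0T tr).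
have W : weak_solution f u0 u1 T (fun t => syn (a t)) by exact: (weak_existence hT sol0 Lu0 Lu1 a0 b0).
have Lu t : 0 <= t <= T -> L2 (syn (a t)) /\ cf (syn (a t)) = a t.
  by move=> /HQ/bdEl/synP.
have S : S_space T n (fun t => syn (a t)).
  move=> j jn; apply: (Cj_Ckcf hT (lev _)); first by move=> t /Lu[].
  by apply: (Ckcf_ext _ (Ckcf_solution hT sol jn)) => t /Lu[_ ->].
exists (fun t => syn (a t)); split; [exact: W| | |exact: S|].
- move=> v Wv t; rewrite in_itv => t0T; have [L E] := Lu t t0T.
  have [LL _ _ _ _] := weak_facts hT Lu0 Lu1 Wv; have [Lv _] := LL t t0T.
  by apply: cf_inj => //; rewrite E; exact: (weak_unique hT Lu0 Lu1 a0 b0 sol0 Wv t0T).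
- split; first exact: (S 0%N (leq0n _)).
  have Db := dercf_ab sol0.
  have [_ Ed] : (forall t, 0 <= t <= T -> exists w, is_tderiv L2 T (fun t => syn (a t)) t w) /\
     (forall t, 0 <= t <= T -> L2 (tderiv L2 T (fun t => syn (a t)) t) /\ cf (tderiv L2 T (fun t => syn (a t)) t) = b t).
    apply: (dercf_tderiv hT (@level_L2 R)).
    - by move=> t /Lu[].
    - by apply: (dercf_ext _ _ Db) => // t /Lu[_ ->].
    - by move=> t t0T; exists Q; exact: bdEr (bdE_anti (leq0n n) (HQ t t0T)).
  apply: (Cj_Ckcf hT (lev n)); first by move=> t /Ed[].
  have Cb : Ckcf T n 0 b.
    move=> t t0T; split; first by exists Q; exact: bdEr (HQ t t0T).
    by move=> e e0; have [d d0 H] := U e e0; exists d => // r r0T rt; exact: bdEr (H _ _ r0T t0T rt).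
  by apply: (Ckcf_ext _ Cb) => t /Ed[_ ->].
- by move=> j jn; apply: S; exact: leqW.
Qed.
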